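(* Let $(F_n)_{n\ge 0}$ be the Fibonacci sequence, $F_0=0$, $F_1=1$, $F_{n+2}=F_{n+1}+F_n$. For a prime $p$ and an integer $c$ put $$m_{F,p}(c):=\#\{(k,\ell)\in\mathbb{Z}^2:\ k\ge 2,\ \ell\ge 0,\ c=F_k-p^{\ell}\}.$$ Then $m_{F,p}(c)\le 4$ for every prime $p$ and every integer $c$. *)

(* Defs.v *)
From mathcomp Require Import all_boot all_algebra.
Set Implicit Arguments. Unset Strict Implicit. Unset Printing Implicit Defensive.
Import GRing.Theory Num.Theory.
Local Open Scope ring_scope.

Fixpoint fib (n : nat) : nat :=
  match n with
  | 0 => 0
  | 1 => 1
  | (m.+1 as n').+1 => fib n' + fib m
  end%N.

Definition is_rep (p : nat) (c : int) (kl : nat * nat) : bool :=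
  (2 <= kl.1)%N && (c == (fib kl.1)%:Z - (p ^ kl.2)%:Z).

(* Main.v *)
(* Suppose that there were five solutions k_1 < ... < k_5, l_1 < ... < l_5, and let phi be the golden
   ratio.  For c <> 0 three estimates interact.
   (1) For a single solution, phi^k is p-adically close to a root rho of X^2 - sqrt 5 c X - (-1)^k.
       Some power phi^g with g = O(p) is p-adically close to 1, so an interpolation determinant in
       the numbers phi^r rho^s is highly divisible by p, and comparing with its archimedean size
       gives k = O(p log |c|).
   (2) Three solutions with p^l large compared with |c| give a nontrivial relation between powers
       of phi^k_i / (sqrt 5 p^l_i), which are close to 1; since phi^M is never close to 1 unless
       M = 0, the exponents must differ by at least p^l / (13 |c|).
   (3) Eliminating c from three solutions gives nonzero elements of Z[phi] that are small in one
       embedding; their norm is at least 1, which bounds F_k_1 and F_k_2 by powers of p.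
   Together they bound p^l_3, and for p >= 10^4 leave only a few possibilities for l_1, l_2, l_3,
   uniformly in p.  For such p, (F_k_2 - F_k_1)^l_3 / F_k_3^l_2 is nearly 1, which amounts to
   (1 - phi^-g)^l_3 being close to sqrt 5^d phi^N with g = k_2 - k_1 and d = l_3 - l_2, and this is
   refuted numerically.  For p <= 10^4 all possible triples are enumerated. *)
From Stdlib Require Import BinNat Nnat.
From HB Require Import structures.
Require Import Defs.
From mathcomp Require Import all_boot all_order all_fingroup all_algebra.
From mathcomp Require Import realalg.
From mathcomp Require Import zify ring lra.
Set Implicit Arguments. Unset Strict Implicit. Unset Printing Implicit Defensive.
Import Order.TTheory GRing.Theory Num.Theory.
Local Open Scope ring_scope.

(** * Interpolation determinants *)

(** Five solutions are what the method needs. The code numbers them from 0 to 4. The last three,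
    through (1) and (2), bound p^l_2 by a constant times p (33 + v) |c|, where v is a logarithm of a
    bound for |c|; the first three, through (3), bound |c|, or p^l_1 when c < 0, by products of
    powers of p. The two meet in l_2. Estimate (1) is an explicit, elementary substitute for lower
    bounds of linear forms in p-adic logarithms. It loses a factor p, the order of the period of phi
    modulo p, and a large constant. Only when p is large against that constant do the exponents
    become bounded by absolute small numbers; this is why the smaller primes need an enumeration.
    For c < 0 one has |c| < p^l_0, so F_k_1 and F_k_2 are themselves nearly powers of p. For c > 0
    the size of c may reach 2 p^l_1, only the difference F_k_1 - F_k_0 is usable, and the free
    parameter g forces a numerical table. Outside this scheme stand c = 0, settled by divisibility
    of Fibonacci numbers, and p = 2 with c = 1 or c = -3, where three solutions do exist and
    congruences exclude more. *)

Lemma uniq_sumn_ge (s : seq nat) : uniq s -> ('C(size s, 2) <= sumn s)%N.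
Proof.
elim: {s}(size s) {-2}s (erefl (size s)) => [|n IH] s sz us; first by rewrite sz bin_small.
have [x xs nx] : exists2 x, x \in s & (n <= x)%N.
  apply/hasP; rewrite -[has _ _]negbK -all_predC; apply/negP => /allP h.
  have /(uniq_leq_size us) : {subset s <= iota 0 n}.
    by move=> y /h /=; rewrite -ltnNge mem_iota.
  by rewrite size_iota sz ltnn.
have := IH (rem x s); rewrite size_rem // sz => /(_ erefl (rem_uniq _ us)).
have /perm_sumn -> := perm_to_rem xs.
by rewrite binS bin1 /= => h; lia.
Qed.

(** Write q i - i as (q i - K) + (K - 1 - i) + 1. The first two terms take distinct values as i runs
    over D, so each sums to at least 'C(d, 2) with d = #|D|, and d (d - 1) + d = d^2. *)
Lemma sum_gap_ge (K : nat) (D : {set 'I_K}) (q : 'I_K -> nat) :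
  {in D &, injective q} -> (forall i, i \in D -> (K <= q i)%N) ->
  (#|D| ^ 2 <= \sum_(i in D) (q i - i))%N.
Proof.
move=> qI qK.
have sumE (f : 'I_K -> nat) : \sum_(i in D) f i = sumn [seq f i | i <- enum D].
  by rewrite sumnE big_map big_enum.
have h1 : ('C(#|D|, 2) <= \sum_(i in D) (q i - K))%N.
  rewrite sumE; have <- : size [seq (q i - K)%N | i <- enum D] = #|D| by rewrite size_map -cardE.
  apply: uniq_sumn_ge; rewrite map_inj_in_uniq ?enum_uniq // => i j.
  rewrite !mem_enum => iD jD e; apply: qI => //.
  by have := qK _ iD; have := qK _ jD; lia.
have h2 : ('C(#|D|, 2) <= \sum_(i in D) (K.-1 - i))%N.
  rewrite sumE; have <- : size [seq (K.-1 - i)%N | i : 'I_K <- enum D] = #|D|.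
    by rewrite size_map -cardE.
  apply: uniq_sumn_ge; rewrite map_inj_uniq ?enum_uniq // => i j e.
  by apply/val_inj => /=; have := ltn_ord i; have := ltn_ord j; lia.
have -> : \sum_(i in D) (q i - i)%N
   = (\sum_(i in D) (q i - K) + \sum_(i in D) (K.-1 - i) + #|D|)%N.
  rewrite -sum1_card -!big_split /=; apply: eq_bigr => i iD.
  by have := qK _ iD; have := ltn_ord i; lia.
rewrite bin2 in h1 h2; have := half_bit_double (#|D| * #|D|.-1) false.
have e : odd (#|D| * #|D|.-1) = false by case: #|D| => //= n; rewrite oddM /= andbC; case: (odd n).
have := odd_double_half (#|D| * #|D|.-1); rewrite e add0n => e2 _.
by case: #|D| h1 h2 e2 => [|n] //=; nia.
Qed.

(** Multilinearity in the rows, that is Cauchy-Binet before the selections are grouped. No grouping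
    is wanted, since the summands are estimated one by one. *)
Lemma det_sum_rows (A : comNzRingType) (n : nat) (I : finType)
    (C : 'I_n -> I -> A) (B : I -> 'I_n -> A) :
  \det (\matrix_(i, j) \sum_q C i q * B q j) =
  \sum_(f : {ffun 'I_n -> I}) (\prod_i C i (f i)) * \det (\matrix_(i, j) B (f i) j).
Proof.
rewrite /determinant.
transitivity (\sum_(s : 'S_n) \sum_(f : {ffun 'I_n -> I})
    (-1) ^+ s * ((\prod_i C i (f i)) * \prod_i B (f i) (s i))).
  apply: eq_bigr => s _; rewrite -big_distrr /=; congr (_ * _).
  under eq_bigr => i _ do rewrite mxE.
  by rewrite bigA_distr_bigA /=; apply: eq_bigr => f _; rewrite big_split.
rewrite exchange_big /=; apply: eq_bigr => f _.
rewrite big_distrr /=; apply: eq_bigr => s _.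
by rewrite mulrCA; congr (_ * (_ * _)); apply: eq_bigr => i _; rewrite mxE.
Qed.

Lemma bin_mul_bin (t i h : nat) :
  ('C(t, i) * 'C(t - i, h) = 'C(i + h, i) * 'C(t, i + h))%N.
Proof.
have [le|lt] := leqP (i + h) t; last first.
  rewrite (bin_small lt) muln0.
  have [ti|it] := ltnP t i; first by rewrite bin_small.
  by rewrite (@bin_small (t - i)) ?muln0 //; lia.
have it : (i <= t)%N by lia.
have h1 := bin_fact it; have h2 := @bin_fact (t - i) h ltac:(lia).
have h3 := bin_fact le; have h4 := bin_fact (leq_addr h i).
rewrite addKn in h4; rewrite -subnDA in h2.
apply/eqP; rewrite -(@eqn_pmul2r (i`! * h`! * (t - (i + h))`!)) ?muln_gt0 ?fact_gt0 //; apply/eqP.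
transitivity t`!; first by rewrite -h1 -h2; ring.
by rewrite -h3 -h4; ring.
Qed.

(** In the basis of the 'C(t, q), the function 'C(t, i) (1 + x)^t of t has coefficients divisible by
    x^(q - i). With x = P g this produces the powers of P in [idet_expansion]. *)
Lemma bin_mul_exp (A : comNzRingType) (x : A) (t i Q : nat) : (t < Q)%N ->
  'C(t, i)%:R * (1 + x) ^+ t =
  \sum_(q < Q) ((1 + x) ^+ i * 'C(q, i)%:R * x ^+ (q - i)) * 'C(t, q)%:R.
Proof.
move=> tQ; have [it|it] := leqP i t; last first.
  rewrite bin_small // mul0r big1 // => q _.
  have [qi|qi] := ltnP q i; first by rewrite (bin_small qi) !(mulr0, mul0r).
  by rewrite (bin_small (leq_trans it qi)) mulr0.
rewrite -{2}(subnKC it) exprD (exprDn 1 x (t - i)).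
pose F (q : nat) := ((1 + x) ^+ i * 'C(q, i)%:R * x ^+ (q - i)) * 'C(t, q)%:R.
have -> : \sum_(q < Q) (1 + x) ^+ i * 'C(q, i)%:R * x ^+ (q - i) * 'C(t, q)%:R
   = \sum_(0 <= q < Q) F q by rewrite big_mkord.
rewrite (@big_cat_nat _ _ _ i) /= ?(leq_trans it (ltnW tQ)) //.
rewrite [X in _ = X + _]big_nat [X in _ = X + _]big1 ?add0r; last first.
  by move=> q /andP[_ qi]; rewrite /F (bin_small qi) !(mulr0, mul0r).
rewrite (@big_cat_nat _ _ _ t.+1) /= ?(leqW it) //.
rewrite [X in _ = _ + X]big_nat [X in _ = _ + X]big1 ?addr0; last first.
  by move=> q /andP[tq _]; rewrite /F (bin_small tq) mulr0.
have := big_addn 0 t.+1 i xpredT F; rewrite add0n => ->.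
rewrite subSn // big_mkord mulrCA !big_distrr /= {}/F.
apply: eq_bigr => h _; rewrite expr1n mul1r addnK -mulr_natl.
have := bin_mul_bin t i h; rewrite [(i + h)%N]addnC => /(congr1 (fun n => n%:R : A)).
rewrite !natrM => e.
transitivity ((1 + x) ^+ i * (('C(t, i)%:R * 'C(t - i, h)%:R) * x ^+ h)); first by ring.
by rewrite e; ring.
Qed.

(** An interpolation determinant at the points (t j, u j). Binomial coefficients take the place of
    powers of t: over a field of characteristic 0 they span the same polynomials, but they are
    smaller and re-expand with integral coefficients. *)
Definition bdet (A : comNzRingType) (K : nat) (t : 'I_(K + K) -> nat)
    (u : 'I_(K + K) -> A) : A :=
  \det (col_mx (\matrix_(i < K, j < K + K) 'C(t j, i)%:R)
               (\matrix_(i < K, j < K + K) ('C(t j, i)%:R * u j))).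

Section InterpolationDeterminant.
Variables (A : comNzRingType) (K : nat) (P g mu : A) (t s : 'I_(K + K) -> nat).

Definition idet : A := bdet t (fun j => (1 + P * g) ^+ t j * (1 + mu) ^+ s j).

Let J (y : A) := exists xi : nat -> A,
  y = \sum_(m < K.+1) mu ^+ m * P ^+ ((K - m) ^ 2) * xi m.

Let J0 : J 0.
Proof. by exists (fun=> 0); rewrite big1 // => m _; rewrite mulr0. Qed.

Let JD y z : J y -> J z -> J (y + z).
Proof.
move=> [a ->] [b ->]; exists (fun m => a m + b m).
by rewrite -big_split /=; apply: eq_bigr => m _; rewrite mulrDr.
Qed.

Let Jsum (I : finType) (F : I -> A) : (forall i, J (F i)) -> J (\sum_i F i).
Proof. by move=> h; apply: (big_ind J). Qed.

Let Jterm m z : (m <= K)%N -> J (mu ^+ m * P ^+ ((K - m) ^ 2) * z).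
Proof.
move=> mK; exists (fun i => if i == m then z else 0).
rewrite (bigD1 (inord m)) //= inordK // eqxx big1 ?addr0 // => i.
by rewrite -val_eqE /= inordK // => /negPf ->; rewrite mulr0.
Qed.

(** As (1 + mu)^s is 1 plus a multiple of mu, each lower row is a combination of rows 'C(t j, q)
    with coefficients divisible by P^(q - i), and of mu times another row. If m lower rows take the
    mu part, the other K - m need distinct q, all at least K because the upper rows already occupy q
    < K; [sum_gap_ge] then gives the exponent (K - m)^2. *)
Lemma idet_expansion : exists xi : nat -> A,
  idet = \sum_(m < K.+1) mu ^+ m * P ^+ ((K - m) ^ 2) * xi m.
Proof.
pose T := \max_j t j; pose Q := (T + K).+1.
have tQ j : (t j < Q)%N by rewrite ltnS (leq_trans (leq_bigmax j)) ?leq_addr.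
have KQ i : (i < K)%N -> (i < Q)%N by rewrite /Q; lia.
pose w j := (\sum_(i < s j) (1 + mu) ^+ i).
have wE j : (1 + mu) ^+ s j = 1 + mu * w j.
  by rewrite -[LHS](subrK 1) subrX1 addrC {1}[1 + mu]addrC addrK.
pose B (q : 'I_Q + 'I_K) (j : 'I_(K + K)) : A := match q with
  | inl q => 'C(t j, q)%:R
  | inr i => 'C(t j, i)%:R * (1 + P * g) ^+ t j * w j end.
pose C (i : 'I_(K + K)) (q : 'I_Q + 'I_K) : A := match split i, q with
  | inl i, inl q => (i == q :> nat)%:R
  | inl _, inr _ => 0
  | inr i, inl q => (1 + P * g) ^+ i * 'C(q, i)%:R * (P * g) ^+ (q - i)
  | inr i, inr i' => (i == i')%:R * mu end.
have sumQ (F : 'I_Q + 'I_K -> A) : \sum_q F q = \sum_q F (inl q) + \sum_q F (inr q).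
  exact: big_sumType.
have -> : idet = \det (\matrix_(i, j) \sum_q C i q * B q j).
  congr (\det _); apply/matrixP => i j; rewrite !mxE sumQ /C.
  case: split => i'; rewrite mxE /=.
    rewrite [X in _ + X]big1 ?addr0; last by move=> q _; rewrite mul0r.
    rewrite (bigD1 (Ordinal (KQ _ (ltn_ord i')))) //= eqxx mul1r big1 ?addr0 // => q.
    by rewrite -val_eqE /= eq_sym => /negPf ->; rewrite mul0r.
  rewrite -(bin_mul_exp _ _ (tQ j)) (bigD1 i') //= eqxx mul1r big1 ?addr0; last first.
    by move=> q /negPf qi; rewrite eq_sym qi !mul0r.
  by rewrite wE; ring.
rewrite det_sum_rows; apply: Jsum => f.
have [fI|] := boolP (injectiveb f); last first.
  move/injectivePn => [i [j ij e]].
  by rewrite (determinant_alternate ij) ?mulr0 // => x; rewrite !mxE e.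
have {fI} fI := injectiveP _ fI.
have [up|] := boolP [forall i : 'I_K, f (lshift K i) == inl (Ordinal (KQ _ (ltn_ord i)))];
    last first.
  rewrite negb_forall => /existsP[i hi].
  rewrite (bigD1 (lshift K i)) //= /C (unsplitK (inl i)).
  case: (f _) hi => [q|q] hi; last by rewrite !mul0r.
  suff -> : (i == q :> nat) = false by rewrite !mul0r.
  by apply: contraNF hi => /eqP e; apply/eqP; congr inl; apply: val_inj.
have {}up i := eqP (forallP up i).
pose D := [set i : 'I_K | if f (rshift K i) is inl _ then true else false].
pose q (i : 'I_K) : nat := if f (rshift K i) is inl q then q else 0%N.
have qI : {in D &, injective q}.
  move=> i j; rewrite !inE /q; case ei: (f _) => [a|] //; case ej: (f _) => [b|] // _ _ e.
  by apply: (@rshift_inj K); apply: fI; rewrite ei ej; congr inl; apply: val_inj.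
have qK i : i \in D -> (K <= q i)%N.
  rewrite inE /q; case ei: (f _) => [a|] // _; rewrite leqNgt; apply/negP => aK.
  have := up (Ordinal aK); rewrite (_ : inl _ = f (rshift K i)).
    by move/fI/eqP; rewrite eq_lrshift.
  by rewrite ei; congr inl; apply: val_inj.
have gap := sum_gap_ge qI qK.
have DK : (#|D| <= K)%N by rewrite -[X in (_ <= X)%N](card_ord K) max_card.
have [z ->] : exists z, \prod_i C i (f i)
    = mu ^+ (K - #|D|) * P ^+ (\sum_(i in D) (q i - i)) * z; last first.
  rewrite -(subnK gap) exprD.
  have -> : P ^+ (#|D| ^ 2) = P ^+ ((K - (K - #|D|)) ^ 2) by rewrite subKn.
  set m := (K - #|D|)%N; set e := (_ - _)%N; set d := \det _.
  have -> : mu ^+ m * (P ^+ e * P ^+ ((K - m) ^ 2)) * z * d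
     = mu ^+ m * P ^+ ((K - m) ^ 2) * (P ^+ e * z * d) by ring.
  by apply: Jterm; rewrite leq_subr.
rewrite big_split_ord /= big1 ?mul1r; last first.
  by move=> i _; rewrite up /C (unsplitK (inl i)) eqxx.
pose zz (i : 'I_K) := match f (rshift K i) with
  | inl q => (1 + P * g) ^+ i * 'C(q, i)%:R * g ^+ (q - i)
  | inr i' => (i == i')%:R end.
exists (\prod_i zz i).
have -> : mu ^+ (K - #|D|) * P ^+ (\sum_(i in D) (q i - i))
    = \prod_(i < K) (if i \in D then P ^+ (q i - i) else mu).
  rewrite [RHS](bigID (mem D)) /= [RHS]mulrC; congr (_ * _).
    rewrite [RHS](eq_bigr (fun=> mu)) => [|i /negPf -> //].
    rewrite prodr_const; congr (_ ^+ _).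
    by have := cardC (mem D); rewrite card_ord => e; apply/eqP; rewrite -(eqn_add2l #|D|) subnKC // -{1}e.
  by rewrite expr_sum; apply: eq_bigr => i ->.
rewrite -big_split /=; apply: eq_bigr => i _.
rewrite /C (unsplitK (inr i)) /zz inE /q; case: (f _) => [a|i'].
  by rewrite exprMn; ring.
by ring.
Qed.
End InterpolationDeterminant.

(* Pairing terms of orders m <= m', the exponent of p is at least
   l m + E (K - m)^2 >= E (2 K m + (K - m)^2) >= E K^2. *)
Lemma idet_mul_dvd (A : comNzRingType) (K E l : nat) (p g mu mu' eta : A)
    (t s t' s' : 'I_(K + K) -> nat) :
  mu * mu' = p ^+ l * eta -> (2 * E * K <= l)%N ->
  exists z, idet (p ^+ E) g mu t s * idet (p ^+ E) g mu' t' s' = p ^+ (E * K ^ 2) * z.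
Proof.
move=> mm lEK.
have [xi ->] := idet_expansion (p ^+ E) g mu t s.
have [xi' ->] := idet_expansion (p ^+ E) g mu' t' s'.
pose D (y : A) := exists z, y = p ^+ (E * K ^ 2) * z.
have D0 : D 0 by exists 0; rewrite mulr0.
have DD x y : D x -> D y -> D (x + y) by move=> [a ->] [b ->]; exists (a + b); rewrite mulrDr.
have Dle n z : (E * K ^ 2 <= n)%N -> D (p ^+ n * z).
  by move=> h; exists (p ^+ (n - E * K ^ 2) * z); rewrite mulrA -exprD subnKC.
rewrite -/(D _) big_distrl /=; apply: (big_ind D) => // m _.
rewrite big_distrr /=; apply: (big_ind D) => // m' _.
rewrite -!exprM.
have main a b (c : A) : (a <= K)%N -> (b <= K)%N ->
    D ((mu * mu') ^+ a * p ^+ (E * (K - a) ^ 2) * p ^+ (E * (K - b) ^ 2) * c).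
  move=> aK bK.
  have -> : (mu * mu') ^+ a * p ^+ (E * (K - a) ^ 2) * p ^+ (E * (K - b) ^ 2) * c
    = p ^+ (l * a + E * (K - a) ^ 2) * (eta ^+ a * p ^+ (E * (K - b) ^ 2) * c).
    by rewrite mm exprMn -exprM exprD; ring.
  apply: Dle; have : (2 * E * K * a <= l * a)%N by rewrite leq_mul2r lEK orbT.
  have : ((K - a) ^ 2 + 2 * K * a = K ^ 2 + a ^ 2)%N.
    by have := subnK aK; set d := (K - a)%N => <-; ring.
  set x := ((K - a) ^ 2)%N; set y := (K ^ 2)%N; nia.
have [mlt|mlt] := leqP m m'.
  have := main m m' (mu' ^+ (m' - m) * xi m * xi' m') (ltn_ord m) (ltn_ord m').
  have e : mu' ^+ m' = mu' ^+ (m' - m) * mu' ^+ m by rewrite -exprD subnK.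
  by congr D; rewrite e exprMn; ring.
have := main m' m (mu ^+ (m - m') * xi m * xi' m') (ltn_ord m') (ltn_ord m).
have e : mu ^+ m = mu ^+ (m - m') * mu ^+ m' by rewrite -exprD subnK // ltnW.
by congr D; rewrite e exprMn; ring.
Qed.

Lemma bdet_morph (A B : comNzRingType) (f : {rmorphism A -> B}) K
    (t : 'I_(K + K) -> nat) (u : 'I_(K + K) -> A) :
  f (bdet t u) = bdet t (f \o u).
Proof.
rewrite /bdet -det_map_mx map_col_mx; congr (\det (col_mx _ _));
  by apply/matrixP => i j; rewrite !mxE ?rmorphM rmorph_nat.
Qed.

Lemma eq_bdet (A : comNzRingType) K (t : 'I_(K + K) -> nat) (u v : 'I_(K + K) -> A) :
  u =1 v -> bdet t u = bdet t v.
Proof.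
move=> e; rewrite /bdet; congr (\det (col_mx _ _)).
by apply/matrixP => i j; rewrite !mxE e.
Qed.

Lemma bdet_norm_le (F : realFieldType) K (t : 'I_(K + K) -> nat) (u : 'I_(K + K) -> F)
    (b : nat -> F) (U : F) :
  (forall i j, (i < K)%N -> 'C(t j, i)%:R <= b i) -> (forall j, `|u j| <= U) ->
  `|bdet t u| <= (K + K)`!%:R * ((\prod_(i < K) b i) ^+ 2 * U ^+ K).
Proof.
move=> hb hU; rewrite /bdet /determinant.
apply: (le_trans (ler_norm_sum _ _ _)).
have -> : (K + K)`!%:R * ((\prod_(i < K) b i) ^+ 2 * U ^+ K)
    = \sum_(s : 'S_(K + K)) ((\prod_(i < K) b i) ^+ 2 * U ^+ K).
  by rewrite sumr_const card_Sn mulr_natl.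
apply: ler_sum => s _; rewrite normrM normr_sign mul1r normr_prod big_split_ord /=.
rewrite expr2 -mulrA; apply: ler_pM; try by apply: prodr_ge0.
  apply: ler_prod => i _; rewrite normr_ge0 /= col_mxEu mxE normr_nat.
  exact: hb.
rewrite -[X in U ^+ X](card_ord K) -prodr_const -big_split /=.
apply: ler_prod => i _; rewrite normr_ge0 /= col_mxEd mxE normrM normr_nat.
by apply: ler_pM; rewrite ?hb.
Qed.

(** * Zero estimate: some minor does not vanish *)

Section ZeroLemma.
Variable F : numFieldType.

Definition bpoly (i : nat) : {poly F} := (i`!%:R)^-1 *: \prod_(h < i) ('X - h%:R%:P).

Lemma bpolyE i t : (bpoly i).[t%:R] = 'C(t, i)%:R.
Proof.
rewrite /bpoly hornerZ horner_prod.
under eq_bigr => h _ do rewrite hornerXsubC.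
have fi : i`!%:R != 0 :> F by rewrite pnatr_eq0 -lt0n fact_gt0.
apply: (mulfI fi); rewrite mulrA mulfV // mul1r -natrM mulnC bin_ffact.
elim: i {fi} => [|i IH]; first by rewrite big_ord0 ffactn0.
rewrite big_ord_recr /= IH ffactnSr natrM.
have [it|ti] := leqP i t; first by rewrite natrB.
by rewrite ffact_small // !mul0r.
Qed.

Lemma size_bpoly i : size (bpoly i) = i.+1.
Proof.
rewrite size_scale ?invr_eq0 ?pnatr_eq0 -?lt0n ?fact_gt0 //.
by rewrite size_prod_XsubC /index_enum -enumT size_enum_ord.
Qed.

Definition bsum K (v : 'I_K -> F) : {poly F} := \sum_i v i *: bpoly i.

Lemma bsumE K (v : 'I_K -> F) t : (bsum v).[t%:R] = \sum_i v i * 'C(t, i)%:R.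
Proof.
by rewrite horner_sum; apply: eq_bigr => i _; rewrite hornerZ bpolyE.
Qed.

Lemma size_bsum K (v : 'I_K -> F) : (size (bsum v) <= K)%N.
Proof.
apply: (leq_trans (size_sum _ _ _)); apply/bigmax_leqP => i _.
by apply: (leq_trans (size_scale_leq _ _)); rewrite size_bpoly.
Qed.

Lemma bsum_eq0 K (v : 'I_K -> F) : bsum v = 0 -> forall i, v i = 0.
Proof.
move=> e i; have [n] := ubnP i; elim: n i => // n IH i; rewrite ltnS => ni.
have := bsumE v i; rewrite e horner0 (bigD1 i) //= binn mulr1 big1 ?addr0; first by move<-.
move=> j ji; have [lt|] := ltnP j i; first by rewrite (IH j) ?mul0r // (leq_trans lt).
move=> le; rewrite bin_small ?mulr0 // ltn_neqAle le andbT eq_sym.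
by move: ji; rewrite -val_eqE.
Qed.

(* Eliminating u between (t, u) and (t + 1, a u) leaves a polynomial in t of degree at most
   2K - 2, whose leading coefficient does not vanish as a != 1. *)
Lemma bsum_zero_lemma K N (v w : 'I_K -> F) (a : F) (t : 'I_N -> nat) (u : 'I_N -> F) :
  (0 < K)%N -> (K + K <= N.+1)%N -> a != 1 -> injective t -> (forall j, u j != 0) ->
  (forall j, (bsum v).[(t j)%:R] + (bsum w).[(t j)%:R] * u j = 0) ->
  (forall j, (bsum v).[(t j).+1%:R] + (bsum w).[(t j).+1%:R] * (a * u j) = 0) ->
  bsum v = 0 /\ bsum w = 0.
Proof.
move=> K0 KN a1 tI u0 h0 h1; set P0 := bsum v in h0 h1 *; set P1 := bsum w in h0 h1 *.
have s0 : (size P0 <= K)%N := size_bsum v.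
have s1 : (size P1 <= K)%N := size_bsum w.
have roots_eq0 (p : {poly F}) : (size p <= N)%N -> (forall j, p.[(t j)%:R] = 0) -> p = 0.
  move=> sp hp; apply: contraTeq sp => p0; rewrite -ltnNge.
  have := @max_poly_roots _ p [seq (t j)%:R | j <- enum 'I_N] p0.
  rewrite size_map size_enum_ord; apply.
    by apply/allP => x /mapP[j _ ->]; rewrite /root hp.
  by rewrite map_inj_uniq ?enum_uniq // => i j /eqP; rewrite eqr_nat => /eqP/tI.
pose X1 : {poly F} := 'X + 1%:P.
have sX1 : size X1 = 2%N by rewrite size_XaddC.
pose Q := a *: (P0 * (P1 \Po X1)) - P1 * (P0 \Po X1).
have Q0 : Q = 0.
  apply: roots_eq0.
    have sm (p q : {poly F}) : (size p <= K)%N -> (size q <= K)%N ->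
        (size (p * (q \Po X1))%R <= N)%N.
      move=> sp sq; apply: (leq_trans (size_polyMleq _ _)).
      rewrite (size_comp_poly2 q sX1); have := leq_add sp sq; move: (size p) (size q) => x y; lia.
    apply: (leq_trans (size_polyD _ _)); rewrite size_polyN geq_max sm // andbT.
    by apply: (leq_trans (size_scale_leq _ _)); rewrite sm.
  move=> j; rewrite /Q hornerD hornerN hornerZ !hornerM !horner_comp hornerD hornerX hornerC.
  have := h0 j; have := h1 j; rewrite -natr1.
  set x := P0.[_ + 1]; set y := P1.[_ + 1]; set z := P0.[_]; set q := P1.[_] => e1 e2.
  apply: (mulIf (u0 j)); rewrite mul0r.
  have -> : x = - (y * (a * u j)) by apply/eqP; rewrite -addr_eq0 e1.
  have -> : z = - (q * u j) by apply/eqP; rewrite -addr_eq0 e2.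
  ring.
have : P0 * P1 = 0.
  have /eqP := Q0; rewrite subr_eq0 => /eqP/(congr1 lead_coef).
  rewrite lead_coefZ !lead_coefM !lead_coef_comp ?sX1 // lead_coefXaddC !expr1n !mulr1.
  rewrite [in RHS]mulrC => /eqP; rewrite -subr_eq0 -[X in _ - X]mul1r -mulrBl.
  rewrite mulf_eq0 subr_eq0 (negPf a1) /= => e.
  by apply/eqP; rewrite -lead_coef_eq0 lead_coefM.
move/eqP; rewrite mulf_eq0 => /orP[] /eqP e; split => //; apply: roots_eq0; try lia.
  move=> j; have := h0 j; rewrite e horner0 add0r => /eqP.
  by rewrite mulf_eq0 (negPf (u0 j)) orbF => /eqP.
by move=> j; have := h0 j; rewrite e horner0 mul0r addr0.
Qed.

(** A left kernel vector of the matrix with all m columns would give two polynomials that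
    [bsum_zero_lemma], applied to the N pairs b j, b' j, forces to vanish. So the rows are
    independent and some K + K columns carry a nonzero minor. *)
Lemma bdet_neq0 K N m (t : 'I_m -> nat) (u : 'I_m -> F) (a : F) (b b' : 'I_N -> 'I_m) :
  (0 < K)%N -> (K + K <= N.+1)%N -> a != 1 -> injective (t \o b) -> (forall j, u j != 0) ->
  (forall j, t (b' j) = (t (b j)).+1) -> (forall j, u (b' j) = a * u (b j)) ->
  exists f : 'I_(K + K) -> 'I_m, bdet (t \o f) (u \o f) != 0.
Proof.
move=> K0 KN a1 tI u0 tS uS.
pose M := col_mx (\matrix_(i < K, j < m) ('C(t j, i)%:R : F))
   (\matrix_(i < K, j < m) ('C(t j, i)%:R * u j)).
have full : row_full M^T.
  rewrite -[row_full _]/(\rank _ == _) mxrank_tr -[_ == _]/(row_free M) -kermx_eq0.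
  apply: contraT => /rowV0Pn[x /sub_kermxP xM x0].
  pose v i := lsubmx x 0 i; pose w i := rsubmx x 0 i.
  have xE j : (bsum v).[(t j)%:R] + (bsum w).[(t j)%:R] * u j = 0.
    have e : (x *m M) 0 j = 0 by rewrite xM mxE.
    rewrite -[RHS]e -[x in RHS]hsubmxK mul_row_col !mxE !bsumE; congr (_ + _).
      by apply: eq_bigr => i _; rewrite /v !mxE.
    by rewrite big_distrl; apply: eq_bigr => i _; rewrite /w !mxE mulrA.
  have [|||||j|j|v0 w0] := @bsum_zero_lemma K N v w a (t \o b) (u \o b) => //=.
    by rewrite -tS -uS.
  case/negP: x0; apply/eqP; rewrite -[x]hsubmxK.
  rewrite (_ : lsubmx x = 0); last by apply/rowP => i; have := bsum_eq0 v0 i; rewrite /v => ->; rewrite mxE.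
  rewrite (_ : rsubmx x = 0); last by apply/rowP => i; have := bsum_eq0 w0 i; rewrite /w => ->; rewrite mxE.
  by rewrite row_mx0.
exists (fullrankfun full).
have := fullrowsub_unit full; rewrite unitmxE unitfE -det_tr; congr (_ != 0).
rewrite /bdet; congr (\det _); apply/matrixP => i j; rewrite !mxE.
by case: (split i) => k; rewrite !mxE.
Qed.
End ZeroLemma.

(** * The ring Z[phi] and its two real embeddings *)

(* quad b s is R[X] / (X^2 - b X - s). *)
Record quad (R : comNzRingType) (b s : R) := Quad { qfst : R; qsnd : R }.

Section Quad.
Variables (R : comNzRingType) (b s : R).
Notation quad := (quad b s).
Notation Quad := (Quad b s).

Definition quad_pair (x : quad) := (qfst x, qsnd x).
Lemma quad_pairK : cancel quad_pair (fun x => Quad x.1 x.2). Proof. by case. Qed.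
HB.instance Definition _ := Choice.copy quad (can_type quad_pairK).

Definition quad_zero : quad := Quad 0 0.
Definition quad_opp (x : quad) : quad := Quad (- qfst x) (- qsnd x).
Definition quad_add (x y : quad) : quad := Quad (qfst x + qfst y) (qsnd x + qsnd y).
Definition quad_one : quad := Quad 1 0.
Definition quad_mul (x y : quad) : quad :=
  Quad (qfst x * qfst y + s * (qsnd x * qsnd y))
       (qfst x * qsnd y + qsnd x * qfst y + b * (qsnd x * qsnd y)).

Let addA : associative quad_add.
Proof. by move=> x y z; congr Quad => /=; ring. Qed.
Let addC : commutative quad_add.
Proof. by move=> x y; congr Quad => /=; ring. Qed.
Let add0 : left_id quad_zero quad_add.
Proof. by move=> [x y]; congr Quad => /=; ring. Qed.
Let addN : left_inverse quad_zero quad_opp quad_add.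
Proof. by move=> x; congr Quad => /=; ring. Qed.
HB.instance Definition _ := GRing.isZmodule.Build quad addA addC add0 addN.

Let mulA : associative quad_mul.
Proof. by move=> x y z; congr Quad => /=; ring. Qed.
Let mulC : commutative quad_mul.
Proof. by move=> x y; congr Quad => /=; ring. Qed.
Let mul1 : left_id quad_one quad_mul.
Proof. by move=> [x y]; congr Quad => /=; ring. Qed.
Let mulD : left_distributive quad_mul +%R.
Proof. by move=> x y z; congr Quad => /=; ring. Qed.
Let one_neq0 : quad_one != 0.
Proof. by apply/eqP => -[] /eqP; rewrite oner_eq0. Qed.
HB.instance Definition _ :=
  GRing.Zmodule_isComNzRing.Build quad mulA mulC mul1 mulD one_neq0.

Definition qX : quad := Quad 0 1.
Definition qC (x : R) : quad := Quad x 0.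
Definition qconj (x : quad) : quad := Quad (qfst x + b * qsnd x) (- qsnd x).
Definition qnorm (x : quad) : R := qfst x ^+ 2 + b * qfst x * qsnd x - s * qsnd x ^+ 2.

Lemma qmulE (x y : quad) : x * y = quad_mul x y. Proof. by []. Qed.
Lemma qaddE (x y : quad) : x + y = quad_add x y. Proof. by []. Qed.
Lemma qoppE (x : quad) : - x = quad_opp x. Proof. by []. Qed.

Let qCD : {morph qC : x y / x - y}.
Proof. by move=> x y; rewrite qoppE qaddE; congr Quad; rewrite /= subrr. Qed.
Let qCM : monoid_morphism qC.
Proof. by split=> // x y; rewrite qmulE; congr Quad => /=; ring. Qed.
HB.instance Definition _ := GRing.isZmodMorphism.Build R quad qC qCD.
HB.instance Definition _ := GRing.isMonoidMorphism.Build R quad qC qCM.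

Let qconjB : {morph qconj : x y / x - y}.
Proof. by move=> x y; rewrite !qoppE !qaddE; congr Quad => /=; ring. Qed.
Let qconjM : monoid_morphism qconj.
Proof.
split=> [|x y]; first by congr Quad => /=; ring.
by rewrite !qmulE; congr Quad => /=; ring.
Qed.
HB.instance Definition _ := GRing.isZmodMorphism.Build quad quad qconj qconjB.
HB.instance Definition _ := GRing.isMonoidMorphism.Build quad quad qconj qconjM.

Lemma mul_qconj x : x * qconj x = qC (qnorm x).
Proof. by rewrite qmulE; congr Quad => /=; rewrite /qnorm; ring. Qed.

Lemma qconj_qC x : qconj (qC x) = qC x.
Proof. by rewrite /qconj /qC /= mulr0 addr0 oppr0. Qed.

Lemma qnormM x y : qnorm (x * y) = qnorm x * qnorm y.
Proof. by rewrite qmulE /qnorm /=; ring. Qed.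

Lemma qX_sqr : qX ^+ 2 = qC b * qX + qC s.
Proof. by rewrite expr2 !qmulE qaddE; congr Quad => /=; ring. Qed.

Section Eval.
Variables (S : comNzRingType) (f : {rmorphism R -> S}) (r : S).
Hypothesis hr : r ^+ 2 = f b * r + f s.
(** The equation is an argument so that the term [qev hr] carries its proof and can be declared a
    ring morphism. *)
Definition qev of r ^+ 2 = f b * r + f s := fun x : quad => f (qfst x) + f (qsnd x) * r.
Let qevB : {morph qev hr : x y / x - y}.
Proof. by move=> x y; rewrite /qev /= !raddfB /=; ring. Qed.
Let qevM : monoid_morphism (qev hr).
Proof.
split=> [|x y]; first by rewrite /qev /= rmorph1 rmorph0 mul0r addr0.
rewrite qmulE /qev /= !raddfD /= !rmorphM /=.
transitivity (f (qfst x) * f (qfst y) + (f (qfst x) * f (qsnd y) + f (qsnd x) * f (qfst y)) * r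
   + f (qsnd x) * f (qsnd y) * (f b * r + f s)); first by ring.
by rewrite -hr; ring.
Qed.
HB.instance Definition _ := GRing.isZmodMorphism.Build quad S (qev hr) qevB.
HB.instance Definition _ := GRing.isMonoidMorphism.Build quad S (qev hr) qevM.
Lemma qevX : qev hr qX = r. Proof. by rewrite /qev /= rmorph0 rmorph1 mul1r add0r. Qed.
Lemma qevC x : qev hr (qC x) = f x. Proof. by rewrite /qev /= rmorph0 mul0r addr0. Qed.
End Eval.
End Quad.

Notation Zphi := (quad (1 : int) (1 : int)).
Definition zphi : Zphi := qX 1 1.
Definition zs5 : Zphi := 2%:R * zphi - 1.
Definition zphiV : Zphi := zphi - 1.

Lemma zphi_sqr : zphi ^+ 2 = zphi + 1.
Proof. by rewrite /zphi qX_sqr !rmorph1 mul1r. Qed.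

Lemma zphiVM : zphi * zphiV = 1.
Proof. by rewrite /zphiV mulrBr mulr1 -expr2 zphi_sqr addrAC subrr add0r. Qed.

Lemma zs5_sqr : zs5 ^+ 2 = 5%:R.
Proof.
have -> : zs5 ^+ 2 = 4%:R * zphi ^+ 2 - 4%:R * zphi + 1 by rewrite /zs5; ring.
by rewrite zphi_sqr; ring.
Qed.

Lemma fibSS n : fib n.+2 = (fib n.+1 + fib n)%N. Proof. by []. Qed.

Lemma zphi_exp n : zphi ^+ n.+1 = (fib n)%:R + (fib n.+1)%:R * zphi.
Proof.
elim: n => [|n IH]; first by rewrite expr1 /=; ring.
rewrite exprS IH fibSS natrD.
transitivity ((fib n)%:R * zphi + (fib n.+1)%:R * zphi ^+ 2); first by ring.
by rewrite zphi_sqr; ring.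
Qed.

Lemma zs5_fib n : zs5 * (fib n)%:R = zphi ^+ n - (-1) ^+ n * zphiV ^+ n.
Proof.
have [m] := ubnP n; elim: m n => // m IH [|[|n]] nm.
- by rewrite /= mulr0 !expr0 mulr1 subrr.
- by rewrite /= mulr1 !expr1 /zs5 /zphiV; ring.
rewrite fibSS natrD mulrDr !IH //; try lia.
have e1 : zphi ^+ n.+2 = zphi ^+ n.+1 + zphi ^+ n.
  by rewrite -addn2 exprD zphi_sqr exprS; ring.
have zV2 : zphiV ^+ 2 = 1 - zphiV.
  rewrite /zphiV; transitivity (zphi ^+ 2 - 2%:R * zphi + 1); first by ring.
  by rewrite zphi_sqr; ring.
have e2 : zphiV ^+ n.+2 = zphiV ^+ n - zphiV ^+ n.+1.
  by rewrite -addn2 exprD zV2 [zphiV ^+ n.+1]exprS; ring.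
by rewrite e1 e2 !exprS; ring.
Qed.

Lemma sqr_eq_5sqr (x y : int) : x ^+ 2 = 5 * y ^+ 2 -> y = 0.
Proof.
move=> h; apply/eqP; apply: contraT => y0.
have : (`|x| ^ 2 = 5 * `|y| ^ 2)%N.
  by move/(congr1 absz): h; rewrite abszM !abszX.
move/(congr1 (logn 5)); rewrite lognM ?expn_gt0 ?absz_gt0 ?y0 // !lognX -[logn 5 5]/1%N => e.
by lia.
Qed.

Lemma qnorm_Zphi_eq0 (x : Zphi) : qnorm x = 0 -> x = 0.
Proof.
case: x => x y; rewrite /qnorm /= => h.
have h2 : (2 * x + y) ^+ 2 = 5 * y ^+ 2 by lia.
by have y0 := sqr_eq_5sqr h2; move: h; rewrite y0 => h; congr Quad; lia.
Qed.

Section Reals.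
Variable R : rcfType.

Definition s5 : R := Num.sqrt 5%:R.
Definition phi : R := (1 + s5) / 2%:R.
Definition psi : R := (1 - s5) / 2%:R.

Lemma s5_sqr : s5 ^+ 2 = 5%:R. Proof. by rewrite sqr_sqrtr ?ler0n. Qed.

Lemma s5_bounds : 2236 / 1000 < s5 < 2237 / 1000.
Proof.
have s0 : 0 <= s5 by exact: sqrtr_ge0.
have := s5_sqr; nra.
Qed.

Lemma phi_sqr : phi ^+ 2 = phi + 1.
Proof. by rewrite /phi; have := s5_sqr => h; field: h. Qed.

Lemma psi_sqr : psi ^+ 2 = psi + 1.
Proof. by rewrite /psi; have := s5_sqr => h; field: h. Qed.

Lemma phi_bounds : 1618 / 1000 < phi < 3237 / 2000.
Proof. by rewrite /phi; have := s5_bounds; lra. Qed.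

Lemma psiE : psi = 1 - phi.
Proof. by rewrite /psi /phi; field. Qed.

Lemma psi_bounds : - (1237 / 2000) < psi < - (618 / 1000).
Proof. by rewrite psiE; have := phi_bounds; lra. Qed.

Lemma phi_gt1 : 1 < phi. Proof. by have := phi_bounds; lra. Qed.
Lemma phi_gt0 : 0 < phi. Proof. exact: lt_trans ltr01 phi_gt1. Qed.
Lemma phi_ge0 : 0 <= phi. Proof. exact: ltW phi_gt0. Qed.
Lemma psi_lt0 : psi < 0. Proof. by have := psi_bounds; lra. Qed.
Lemma psi_norm_lt1 : `|psi| < 1.
Proof. by rewrite ltr0_norm ?psi_lt0 //; have := psi_bounds; lra. Qed.

Lemma phi_psi : phi * psi = - 1.
Proof. by have := phi_sqr; rewrite psiE expr2 mulrBr mulr1 => ->; ring. Qed.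

Definition i2R : {rmorphism int -> R} := (intmul 1 : int -> R).

Lemma phi_hr : phi ^+ 2 = i2R 1 * phi + i2R 1.
Proof. by rewrite rmorph1 mul1r phi_sqr. Qed.
Lemma psi_hr : psi ^+ 2 = i2R 1 * psi + i2R 1.
Proof. by rewrite rmorph1 mul1r psi_sqr. Qed.

Definition ev1 : {rmorphism Zphi -> R} := qev phi_hr.
Definition ev2 : {rmorphism Zphi -> R} := qev psi_hr.

Lemma ev1_phi : ev1 zphi = phi. Proof. exact: qevX. Qed.
Lemma ev2_phi : ev2 zphi = psi. Proof. exact: qevX. Qed.
Lemma ev1_s5 : ev1 zs5 = s5.
Proof. by rewrite rmorphB rmorphM rmorph_nat rmorph1 ev1_phi /phi; field. Qed.
Lemma ev2_s5 : ev2 zs5 = - s5.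
Proof. by rewrite rmorphB rmorphM rmorph_nat rmorph1 ev2_phi /psi; field. Qed.

Lemma ev12_norm (x : Zphi) : ev1 x * ev2 x = (qnorm x)%:~R.
Proof.
have -> : ev2 x = ev1 (qconj x).
  case: x => x y; rewrite /ev1 /ev2 /= /qev /= mul1r rmorphD rmorphN /= psiE; ring.
by rewrite -rmorphM mul_qconj /ev1 /= qevC.
Qed.

(** The norm of X is a nonzero integer divisible by p^(2M), and it is the product of the two
    embeddings. *)
Lemma Zphi_dvd_size (X z : Zphi) (p M : nat) (S1 S2 : R) :
  X != 0 -> X = p%:R ^+ M * z -> `|ev1 X| <= S1 -> `|ev2 X| <= S2 ->
  (p%:R) ^+ (2 * M) <= S1 * S2.
Proof.
move=> X0 XE h1 h2; apply: le_trans (ler_pM (normr_ge0 _) (normr_ge0 _) h1 h2).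
rewrite -normrM ev12_norm.
have z0 : qnorm z != 0.
  by apply: contraNneq X0 => /qnorm_Zphi_eq0 z0; rewrite XE z0 mulr0.
have -> : qnorm X = p%:R ^+ (2 * M) * qnorm z.
  rewrite XE qnormM exprM; congr (_ * _); elim: M {XE} => [|M IH].
    by rewrite !expr0 /qnorm /=; ring.
  rewrite exprS qnormM IH [in RHS]exprS; congr (_ * _).
  rewrite -(rmorph_nat (@qC int 1 1)) /qnorm /=; ring.
rewrite rmorphM rmorphXn rmorph_nat normrM normrX normr_nat.
rewrite -{1}[_ ^+ _]mulr1 ler_wpM2l ?exprn_ge0 ?ler0n //.
by rewrite -intr_norm (ler_int R 1); lia.
Qed.
End Reals.

(** * The determinant inequality *)

(* The points (r, s) of the grid, s < ns and nr + 1 values of r for each s, with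
   r + k s = g t; the index j runs over 'I_(ns * nr.+1). *)
Section Grid.
Variables (k g nr : nat).
Hypothesis g0 : (0 < g)%N.

Definition ps (j : nat) := (j %/ nr.+1)%N.
Definition pr (j : nat) := (j %% nr.+1)%N.
(** The successor puts g t strictly above k s, so that the exponent r = g t - k s of [pe] is a
    positive natural number. *)
Definition pt (j : nat) := (pr j + (k * ps j) %/ g).+1.
Definition pe (j : nat) := (g * pr j + (g - (k * ps j) %% g))%N.
Definition pu (A : comNzRingType) (al ro : A) (j : nat) := al ^+ pe j * ro ^+ ps j.

Lemma pt_pe j : (g * pt j = pe j + k * ps j)%N.
Proof.
rewrite /pt /pe; have := divn_eq (k * ps j) g; have := ltn_pmod (k * ps j) g0.
set q := (_ %/ _)%N; set r := (_ %% _)%N; nia.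
Qed.

Lemma pt_le ns j : (j < ns * nr.+1)%N -> (pt j <= (nr + (k * ns.-1) %/ g).+1)%N.
Proof.
move=> jn; rewrite ltnS leq_add //; first by rewrite -ltnS ltn_pmod.
apply: leq_div2r; rewrite leq_mul2l; apply/orP; right.
have : (ps j < ns)%N by rewrite ltn_divLR.
by lia.
Qed.

Lemma pe_le j : (pe j <= g * nr.+1)%N.
Proof. by rewrite /pe; have : (pr j <= nr)%N by [rewrite -ltnS ltn_pmod]; nia. Qed.

Lemma ps_le ns j : (j < ns * nr.+1)%N -> (ps j <= ns.-1)%N.
Proof. by move=> jn; have : (ps j < ns)%N by [rewrite ltn_divLR]; lia. Qed.

(** As r = g t - k s, al^r rho^s is (al^g)^t (al^-k rho)^s. Both bases are p-adically close to 1: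
    al^g by the choice of g, al^-k rho because rho is close to al^k. *)
Lemma pu_expansion (A : comNzRingType) (al alV ro x : A) j :
  al * alV = 1 -> al ^+ g = 1 + x ->
  pu al ro j = (1 + x) ^+ pt j * (1 + (alV ^+ k * ro - 1)) ^+ ps j.
Proof.
move=> aV <-; rewrite -exprM pt_pe addrC subrK exprMn -exprM exprD.
rewrite mulrA -[_ * _ * alV ^+ _]mulrA -exprMn aV expr1n mulr1 //.
Qed.

Lemma pu_bdet_dvd (A : comNzRingType) K E l p m m' (al alV ro ro' ga eta : A)
    (f : 'I_(K + K) -> 'I_m) (f' : 'I_(K + K) -> 'I_m') :
  al * alV = 1 -> al ^+ g = 1 + p ^+ E * ga ->
  (alV ^+ k * ro - 1) * (alV ^+ k * ro' - 1) = p ^+ l * eta -> (2 * E * K <= l)%N ->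
  exists z, bdet (pt \o f) (pu al ro \o f) * bdet (pt \o f') (pu al ro' \o f')
    = p ^+ (E * K ^ 2) * z.
Proof.
move=> aV ag mm lEK.
have [z e] := idet_mul_dvd ga (pt \o f) (ps \o f) (pt \o f') (ps \o f') mm lEK.
exists z; rewrite -e /idet; congr (_ * _); apply: eq_bdet => j /=;
  exact: pu_expansion aV ag.
Qed.

(** The pairs needed by [bdet_neq0] are neighbours with the same s: raising r by g raises t by 1 and
    multiplies u by al^g. Each s uses a block of nr values of t, and [nr <= k %/ g] keeps the blocks
    of different s disjoint. *)
Lemma pu_bdet_neq0 (F : numFieldType) K ns (al ro : F) :
  (0 < K)%N -> (K + K <= (ns * nr).+1)%N -> (nr <= k %/ g)%N ->
  al ^+ g != 1 -> al != 0 -> ro != 0 ->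
  exists f : 'I_(K + K) -> 'I_(ns * nr.+1), bdet (pt \o f) (pu al ro \o f) != 0.
Proof.
move=> K0 KN nrk a1 a0 r0.
have nr0 : (0 < nr)%N by move: KN; case: nr => //; lia.
have bP (i : 'I_(ns * nr)) e : (e < 2)%N ->
    ((i %/ nr) * nr.+1 + (i %% nr + e) < ns * nr.+1)%N.
  have : (i %/ nr < ns)%N by rewrite ltn_divLR.
  have := ltn_pmod i nr0; set q := (i %/ nr)%N; set r := (i %% nr)%N; nia.
pose b i := Ordinal (bP i 0%N isT); pose b' i := Ordinal (bP i 1%N isT).
have small i e : (e < 2)%N -> (i %% nr + e < nr.+1)%N.
  by have := ltn_pmod i nr0; lia.
have psb i e : (e < 2)%N -> ps ((i %/ nr) * nr.+1 + (i %% nr + e)) = (i %/ nr)%N.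
  by move=> e2; rewrite /ps divnMDl // (divn_small (small i e e2)) addn0.
have prb i e : (e < 2)%N -> pr ((i %/ nr) * nr.+1 + (i %% nr + e)) = (i %% nr + e)%N.
  by move=> e2; rewrite /pr modnMDl (modn_small (small i e e2)).
have ptE (i : 'I_(ns * nr)) : pt (b i) = (i %% nr + (k * (i %/ nr)) %/ g).+1.
  by rewrite /pt /= psb ?prb // addn0.
have divS s : ((k * s) %/ g + k %/ g <= (k * s.+1) %/ g)%N.
  rewrite leq_divRL // mulnDl mulnS addnC.
  by apply: leq_add; apply: leq_trunc_div.
have step s s' : (s < s')%N -> ((k * s) %/ g + nr <= (k * s') %/ g)%N.
  move=> ss; apply: (leq_trans (n := ((k * s.+1) %/ g)%N)).
    by have := divS s; lia.
  by apply: leq_div2r; rewrite leq_mul2l ss orbT.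
apply: (@bdet_neq0 F K (ns * nr) (ns * nr.+1) (pt \o val) (pu al ro \o val) (al ^+ g) b b') => //=.
- move=> i j; rewrite /comp !ptE => -[] e.
  have := ltn_pmod i nr0; have := ltn_pmod j nr0 => hj hi.
  have ee : (i %/ nr = j %/ nr)%N.
    by have [/step|/step|//] := ltngtP (i %/ nr)%N (j %/ nr)%N; lia.
  apply: val_inj => /=; rewrite (divn_eq i nr) (divn_eq j nr) ee; congr addn.
  by move: e; rewrite ee; lia.
- by move=> j; rewrite /pu mulf_neq0 // expf_neq0.
- by move=> j; rewrite /pt /= !psb ?prb // addn0; lia.
- by move=> j; rewrite /pu /pe /= !psb ?prb // mulrA -exprD addn0; congr (al ^+ _ * _); lia.
Qed.

Lemma pu_norm_le (F : realFieldType) ns (al ro a b : F) j : (j < ns * nr.+1)%N ->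
  `|al| <= a -> 1 <= a -> `|ro| <= b -> 1 <= b ->
  `|pu al ro j| <= a ^+ (g * nr.+1) * b ^+ ns.-1.
Proof.
move=> jn ha a1 hb b1; rewrite /pu normrM !normrX; apply: ler_pM; rewrite ?exprn_ge0 //.
  apply: (@le_trans _ _ (a ^+ pe j)); first by rewrite lerXn2r ?nnegrE // (le_trans _ ha).
  by apply: ler_weXn2l; rewrite ?pe_le.
apply: (@le_trans _ _ (b ^+ ps j)); first by rewrite lerXn2r ?nnegrE // (le_trans _ hb).
by apply: ler_weXn2l; rewrite ?ps_le.
Qed.
End Grid.

(** The left side is alV^(2k) times the value at al^k of X^2 - s c X - (-1)^k, whose roots are ro
    and ro'. That value is al^k s (F - c) = al^k s P, where P will be p^l. *)
Lemma mu_mul (A : comNzRingType) (al alV s F P c ro ro' : A) k :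
  al * alV = 1 -> s * F = al ^+ k - (-1) ^+ k * alV ^+ k -> F = P + c ->
  ro + ro' = s * c -> ro * ro' = - (-1) ^+ k ->
  (alV ^+ k * ro - 1) * (alV ^+ k * ro' - 1) = P * (alV ^+ k * s).
Proof.
move=> aV sF FE rD rM.
have aVk : alV ^+ k * al ^+ k = 1 by rewrite -exprMn mulrC aV expr1n.
transitivity (alV ^+ k * alV ^+ k * (ro * ro') - alV ^+ k * (ro + ro') + 1); first by ring.
transitivity (alV ^+ k * (s * F) - alV ^+ k * (s * c)); last by rewrite FE; ring.
by rewrite rM rD sF mulrBr aVk; ring.
Qed.

(** The left side is the Mahler measure of the polynomial with roots r and r'. As |r r'| = 1 it
    equals the larger of |r| and |r'|, which is at most |b| plus the smaller one. *)
Lemma root_max (F : realFieldType) (r r' b : F) : r + r' = b -> `|r * r'| = 1 ->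
  Num.max 1 `|r| * Num.max 1 `|r'| <= `|b| + 1.
Proof.
move=> <-; rewrite normrM => rr.
have := ler_normD (r + r') (- r'); rewrite addrK normrN => h1.
have := ler_normD (r + r') (- r); rewrite addrAC subrr add0r normrN => h2.
have := normr_ge0 r; have := normr_ge0 r'; move: h1 h2 rr (normr_ge0 (r + r')).
move: (`|r|) (`|r'|) (`|r + r'|) => x y z *.
by case: (lerP 1 x) => hx; case: (lerP 1 y) => hy; nra.
Qed.

Lemma sqr_Zphi_eq0 (u : Zphi) : u ^+ 2 = 0 -> u = 0.
Proof.
move=> h; apply: qnorm_Zphi_eq0; have := qnormM u u; rewrite -expr2 h.
by rewrite [LHS]/qnorm /= => e; nia.
Qed.

Lemma sqr_eq_mul_sqr (D y n : int) : n != 0 -> y ^+ 2 = D * n ^+ 2 -> exists d, d ^+ 2 = D.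
Proof.
move=> n0 e; have : (`|y| ^ 2 = `|D| * `|n| ^ 2)%N by move/(congr1 absz): e; rewrite abszM !abszX.
move=> h; have : (`|n| ^ 2 %| `|y| ^ 2)%N by rewrite h dvdn_mull.
rewrite dvdn_pexp2r // => /dvdnP[q qE]; exists q%:Z.
have n2 : n ^+ 2 != 0 by rewrite expf_neq0.
apply: (mulIf n2); rewrite -e -[y ^+ 2]real_normK ?num_real // -abszE qE PoszM exprMn abszE.
by rewrite real_normK ?num_real.
Qed.

(** After multiplication by the square of the conjugate of v, D n^2 is a square in Z[phi] with n the
    norm of v. An element with rational square is an integer or an integral multiple of sqrt 5 up to
    a factor 2; the first makes D a square, the second contradicts the 5-adic valuation. *)
Lemma not_square_Zphi (D : int) : 0 < D -> ~~ (5 %| `|D|)%N -> (forall d : int, d ^+ 2 != D) ->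
  forall u v : Zphi, u ^+ 2 = D%:~R * v ^+ 2 -> v = 0.
Proof.
move=> D0 D5 nsq u v uv; apply: qnorm_Zphi_eq0; apply/eqP; apply: contraT => n0.
set n := qnorm v in n0.
have : (u * qconj v) ^+ 2 = (D * n ^+ 2)%:~R.
  have e : (n%:~R : Zphi) = qC 1 1 n by rewrite -(rmorph_int (@qC int 1 1)) intz.
  rewrite rmorphM rmorphXn /= e -mul_qconj exprMn uv; ring.
have -> z : (z%:~R : Zphi) = qC 1 1 z by rewrite -(rmorph_int (@qC int 1 1)) intz.
case: (u * qconj v) => y0 y1; rewrite expr2 qmulE => -[e1 e2].
have : y1 * (2 * y0 + y1) = 0 by lia.
move/eqP; rewrite mulf_eq0 => /orP[] /eqP e3.
  have [|d dD] := @sqr_eq_mul_sqr D y0 n n0; first by lia.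
  by have := nsq d; rewrite dD eqxx.
have e4 : 5 * y0 ^+ 2 = D * n ^+ 2 by rewrite (_ : y1 = - 2 * y0) in e1; lia.
have y00 : y0 != 0 by apply: contraNneq n0 => y00; rewrite y00 in e4; nia.
have := congr1 absz e4; rewrite (abszM 5) (abszM D) !abszX => /(congr1 (logn 5)).
have D0' : (0 < `|D|)%N by lia.
rewrite (@lognM 5 `|5|) ?expn_gt0 ?absz_gt0 ?y00 // (@lognM 5 `|D|) ?expn_gt0 ?absz_gt0 ?n0 //.
by rewrite !lognX -[logn 5 `|5|]/1%N (lognE 5 `|D|) (negPf D5) !andbF; lia.
by rewrite gt_eqF.
Qed.

(** If D is not a square in O, the roots rho and rho' are conjugate over O, and a single minor,
    nonzero at one embedding, serves for both. Its product with its conjugate is a relative norm X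
    in O, which inherits the divisibility of [pu_bdet_dvd]; the last clause describes X at each
    embedding for the size estimate. *)
Lemma quad_bdet_norm (O : comNzRingType) (R : rcfType) (k g nr ns K E l p : nat) (c D : int)
    (al alV s ga : O) (h1 h2 : {rmorphism O -> R}) :
  al * alV = 1 -> al ^+ g = 1 + p%:R ^+ E * ga ->
  s * (fib k)%:R = al ^+ k - (-1) ^+ k * alV ^+ k -> (fib k)%:R = p%:R ^+ l + c%:~R :> O ->
  (s * c%:~R) ^+ 2 + 4%:R * (-1) ^+ k = D%:~R -> 0 < D ->
  (forall u v : O, u ^+ 2 = D%:~R * v ^+ 2 -> v = 0) -> (forall u : O, u ^+ 2 = 0 -> u = 0) ->
  (0 < g)%N -> (0 < K)%N -> (K + K <= (ns * nr).+1)%N -> (nr <= k %/ g)%N ->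
  (2 * E * K <= l)%N -> h1 al ^+ g != 1 -> h1 al != 0 ->
  exists X z : O, [/\ X != 0, X = p%:R ^+ (E * K ^ 2) * z &
    forall h : {rmorphism O -> R}, h = h1 \/ h = h2 ->
    exists (f f' : 'I_(K + K) -> 'I_(ns * nr.+1)) (ro ro' : R),
      [/\ h X = bdet (pt k g nr \o f) (pu k g nr (h al) ro \o f)
              * bdet (pt k g nr \o f') (pu k g nr (h al) ro' \o f'),
          ro + ro' = h s * c%:~R & ro * ro' = - (-1) ^+ k]].
Proof.
move=> aV ag sF cF DE Dpos nsq red g0 K0 Kn nrk lEK aX1 a0.
pose b : O := s * c%:~R; pose sg : O := (-1) ^+ k.
pose A := quad b sg.
have aVA : qC b sg al * qC b sg alV = 1 by rewrite -rmorphM aV rmorph1.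
have agA : (qC b sg al) ^+ g = 1 + p%:R ^+ E * qC b sg ga.
  by rewrite -rmorphXn ag rmorphD rmorph1 rmorphM rmorphXn rmorph_nat.
pose ro : A := qX b sg; pose ro' : A := qconj ro.
have roD : ro + ro' = qC b sg s * c%:~R.
  by rewrite -(rmorph_int (qC b sg)) -rmorphM -/b /ro /ro' qaddE; congr Quad => /=; ring.
have roM : ro * ro' = - (-1) ^+ k.
  rewrite /ro' mul_qconj -[X in _ = - X ^+ k](rmorphN1 (qC b sg)) -rmorphXn -rmorphN.
  by congr (qC _ _ _); rewrite /qnorm /= -/sg; ring.
have cA : (fib k)%:R = p%:R ^+ l + c%:~R :> A.
  by have /(congr1 (qC b sg)) := cF; rewrite rmorphD rmorphXn !rmorph_nat rmorph_int.
have bA : qC b sg s * (fib k)%:R = qC b sg al ^+ k - (-1) ^+ k * qC b sg alV ^+ k.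
  by rewrite -(rmorph_nat (qC b sg)) -rmorphM sF rmorphB rmorphM !rmorphXn rmorphN1.
have mm := mu_mul aVA bA cA roD roM.
have rootP (h : {rmorphism O -> R}) : exists r, r ^+ 2 = h b * r + h sg.
  have hD : (h b) ^+ 2 + 4%:R * h sg = D%:~R.
    by rewrite -rmorphXn -(rmorph_nat h) -rmorphM -rmorphD DE rmorph_int.
  have D0 : 0 <= D%:~R :> R by rewrite ler0z ltW.
  exists ((h b + Num.sqrt D%:~R) / 2%:R); have := sqr_sqrtr D0; move: (Num.sqrt _) => q.
  by rewrite -hD; move: (h b) (h sg) => x y hq; field: hq.
have [r1 hr1] := rootP h1.
have r10 : r1 != 0.
  apply: contraTneq (oner_neq0 R) => r10; move: hr1.
  rewrite r10 expr0n mulr0 add0r rmorphXn rmorphN1 => /esym/eqP.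
  by rewrite expf_eq0 oppr_eq0 => /andP[_ ->].
have [f f0] := pu_bdet_neq0 g0 K0 Kn nrk aX1 a0 r10.
pose F (x : A) : A := bdet (pt k g nr \o f) (pu k g nr (qC b sg al) x \o f).
have FC : qconj (F ro) = F ro'.
  rewrite /F bdet_morph; apply: eq_bdet => j.
  rewrite /= /pu rmorphM !rmorphXn; congr (_ ^+ _ * _).
  exact: qconj_qC.
have hF (h : {rmorphism A -> R}) (x : A) :
   h (F x) = bdet (pt k g nr \o f) (pu k g nr (h (qC b sg al)) (h x) \o f).
  by rewrite /F bdet_morph; apply: eq_bdet => j; rewrite /= /pu rmorphM !rmorphXn.
have [z ze] := pu_bdet_dvd nr g0 f f aVA agA mm lEK.
have {}ze : F ro * F ro' = p%:R ^+ (E * K ^ 2) * z := ze.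
clearbody F; rewrite -FC mul_qconj in ze.
have Del0 : F ro != 0.
  pose q1 : {rmorphism A -> R} := qev hr1.
  have q1C x : q1 (qC b sg x) = h1 x by exact: qevC.
  have q1X : q1 ro = r1 by exact: qevX.
  apply: contraNneq f0 => /(congr1 q1).
  by rewrite rmorph0 hF q1C q1X => ->.
exists (qnorm (F ro)), (qfst z); split.
(* Four times the relative norm of u + v rho is (2 u + b v)^2 - D v^2, so a zero norm would make D
   v^2 a square. *)
- apply: contraNneq Del0; case: (F ro) => u v; rewrite /qnorm /= => n0.
  have v0 : v = 0.
    apply: (nsq (2%:R * u + b * v)); rewrite -DE -/b -/sg.
    transitivity (4%:R * (u ^+ 2 + b * u * v - sg * v ^+ 2) + (b ^+ 2 + 4%:R * sg) * v ^+ 2).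
      by ring.
    by rewrite n0 mulr0 add0r.
  have u0 : u = 0.
    by apply: red; rewrite -n0 v0; ring.
  by rewrite u0 v0.
- have := congr1 (@qfst _ _ _) ze; rewrite -(rmorph_nat (qC b sg)) -rmorphXn qmulE /=.
  by rewrite !mul0r mulr0 addr0.
move=> h _; have [r hr] := rootP h; pose q : {rmorphism A -> R} := qev hr.
have qqC x : q (qC b sg x) = h x by exact: qevC.
exists f, f, (q ro), (q ro'); split.
- have d1 : q (F ro) = bdet (pt k g nr \o f) (pu k g nr (h al) (q ro) \o f).
    by rewrite hF qqC.
  have d2 : q (qconj (F ro)) = bdet (pt k g nr \o f) (pu k g nr (h al) (q ro') \o f).
    by rewrite FC hF qqC.
  by rewrite -d1 -d2 -rmorphM mul_qconj; exact: esym (qqC _).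
- by rewrite -rmorphD roD rmorphM rmorph_int qqC.
- by rewrite -rmorphM roM rmorphN rmorphXn rmorphN1.
Qed.

(** If the discriminant is a square d^2, then d and c have the same parity, and the roots (sqrt 5 c
    + d) / 2 and (sqrt 5 c - d) / 2 are c phi + e and c phi - e - c, elements of Z[phi]. *)
Lemma half_of_disc (c d s : int) : d ^+ 2 = 5 * c ^+ 2 + 4 * s ->
  exists2 e : int, d = c + 2 * e & c ^+ 2 - e ^+ 2 - e * c = - s.
Proof.
move=> h; have dE := divz_eq (d - c) 2; have r2 : (0 <= (d - c) %% 2 < 2)%Z by lia.
move: ((d - c) %/ 2)%Z ((d - c) %% 2)%Z dE r2 => e r dE r2.
have {dE} dE : d = c + 2 * e + r by rewrite -[d](subrK c) dE; ring.
have e4 : 4 * (c ^+ 2 - e ^+ 2 - e * c + s) = r * (r + 2 * (c + 2 * e)).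
  have s4 : 4 * s = d ^+ 2 - 5 * c ^+ 2 by rewrite h; ring.
  by rewrite mulrDr s4 dE; ring.
have [r0|r1] : r = 0 \/ r = 1 by move: r2; clear; lia.
  exists e; first by rewrite dE r0 addr0.
  by move: e4; rewrite r0 mul0r; clear; lia.
by move: e4; rewrite r1; move: (c ^+ 2 - _ + _) => x; clear; lia.
Qed.

Lemma absz_lt_sqr (d : int) : (`|d| < `|d ^+ 2|.+1)%N.
Proof. by rewrite abszX ltnS -mulnn; case: `|d|%N => // n; rewrite leq_pmulr. Qed.

Section Bound.
Variables (R : rcfType) (p : nat) (c : int) (k l g E K ns nr : nat) (ga : Zphi).
Hypotheses (c0 : c != 0) (ckl : (fib k)%:Z = (p ^ l)%:Z + c).
Hypotheses (gga : zphi ^+ g = 1 + p%:R ^+ E * ga) (g0 : (0 < g)%N) (K0 : (0 < K)%N).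
Hypotheses (Kn : (K + K <= (ns * nr).+1)%N) (nrk : (nr <= k %/ g)%N) (lEK : (2 * E * K <= l)%N).

Let m := (ns * nr.+1)%N.
Let T := (nr + (k * ns.-1) %/ g).+1.
Definition U_base : R := (K + K)`!%:R * (\prod_(i < K) 'C(T, i)%:R) ^+ 2.
Let W := U_base.
Let B : R := s5 R * `|c|%:~R + 1.

Let bd (f : 'I_(K + K) -> 'I_m) (al ro : R) :=
  bdet (pt k g nr \o f) (pu k g nr al ro \o f).

Let bd_le f al ro a : `|al| <= a -> 1 <= a ->
  `|bd f al ro| <= W * (a ^+ (g * nr.+1) * (Num.max 1 `|ro|) ^+ ns.-1) ^+ K.
Proof.
move=> ha a1; rewrite /W /U_base -mulrA; apply: (@bdet_norm_le R K _ _ (fun i => 'C(T, i)%:R)).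
  by move=> i j _; rewrite ler_nat; exact: leq_bin2l (pt_le k g0 (ltn_ord (f j))).
by move=> j; apply: (pu_norm_le k g0 (ltn_ord (f j))) => //; rewrite le_max lexx ?orbT.
Qed.
Let W0 : 0 <= W. Proof. by rewrite /W /U_base mulr_ge0 ?ler0n ?sqr_ge0. Qed.


Let bd2_le f f' al ro ro' a : `|al| <= a -> 1 <= a ->
    `|ro + ro'| <= B - 1 -> `|ro * ro'| = 1 ->
  `|bd f al ro * bd f' al ro'| <= W ^+ 2 * a ^+ (2 * (g * nr.+1) * K) * B ^+ (ns.-1 * K).
Proof.
move=> ha a1 hD hM; rewrite normrM.
apply: (le_trans (ler_pM _ _ (bd_le _ _ ha a1) (bd_le _ _ ha a1))) => //.
set x := Num.max 1 `|ro|; set y := Num.max 1 `|ro'|.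
have x1 : 1 <= x by rewrite le_max lexx.
have y1 : 1 <= y by rewrite le_max lexx.
have xy : x * y <= B by have := root_max (erefl (ro + ro')) hM; rewrite -/x -/y; lra.
have E1 (w : R) : w * (a ^+ (g * nr.+1) * x ^+ ns.-1) ^+ K * (w * (a ^+ (g * nr.+1) * y ^+ ns.-1) ^+ K)
   = w ^+ 2 * a ^+ (2 * (g * nr.+1) * K) * (x * y) ^+ (ns.-1 * K).
  rewrite !exprMn -!exprM (_ : (2 * (g * nr.+1) * K = g * nr.+1 * K + g * nr.+1 * K)%N); last by lia.
  by rewrite exprD; move: (a ^+ _) (x ^+ _) (y ^+ _) => ? ? ?; ring.
rewrite E1.
have a0 : 0 <= a by lra.
have xy0 : 0 <= x * y by apply: mulr_ge0; lra.
apply: ler_wpM2l; first by rewrite mulr_ge0 // exprn_ge0.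
by rewrite lerXn2r // nnegrE // (le_trans xy0).
Qed.

Let sg2 : `|(-1) ^+ k : R| = 1. Proof. by rewrite normrX normrN1 expr1n. Qed.

(** Common end of both cases. Each embedding sees two minors, whence W^4; phi occurs once only,
    because |psi| < 1 in the second embedding; B bounds the product of the maxima by [root_max]. *)
Let finish (X z : Zphi) : X != 0 -> X = p%:R ^+ (E * K ^ 2) * z ->
  (exists f f' ro ro', [/\ ev1 R X = bd f (phi R) ro * bd f' (phi R) ro',
     ro + ro' = s5 R * c%:~R & ro * ro' = - (-1) ^+ k]) ->
  (exists f f' ro ro', [/\ ev2 R X = bd f (psi R) ro * bd f' (psi R) ro',
     ro + ro' = - s5 R * c%:~R & ro * ro' = - (-1) ^+ k]) ->
  p%:R ^+ (2 * (E * K ^ 2)) <=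
   W ^+ 4 * phi R ^+ (2 * (g * nr.+1) * K) * B ^+ (2 * (ns.-1 * K)).
Proof.
move=> X0 XE [f [f' [ro [ro' [e1 hD hM]]]]] [h [h' [so [so' [e2 kD kM]]]]].
have s0 : 0 <= s5 R by have := s5_bounds R; lra.
have i1 : `|ro + ro'| <= B - 1 by rewrite hD normrM (ger0_norm s0) -intr_norm /B addrK.
have i2 : `|so + so'| <= B - 1.
  by rewrite kD normrM normrN (ger0_norm s0) -intr_norm /B addrK.
have j1 : `|ro * ro'| = 1 by rewrite hM normrN sg2.
have j2 : `|so * so'| = 1 by rewrite kM normrN sg2.
have P1 : 1 <= phi R by exact: ltW (phi_gt1 R).
have u1 : `|ev1 R X| <= W ^+ 2 * phi R ^+ (2 * (g * nr.+1) * K) * B ^+ (ns.-1 * K).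
  by rewrite e1; apply: bd2_le => //; rewrite ger0_norm // phi_ge0.
have u2 : `|ev2 R X| <= W ^+ 2 * 1 ^+ (2 * (g * nr.+1) * K) * B ^+ (ns.-1 * K).
  by rewrite e2; apply: bd2_le => //; exact: ltW (psi_norm_lt1 R).
have := Zphi_dvd_size X0 XE u1 u2; congr (_ <= _).
have E1 (w x y : R) : w ^+ 2 * x * y * (w ^+ 2 * 1 * y) = w ^+ 4 * x * y ^+ 2 by ring.
by rewrite expr1n E1 -exprM [(ns.-1 * K * 2)%N]mulnC.
Qed.

Let phiX1 : phi R ^+ g != 1.
Proof.
by rewrite gt_eqF // exprn_egt1 -?lt0n ?phi_gt1.
Qed.
Let phi0 : phi R != 0. Proof. by rewrite gt_eqF // phi_gt0. Qed.

Let mulN1_neq0 (F : comNzRingType) (S : numFieldType) (h : {rmorphism F -> S}) (x y : F) :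
  x * y = - (-1) ^+ k -> h x != 0 /\ h y != 0.
Proof.
move=> xy; have : h x * h y != 0.
  by rewrite -rmorphM xy rmorphN rmorphXn rmorphN1 oppr_eq0 expf_neq0 // oppr_eq0 oner_eq0.
by rewrite mulf_eq0 negb_or => /andP.
Qed.

Let ev1_bdet (f : 'I_(K + K) -> 'I_m) (al ro : Zphi) :
  ev1 R (bdet (pt k g nr \o f) (pu k g nr al ro \o f)) = bd f (ev1 R al) (ev1 R ro).
Proof.
by rewrite bdet_morph; apply: eq_bdet => j; rewrite /= /pu rmorphM !rmorphXn.
Qed.
Let ev1_bdet2 (f f' : 'I_(K + K) -> 'I_m) (al ro ro' : Zphi) :
  ev1 R (bdet (pt k g nr \o f) (pu k g nr al ro \o f) * bdet (pt k g nr \o f') (pu k g nr al ro' \o f'))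
    = bd f (ev1 R al) (ev1 R ro) * bd f' (ev1 R al) (ev1 R ro').
Proof. by rewrite rmorphM; congr (_ * _); exact: ev1_bdet. Qed.
Let ev2_bdet (f : 'I_(K + K) -> 'I_m) (al ro : Zphi) :
  ev2 R (bdet (pt k g nr \o f) (pu k g nr al ro \o f)) = bd f (ev2 R al) (ev2 R ro).
Proof.
by rewrite bdet_morph; apply: eq_bdet => j; rewrite /= /pu rmorphM !rmorphXn.
Qed.
Let ev2_bdet2 (f f' : 'I_(K + K) -> 'I_m) (al ro ro' : Zphi) :
  ev2 R (bdet (pt k g nr \o f) (pu k g nr al ro \o f) * bdet (pt k g nr \o f') (pu k g nr al ro' \o f'))
    = bd f (ev2 R al) (ev2 R ro) * bd f' (ev2 R al) (ev2 R ro').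
Proof. by rewrite rmorphM; congr (_ * _); exact: ev2_bdet. Qed.

Let ckl_zphi : (fib k)%:R = p%:R ^+ l + c%:~R :> Zphi.
Proof.
by have /(congr1 (fun z : int => z%:~R : Zphi)) := ckl; rewrite rmorphD /= -!pmulrn natrX.
Qed.

Let degenerate (d : int) : d ^+ 2 = 5 * c ^+ 2 + 4 * (-1) ^+ k ->
  p%:R ^+ (2 * (E * K ^ 2)) <=
   W ^+ 4 * phi R ^+ (2 * (g * nr.+1) * K) * B ^+ (2 * (ns.-1 * K)).
Proof.
move=> dD.
have [e dE eE] := half_of_disc dD.
pose ro : Zphi := c%:~R * zphi + e%:~R; pose ro' : Zphi := c%:~R * zphi - e%:~R - c%:~R.
have roD : ro + ro' = zs5 * c%:~R by rewrite /ro /ro' /zs5; ring.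
have roM : ro * ro' = - (-1) ^+ k.
  transitivity (c%:~R ^+ 2 * (zphi ^+ 2 - zphi) - e%:~R ^+ 2 - e%:~R * c%:~R : Zphi).
    by rewrite /ro /ro'; ring.
  have -> : zphi ^+ 2 - zphi = 1 by rewrite zphi_sqr addrAC subrr add0r.
  rewrite mulr1.
  have -> : - (-1) ^+ k = (c ^+ 2 - e ^+ 2 - e * c)%:~R :> Zphi.
    rewrite eE.
    by rewrite rmorphN rmorphXn rmorphN1.
  by ring.
have [r1 r1'] := mulN1_neq0 (ev1 R) roM.
have [f f0] := pu_bdet_neq0 g0 K0 Kn nrk phiX1 phi0 r1.
have [f' f0'] := pu_bdet_neq0 g0 K0 Kn nrk phiX1 phi0 r1'.
have mm := mu_mul zphiVM (zs5_fib k) ckl_zphi roD roM.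
have [z ze] := pu_bdet_dvd nr g0 f f' zphiVM gga mm lEK.
apply: (finish _ ze).
- apply: contraTneq (mulf_neq0 f0 f0') => /(congr1 (ev1 R)).
  by rewrite ev1_bdet2 ev1_phi rmorph0 => /eqP; rewrite negbK.
- exists f, f', (ev1 R ro), (ev1 R ro'); rewrite ev1_bdet2 ev1_phi.
  by rewrite -rmorphD -rmorphM roD roM rmorphM ev1_s5 rmorph_int rmorphN rmorphXn rmorphN1.
- exists f, f', (ev2 R ro), (ev2 R ro'); rewrite ev2_bdet2 ev2_phi.
  by rewrite -rmorphD -rmorphM roD roM rmorphM ev2_s5 rmorph_int rmorphN rmorphXn rmorphN1.
Qed.

Let nondegenerate : (forall d : int, d ^+ 2 != 5 * c ^+ 2 + 4 * (-1) ^+ k) ->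
  p%:R ^+ (2 * (E * K ^ 2)) <=
   W ^+ 4 * phi R ^+ (2 * (g * nr.+1) * K) * B ^+ (2 * (ns.-1 * K)).
Proof.
set D := _ + _; move=> nsq.
have s1 : (-1) ^+ k = 1 :> int \/ (-1) ^+ k = -1 :> int.
  by rewrite -signr_odd; case: odd; rewrite ?expr0 ?expr1; [right|left].
have Dpos : 0 < D.
  have : 0 < c ^+ 2 by rewrite exprn_even_gt0.
  by rewrite /D; case: s1 => ->; move: (c ^+ 2) => x; clear; lia.
have D5 : ~~ (5 %| `|D|)%N by rewrite /D; case: s1 => ->; lia.
have DE : (zs5 * c%:~R) ^+ 2 + 4%:R * (-1) ^+ k = D%:~R.
  have e : ((-1) ^+ k : int)%:~R = (-1) ^+ k :> Zphi by rewrite rmorphXn rmorphN1.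
  by rewrite exprMn zs5_sqr /D rmorphD !rmorphM /= e expr2.
have a1 : ev1 R zphi ^+ g != 1 by rewrite ev1_phi.
have a0 : ev1 R zphi != 0 by rewrite ev1_phi.
have [X [z [X0 XE hX]]] := quad_bdet_norm (ev2 R) zphiVM gga (zs5_fib k) ckl_zphi DE Dpos
  (not_square_Zphi Dpos D5 nsq) sqr_Zphi_eq0 g0 K0 Kn nrk lEK a1 a0.
apply: (finish X0 XE).
  have [f [f' [ro [ro' [e1 e2 e3]]]]] := hX _ (or_introl erefl).
  by exists f, f', ro, ro'; rewrite e1 e2 e3 ev1_phi ev1_s5.
have [f [f' [ro [ro' [e1 e2 e3]]]]] := hX _ (or_intror erefl).
by exists f, f', ro, ro'; rewrite e1 e2 e3 ev2_phi ev2_s5.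
Qed.

(* The integer 5 c^2 + 4 (-1)^k may be a square (c is then a Fibonacci number up to sign);
   the roots rho are then already in Z[phi] and different minors may be needed at each. *)
Lemma determinant_inequality : p%:R ^+ (2 * (E * K ^ 2)) <=
   U_base ^+ 4 * phi R ^+ (2 * (g * nr.+1) * K) * (s5 R * `|c|%:~R + 1) ^+ (2 * (ns.-1 * K)).
Proof.
set D := 5 * c ^+ 2 + 4 * (-1) ^+ k.
have [/existsP[d /eqP dD]|/existsPn nD] := boolP [exists d : 'I_(`|D|.+1), (d%:Z) ^+ 2 == D].
  exact: degenerate dD.
apply: nondegenerate => d; apply/negP => /eqP dD.
have dl : (`|d| < `|D|.+1)%N by rewrite -/D in dD; rewrite -dD; exact: absz_lt_sqr.
by have /eqP := nD (Ordinal dl); apply; rewrite /= abszE real_normK ?num_real.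
Qed.
End Bound.

(** * Upper bound for the indices *)

Lemma fact_le_exp n : (n`! <= n ^ n)%N.
Proof.
elim: n => // n IH; rewrite factS expnS leq_mul2l /=.
by apply: (leq_trans IH); case: n {IH} => // n; rewrite leq_exp2r.
Qed.

Section FibPhi.
Variable R : rcfType.
Local Notation phi := (phi R).

Lemma phiX_gt0 n : 0 < phi ^+ n. Proof. exact: exprn_gt0 _ (phi_gt0 R). Qed.
Lemma phiX_le m n : (phi ^+ m <= phi ^+ n) = (m <= n)%N.
Proof. by rewrite ler_eXn2l ?phi_gt1. Qed.
Lemma phiX_lt m n : (phi ^+ m < phi ^+ n) = (m < n)%N.
Proof. by rewrite ltr_eXn2l ?phi_gt1. Qed.
Lemma phiXSS n : phi ^+ n.+2 = phi ^+ n.+1 + phi ^+ n.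
Proof. by rewrite -addn2 exprD phi_sqr exprS; ring. Qed.

Lemma fib_ge_phi n : phi ^+ n <= (fib n.+2)%:R.
Proof.
have [m] := ubnP n; elim: m n => // m IH [|[|n]] nm; first by rewrite expr0.
  by rewrite expr1 (_ : fib 3 = 2%N) //; have := phi_bounds R; lra.
by rewrite phiXSS fibSS natrD lerD // IH //; lia.
Qed.

Lemma fib_le_phi n : (fib n.+1)%:R <= phi ^+ n.
Proof.
have [m] := ubnP n; elim: m n => // m IH [|[|n]] nm; first by rewrite expr0.
  by rewrite expr1 (_ : fib 2 = 1%N) //; have := phi_bounds R; lra.
by rewrite phiXSS fibSS natrD lerD // IH //; lia.
Qed.

Lemma phi_fib n : phi ^+ n.+1 = (fib n)%:R + (fib n.+1)%:R * phi.
Proof.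
have /(congr1 (ev1 R)) := zphi_exp n.
by rewrite rmorphXn rmorphD rmorphM !rmorph_nat ev1_phi.
Qed.

Lemma natr_le_phi n : (n%:R : R) <= phi ^+ n.+1.
Proof.
elim: n => [|n IH]; first by rewrite ltW // phiX_gt0.
rewrite -natr1 exprS; have := phi_bounds R.
have : 1 <= phi ^+ n.+1 by rewrite exprn_ege1 // ltW // phi_gt1.
case: n IH => [|n] IH; first by rewrite expr1; nra.
have : phi ^+ 2 <= phi ^+ n.+2 by rewrite phiX_le.
by rewrite phi_sqr; nra.
Qed.

Lemma phi_77 : 102 ^+ 8 <= phi ^+ 77.
Proof.
rewrite (_ : 77 = 11 * 7)%N // exprM.
have h : 199 <= phi ^+ 11.
  rewrite phi_fib (_ : fib 10 = 55%N) // (_ : fib 11 = 89%N) //.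
  by have := phi_bounds R; lra.
apply: (@le_trans _ _ (199 ^+ 7)); first by lra.
by rewrite lerXn2r ?nnegrE ?exprn_ge0 ?phi_ge0.
Qed.

Lemma natr2_le_phi K : (104 <= K)%N -> (K + K)%:R ^+ 8 <= phi ^+ K.
Proof.
move=> K104; pose m := (K %/ 8)%N.
have m13 : (13 <= m)%N by rewrite /m; lia.
(* As K <= 8 m + 7, this is the eighth root of the claim. *)
have h : ((16 * m + 14)%N%:R : R) <= phi ^+ m.
  elim: {K K104}m m13 => // m IH; rewrite leq_eqVlt => /orP[/eqP <-|m13].
    rewrite phi_fib (_ : fib 12 = 144%N) // (_ : fib 13 = 233%N) //; have := phi_bounds R; lra.
  have := IH m13; have -> : (16 * m.+1 + 14 = (16 * m + 14) + 16)%N by lia.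
  have : (32%:R : R) <= (16 * m + 14)%:R by rewrite ler_nat; lia.
  rewrite natrD exprS; have := phi_bounds R; nra.
apply: (@le_trans _ _ ((phi ^+ m) ^+ 8)); last by rewrite -exprM phiX_le /m; lia.
rewrite lerXn2r ?nnegrE ?ler0n ?exprn_ge0 ?phi_ge0 //; apply: le_trans h.
by rewrite ler_nat /m; lia.
Qed.

Lemma bin_le_exp (T i : nat) (y : R) : 0 < y -> 'C(T, i)%:R <= y ^+ i * (1 + y^-1) ^+ T.
Proof.
move=> y0; have [Ti|iT] := ltnP T i.
  by rewrite bin_small // mulr_ge0 // exprn_ge0 // ?addr_ge0 ?invr_ge0 // ltW.
rewrite exprDn (bigD1 (Ordinal (iT : (i < T.+1)%N))) //= expr1n mul1r mulrDr.
rewrite mulrnAr -exprMn mulfV ?gt_eqF // expr1n -[X in X <= _]addr0 lerD // mulr_ge0 //.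
  by rewrite exprn_ge0 // ltW.
by apply: sumr_ge0 => j _; rewrite mulrn_wge0 // mulr_ge0 // exprn_ge0 // ?ler01 ?invr_ge0 ltW.
Qed.

(** [bin_le_exp] with y = 34, nearly optimal as it is twice the allowed ratio T / K. The squared
    product is at most 34^(K^2) times ((1 + 1/34)^34)^(K^2), and the inner power is below 3; 102 is
    34 times 3. *)
Lemma bin_prod_le (T K : nat) : (T <= 17 * K)%N ->
  (\prod_(i < K) ('C(T, i)%:R : R)) ^+ 2 <= 102 ^+ (K ^ 2).
Proof.
move=> TK; pose y : R := 34; have y0 : 0 < y by rewrite /y; lra.
pose z := 1 + y^-1; have z1 : 1 <= z by rewrite /z lerDl invr_ge0 ltW.
have h : \prod_(i < K) ('C(T, i)%:R : R) <= \prod_(i < K) (y ^+ i * z ^+ T).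
  by apply: ler_prod => i _; rewrite ler0n /= bin_le_exp.
apply: (@le_trans _ _ ((\prod_(i < K) (y ^+ i * z ^+ T)) ^+ 2)).
  rewrite lerXn2r ?nnegrE ?prodr_ge0 // => i _; rewrite mulr_ge0 // exprn_ge0 //; lra.
rewrite big_split /= prodr_const card_ord -exprM -expr_sum exprMn -!exprM.
have -> : (102 : R) = y * 3 by rewrite /y; lra.
rewrite exprMn; apply: ler_pM; rewrite ?exprn_ge0 //; try lra.
  rewrite ler_eXn2l; last by rewrite /y; lra.
  have -> : (\sum_(i < K) i = 'C(K, 2))%N by rewrite -bin2_sum big_mkord.
  by rewrite bin2 -mulnn; have := odd_double_half (K * K.-1); nia.
have z34 : z ^+ 34 <= 3.
  by rewrite /z /y; lra.
apply: (@le_trans _ _ (z ^+ (34 * K ^ 2))).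
  by apply: ler_weXn2l => //; nia.
by rewrite exprM lerXn2r ?nnegrE ?exprn_ge0 //; lra.
Qed.

End FibPhi.

Section LinearFormBound.
Variable R : rcfType.
Local Notation phi := (phi R).
Local Notation phi_gt1 := (phi_gt1 R).
Local Notation phi_ge0 := (phi_ge0 R).
Local Notation phiX_gt0 := (phiX_gt0 R).
Local Notation phiX_lt := (phiX_lt R).
Local Notation phiX_le := (phiX_le R).
Local Notation phiXSS := (phiXSS R).
Local Notation fib_le_phi := (fib_le_phi R).
Local Notation fib_ge_phi := (fib_ge_phi R).
Local Notation phi_77 := (phi_77 R).

(** K is the largest value allowed by 2 E K <= l, and w the integral part of log_phi p^E. Comparing
    exponents of phi gives 4 w K <= 79 K + 4 g (nr + 1) + 4 beta u, where 79 = 2 + 77 pays for the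
    factorials and the binomials. The terms in g leave 3 w K on the left, and [30 <= w] makes 3 w
    exceed 79. *)
Lemma linear_form_bound (p : nat) (c : int) (k l g E w beta : nat) (ga : Zphi) :
  c != 0 -> (fib k)%:Z = (p ^ l)%:Z + c -> zphi ^+ g = 1 + p%:R ^+ E * ga ->
  (0 < E)%N -> (30 <= w < g)%N -> phi ^+ w <= p%:R ^+ E -> p%:R ^+ E < phi ^+ w.+1 ->
  s5 R * `|c|%:~R + 1 <= phi ^+ beta -> c <= (p ^ l)%:Z ->
  (k <= 210 * g + 7 * g * beta)%N.
Proof.
move=> c0 ckl gga E0 /andP[w30 wg] hw1 hw2 hB cpl.
have g0 : (0 < g)%N by lia.
rewrite leqNgt; apply/negP => kbig.
pose K := (l %/ (2 * E))%N.
have lK : (2 * E * K <= l < 2 * E * K.+1)%N.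
  by rewrite /K mulnC leq_trunc_div mulnC ltn_ceil // muln_gt0.
have s51 : 1 <= s5 R by have := s5_bounds R; lra.
have B0 : 0 <= s5 R * `|c|%:~R by rewrite mulr_ge0 ?ler0z //; lra.
have ckR : (fib k)%:R = p%:R ^+ l + c%:~R :> R.
  by have := congr1 (fun z : int => z%:~R : R) ckl; rewrite rmorphD /= -!pmulrn natrX.
have pl0 : 0 <= p%:R ^+ l :> R by rewrite exprn_ge0 // ler0n.
have cplR : c%:~R <= p%:R ^+ l :> R.
  by rewrite -(ler_int R) -pmulrn natrX in cpl.
have ncR : - c%:~R <= s5 R * `|c|%:~R.
  apply: (@le_trans _ _ `|c|%:~R); last first.
    by rewrite -[X in X <= _]mul1r ler_wpM2r ?ler0z.
  by rewrite -rmorphN ler_int -normrN ler_norm.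
have pE1 : 1 <= p%:R ^+ E :> R.
  by apply: le_trans hw1; rewrite exprn_ege1 // ltW // phi_gt1.
have p1 : 1 <= p%:R :> R.
  by move: pE1; case: (p) => [|n]; rewrite ?expr0n ?gtn_eqF // ?ler1n // ler10.
have k2 : (2 <= k)%N by move: kbig; clear -g0; nia.
have kK : (k <= 2 * w.+1 * K.+1 + 3)%N.
  have : phi ^+ (k - 2) < phi ^+ (2 + 2 * w.+1 * K.+1).
    apply: (@le_lt_trans _ _ (fib k)%:R).
      by have := fib_ge_phi (k - 2); rewrite (_ : (k - 2).+2 = k) //; move: k2; clear; lia.
    apply: (@le_lt_trans _ _ (phi ^+ 2 * p%:R ^+ l)).
      by rewrite ckR phi_sqr; have := phi_bounds R; nra.
    rewrite exprD ltr_pM2l ?phiX_gt0 //.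
    apply: (@le_lt_trans _ _ (p%:R ^+ (E * (2 * K.+1)))).
      by apply: ler_weXn2l => //; case/andP: lK; clear; nia.
    rewrite (_ : 2 * w.+1 * K.+1 = w.+1 * (2 * K.+1))%N; last by clear; lia.
    by rewrite exprM [X in _ < X]exprM ltr_pXn2r ?nnegrE ?exprn_ge0 ?phi_ge0 ?ler0n.
  by rewrite phiX_lt; clear; lia.
have K104 : (104 <= K)%N by move: kbig kK w30 wg; clear; nia.
have wK : (2 * w * K <= k + 1)%N.
  have : phi ^+ (2 * w * K) <= phi ^+ (k + 1).
    apply: (@le_trans _ _ (p%:R ^+ l)).
      apply: (@le_trans _ _ (p%:R ^+ (E * (2 * K)))); last first.
        by apply: ler_weXn2l => //; case/andP: lK; clear; nia.
      rewrite (_ : 2 * w * K = w * (2 * K))%N; last by clear; lia.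
      by rewrite exprM [X in _ <= X]exprM lerXn2r ?nnegrE ?exprn_ge0 ?phi_ge0 ?ler0n.
    have : phi ^+ beta <= phi ^+ k by rewrite phiX_le; move: kbig g0; clear; nia.
    have := fib_le_phi k.-1; rewrite (_ : k.-1.+1 = k) ?ckR; last by move: k2; clear; lia.
    have := phiXSS k.-1; rewrite (_ : k.-1.+1 = k) ?addn1; last by move: k2; clear; lia.
    by move=> -> h1 h2; lra.
  by rewrite phiX_le.
(* About 8 g / w values of s make 4 g nr roughly w K, a quarter of the gain 4 w K. *)
pose u := (8 * g %/ w)%N; pose ns := u.+1; pose nr := (2 * K %/ ns).+1.
have uw : (u * w <= 8 * g)%N by exact: leq_trunc_div.
have nsw : (8 * g < ns * w)%N by rewrite /ns /u ltn_ceil //; move: w30; clear; lia.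
have vns : ((2 * K %/ ns) * ns <= 2 * K)%N by exact: leq_trunc_div.
have vns2 : (2 * K < nr * ns)%N by rewrite ltn_ceil.
have gv : (4 * g * (2 * K %/ ns) <= K * w)%N.
  by move: vns nsw; clear; move: (2 * K %/ ns)%N => v; nia.
have [Kn nrk] : (K + K <= (ns * nr).+1)%N /\ (nr <= k %/ g)%N.
  split; first by move: vns2; clear; nia.
  rewrite leq_divRL // /nr; move: gv wK kbig g0; clear.
  by move: (2 * K %/ ns)%N => v; nia.
(* As k is about 2 w K and u is at most 8 g / w, the quotient k u / g is about 16 K. *)
have TK : ((nr + (k * ns.-1) %/ g).+1 <= 17 * K)%N.
  have q1 : (w * ((k * u) %/ g) <= 8 * k)%N.
    have := leq_trunc_div (k * u) g; move: (_ %/ _)%N uw g0; clear => q; nia.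
  rewrite /ns /= /nr; move: q1 gv kK w30 wg K104; clear.
  move: ((k * u) %/ g)%N (2 * K %/ u.+1)%N => q v q1 gv kK w30 wg K104.
  have v4 : (4 * v <= K)%N by move: gv wg; clear; nia.
  have v5 : (4 * w * v <= w * K)%N by move: v4; clear; nia.
  have : (4 * w * (v.+1 + q).+1 <= 4 * w * (17 * K))%N.
    have w1 : (30 * K <= w * K)%N by rewrite leq_mul2r w30 orbT.
    have w2 : (104 * w <= w * K)%N by rewrite mulnC leq_mul2l K104 orbT.
    by move: q1 v5 kK w1 w2 w30; clear; lia.
  by rewrite leq_pmul2l //; move: w30; clear; lia.
have := determinant_inequality R c0 ckl gga g0 (leq_trans (isT : (0 < 104)%N) K104) Kn nrk (andP lK).1.
rewrite /U_base; set P2 := (\prod_(i < K) _) ^+ 2.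
have P2le : P2 <= 102 ^+ (K ^ 2) by exact: bin_prod_le.
set S := ns.-1; set B := _ + 1 => main.
have P20 : 0 <= P2 by exact: sqr_ge0.
clearbody P2.
have fle : (K + K)`!%:R ^+ 4 <= phi ^+ (K * K) :> R.
  apply: (@le_trans _ _ (((K + K)%:R ^+ 8) ^+ K)); last first.
    by rewrite exprM lerXn2r ?nnegrE ?exprn_ge0 ?phi_ge0 ?ler0n ?natr2_le_phi.
  rewrite -exprM (_ : 8 * K = (K + K) * 4)%N; last by clear; lia.
  by rewrite exprM lerXn2r ?nnegrE ?exprn_ge0 ?ler0n // -natrX ler_nat fact_le_exp.
have P8 : (P2 ^+ 4) ^+ 2 <= phi ^+ (77 * K ^ 2).
  rewrite -exprM; apply: (@le_trans _ _ ((102 ^+ 8) ^+ (K ^ 2))); last first.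
    by rewrite exprM lerXn2r ?nnegrE ?exprn_ge0 ?phi_ge0 ?phi_77 //; lra.
  have -> : (102 ^+ 8) ^+ (K ^ 2) = (102 ^+ (K ^ 2)) ^+ (4 * 2) :> R by rewrite -!exprM mulnC.
  by rewrite lerXn2r ?nnegrE ?exprn_ge0.
have BS : B ^+ (2 * (S * K)) <= phi ^+ (beta * (2 * (S * K))).
  rewrite [X in _ <= X]exprM lerXn2r ?nnegrE ?exprn_ge0 ?phi_ge0 // /B; lra.
have pw : phi ^+ (w * (2 * K ^ 2)) <= p%:R ^+ (2 * (E * K ^ 2)).
  rewrite (_ : 2 * (E * K ^ 2) = E * (2 * K ^ 2))%N; last by clear; lia.
  by rewrite exprM [X in _ <= X]exprM lerXn2r ?nnegrE ?exprn_ge0 ?phi_ge0 ?ler0n.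
have B1 : 0 <= B by rewrite /B; lra.
(* The inequality is squared because 102^4 is only known to be below phi^(77/2), a half-integral
   exponent. *)
have : phi ^+ (w * (2 * K ^ 2) * 2)
    <= phi ^+ (K * K * 2 + 77 * K ^ 2 + (2 * (g * nr.+1) * K) * 2 + (beta * (2 * (S * K))) * 2).
  rewrite exprM; apply: (@le_trans _ _ ((p%:R ^+ (2 * (E * K ^ 2))) ^+ 2)).
    by rewrite lerXn2r ?nnegrE ?exprn_ge0 ?phi_ge0 ?ler0n.
  apply: (@le_trans _ _ ((((K + K)`!%:R * P2) ^+ 4 * phi ^+ (2 * (g * nr.+1) * K)
      * B ^+ (2 * (S * K))) ^+ 2)).
    rewrite lerXn2r // nnegrE; first by rewrite exprn_ge0 // ler0n.
    apply: mulr_ge0; last exact: exprn_ge0.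
    apply: mulr_ge0; last exact: exprn_ge0 phi_ge0.
    by apply: exprn_ge0; rewrite mulr_ge0 // ler0n.
  have E1 (x y r b : R) : ((x * y) ^+ 4 * r * b) ^+ 2 = (x ^+ 4) ^+ 2 * (y ^+ 4) ^+ 2 * r ^+ 2 * b ^+ 2.
    by ring.
  have E2 (a b d e : nat) : phi ^+ (a * 2 + b + d * 2 + e * 2)
      = (phi ^+ a) ^+ 2 * phi ^+ b * (phi ^+ d) ^+ 2 * (phi ^+ e) ^+ 2.
    by rewrite !exprD -!exprM.
  have sq (x y : R) : 0 <= x -> x <= y -> x ^+ 2 <= y ^+ 2.
    by move=> x0 xy; rewrite lerXn2r // nnegrE // (le_trans x0).
  rewrite E1 E2.
  apply: ler_pM; [by apply: mulr_ge0; [apply: mulr_ge0|]; exact: sqr_ge0|exact: sqr_ge0| |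
    by apply: sq => //; exact: exprn_ge0].
  apply: ler_pM; [by apply: mulr_ge0; exact: sqr_ge0|exact: sqr_ge0| |by []].
  by apply: ler_pM; rewrite ?sqr_ge0 ?P8 ?sq ?exprn_ge0 ?ler0n.
rewrite phiX_le => expo.
have {}expo : (4 * w * K <= 79 * K + 4 * g * nr.+1 + 4 * beta * u)%N.
  have : (K * (4 * w * K) <= K * (79 * K + 4 * g * nr.+1 + 4 * beta * u))%N.
    by apply: leq_trans (leq_trans _ expo) _; rewrite /S /ns /=; clear; lia.
  by rewrite leq_pmul2l //; move: K104; clear; lia.
rewrite /nr in expo.
have b1 : (30 * (beta * u) <= 8 * (g * beta))%N.
  have b0 : (u * 30 <= 8 * g)%N by [apply: leq_trans uw; rewrite leq_mul2l w30 orbT].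
  by move: b0; clear; nia.
have b2 : (30 * K <= w * K)%N by rewrite leq_mul2r w30 orbT.
move: expo gv kK kbig b1 b2 wg w30 K104; clear.
move: (2 * K %/ ns)%N => v expo gv kK kbig b1 b2 wg w30 K104.
have e1 : (3 * (w * K) <= 79 * K + 8 * g + 4 * (beta * u))%N by lia.
have e2 : (k <= 2 * (w * K) + 2 * w + 2 * K + 5)%N by lia.
have e3 : (210 * g + 7 * (g * beta) < k)%N by lia.
by move: e1 e2 e3 b1 b2; move: (w * K)%N (beta * u)%N (g * beta)%N; lia.
Qed.
End LinearFormBound.

(** * The period of phi modulo powers of p *)

Lemma expr1D_trunc (A : comNzRingType) (x : A) n :
  exists w, (1 + x) ^+ n = 1 + n%:R * x + x ^+ 2 * w.
Proof.
elim: n => [|n [w IH]]; first by exists 0; rewrite expr0; ring.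
by exists (n%:R + w + x * w); rewrite exprS IH -natr1; ring.
Qed.

Lemma expr1D_prime (A : comNzRingType) (x : A) p : prime p ->
  exists w, (1 + x) ^+ p = 1 + x ^+ p + p%:R * w.
Proof.
move=> pp; have p0 := prime_gt0 pp.
have -> : (1 + x) ^+ p = \sum_(0 <= i < p.+1) x ^+ i *+ 'C(p, i).
  by rewrite big_mkord exprDn; apply: eq_bigr => i _; rewrite expr1n mul1r.
rewrite big_nat_recr //= big_ltn // expr0 bin0 binn !mulr1n addrAC.
exists (\sum_(1 <= i < p) x ^+ i *+ ('C(p, i) %/ p)); congr (_ + _).
rewrite big_distrr /= !big_nat; apply: eq_bigr => i ip.
by rewrite mulr_natl -mulrnA divnK // prime_dvd_bin.
Qed.

Section Period.
Variable p : nat.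
Hypothesis pp : prime p.
Let cong (x y : Zphi) := exists z, x = y + p%:R * z.

Let congM x y x' y' : cong x y -> cong x' y' -> cong (x * x') (y * y').
Proof. by move=> [a ->] [b ->]; exists (a * y' + y * b + p%:R * a * b); ring. Qed.
Let congX x y n : cong x y -> cong (x ^+ n) (y ^+ n).
Proof.
move=> h; elim: n => [|n IH]; first by exists 0; rewrite !expr0 mulr0 addr0.
by rewrite !exprS; apply: congM.
Qed.
Let cong_trans x y z : cong x y -> cong y z -> cong x z.
Proof. by move=> [a ->] [b ->]; exists (a + b); ring. Qed.
Let cong_refl x : cong x x. Proof. by exists 0; ring. Qed.
Let cong_nat (m n : nat) : m = n %[mod p] -> cong m%:R n%:R.
Proof.
move=> e; exists ((m %/ p)%:R - (n %/ p)%:R).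
by rewrite {1}(divn_eq m p) {1}(divn_eq n p) e !natrD !natrM; ring.
Qed.

(** For p = 2 h + 1 one has 2 phi^p = (1 + sqrt 5)^p = 1 + 5^h sqrt 5 modulo p, and 5^h is 1 or -1
    unless p = 5. Hence phi^p is phi or -1/phi, and g = p - 1 or 2 (p + 1) will do. The prime 5 uses
    g = 20, which attains 4 p. *)
Lemma zphi_period : exists g, [/\ (0 < g)%N, (g <= 4 * p)%N & exists z, zphi ^+ g = 1 + p%:R * z].
Proof.
have [p2|p2] := eqVneq p 2%N.
  exists 3%N; rewrite p2; split=> //; exists zphi.
  by rewrite zphi_exp (_ : fib 2 = 1)%N // (_ : fib 3 = 2)%N.
have [h pE] : exists h, p = (2 * h).+1.
  have [p2'|od] := even_prime pp; first by rewrite p2' eqxx in p2.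
  by exists p./2; have := odd_double_half p; rewrite od; clear; lia.
have h2 : cong (2%:R ^+ p) 2%:R by rewrite -natrX; apply/cong_nat/fermat_little.
have s5p : cong (zs5 ^+ p) (5%:R ^+ h * zs5).
  by rewrite pE exprSr exprM zs5_sqr; exact: cong_refl.
have cancel2 x y : cong (2%:R * x) (2%:R * y) -> cong x y.
  move=> [z e]; exists (h.+1%:R * z - (x - y)).
  have e2 : x = h.+1%:R * (2%:R * x) - p%:R * x by rewrite pE; ring.
  by rewrite {1}e2 e pE; ring.
have main : cong (2%:R * zphi ^+ p) (1 + 5%:R ^+ h * zs5).
  have e1 : cong (2%:R * zphi ^+ p) ((2%:R * zphi) ^+ p).
    rewrite exprMn; apply: congM (cong_refl _).
    by case: h2 => z ->; exists (- z); ring.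
  apply: cong_trans e1 _; have -> : 2%:R * zphi = 1 + zs5 by rewrite /zs5; ring.
  have [w ->] := expr1D_prime zs5 pp; case: s5p => z ->.
  by exists (z + w); ring.
have [p5|p5] := eqVneq p 5%N.
  exists 20%N; rewrite p5; split=> //; exists (836%:R + 1353%:R * zphi).
  have e : zphi ^+ 10 = 34%:R + 55%:R * zphi.
    by rewrite zphi_exp (_ : fib 9 = 34)%N // (_ : fib 10 = 55)%N.
  have -> : zphi ^+ 20 = (zphi ^+ 10) ^+ 2 by rewrite -exprM.
  rewrite e.
  have -> : (34%:R + 55%:R * zphi) ^+ 2
      = 34%:R ^+ 2 + 2%:R * 34%:R * 55%:R * zphi + 55%:R ^+ 2 * zphi ^+ 2 by ring.
  by rewrite zphi_sqr; ring.
have c5 : cong (5%:R ^+ h) 1 \/ cong (5%:R ^+ h) (- 1).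
  have cp5 : coprime 5 p by rewrite prime_coprime // dvdn_prime2 // eq_sym.
  have : (p %| 5 ^ h.*2 - 1)%N.
    have := fermat_little 5 pp; rewrite pE expnS -/(2 * h)%N => /eqP.
    rewrite eqn_mod_dvd; last by rewrite leq_pmulr // expn_gt0.
    have -> : (5 * 5 ^ (2 * h) - 5 = 5 * (5 ^ (2 * h) - 1))%N by rewrite mulnBr muln1.
    rewrite Gauss_dvdr; last by rewrite -pE coprime_sym.
    by rewrite mul2n.
  have -> : (5 ^ h.*2 - 1 = (5 ^ h - 1) * (5 ^ h + 1))%N.
    by rewrite -addnn expnD; have : (0 < 5 ^ h)%N by [rewrite expn_gt0]; nia.
  rewrite Euclid_dvdM // => /orP[] /dvdnP[q qE]; [left|right]; exists q%:R.
    rewrite -natrX -[(5 ^ h)%N](@subnK 1) ?expn_gt0 // qE natrD natrM; ring.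
  by rewrite -natrX -[(5 ^ h)%N](@addnK 1) qE natrB ?natrM; [ring|rewrite -qE addn1].
case: c5 => c5.
  exists p.-1; split; first by have := prime_gt1 pp; lia.
    by lia.
  have : cong (zphi ^+ p) zphi.
    apply: cancel2; apply: cong_trans main _; case: c5 => z ->; exists (z * zs5).
    by rewrite /zs5; ring.
  rewrite -{1}(prednK (prime_gt0 pp)) exprSr => /congM/(_ (cong_refl zphiV)).
  by rewrite -mulrA zphiVM mulr1.
exists (p.+1 * 2)%N; split; first by lia.
  by have := prime_gt1 pp; lia.
have hm : cong (zphi ^+ p) (- zphiV).
  apply: cancel2; apply: cong_trans main _; case: c5 => z ->; exists (z * zs5).
  by rewrite /zphiV /zs5; ring.
have : cong (zphi ^+ p.+1) (- 1).
  have := congM hm (cong_refl zphi); rewrite -exprSr mulNr mulrC zphiVM.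
  exact.
by move/(@congX _ _ 2); rewrite -exprM sqrrN expr1n.
Qed.

Lemma zphi_period_pow g z E : zphi ^+ g = 1 + p%:R * z ->
  exists y, zphi ^+ (g * p ^ E) = 1 + p%:R ^+ E.+1 * y.
Proof.
move=> h; elim: E => [|E [y IH]]; first by exists z; rewrite expn0 muln1 expr1.
rewrite expnSr mulnA exprM IH; have [w ->] := expr1D_trunc (p%:R ^+ E.+1 * y) p.
by exists (y + p%:R ^+ E * y ^+ 2 * w); rewrite !exprS; ring.
Qed.
End Period.

Lemma fib_gt0 n : (0 < fib n.+1)%N.
Proof. by elim: n => // n IH; rewrite fibSS addn_gt0 IH. Qed.

Lemma zphi_exp_dvd n m y : zphi ^+ n = 1 + m%:R * y -> (m %| fib n)%N.
Proof.
case: n => [|n]; first by rewrite dvdn0.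
rewrite zphi_exp -!(rmorph_nat (@qC int 1 1)) => /(congr1 (@qsnd _ _ _)).
rewrite !qaddE !qmulE /= => e.
have {}e : (fib n.+1)%:Z = m%:Z * qsnd y.
  by move: e; rewrite !natz !(mulr0, mul0r, mulr1, mul1r, add0r, addr0).
by apply/dvdnP; exists `|qsnd y|%N; have := congr1 absz e; rewrite abszM /= mulnC.
Qed.

Section UpperBound.
Variable R : rcfType.
Local Notation phi := (phi R).

Lemma phi_30 : 1 < phi ^+ 30 < (1862 * 1000)%:R.
Proof.
rewrite exprn_egt1 ?phi_gt1 //= (_ : 30 = 10 * 3)%N // exprM.
have h : phi ^+ 10 <= 6151 / 50.
  rewrite phi_fib (_ : fib 9 = 34)%N // (_ : fib 10 = 55)%N //.
  by have := phi_bounds R; lra.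
apply: (@le_lt_trans _ _ ((6151 / 50) ^+ 3)); last by rewrite natrM; lra.
by rewrite lerXn2r ?nnegrE ?exprn_ge0 ?phi_ge0 //; lra.
Qed.

Lemma log_phi_ex (x : nat) : (0 < x)%N -> exists w, phi ^+ w <= x%:R < phi ^+ w.+1.
Proof.
move=> x0.
have ex : exists n, x%:R < phi ^+ n.
  by exists x.+2; apply: le_lt_trans (natr_le_phi R x) _; rewrite phiX_lt.
have := ex_minnP ex; case=> m hm mmin.
have m0 : (0 < m)%N.
  by rewrite lt0n; apply: contraTneq hm => ->; rewrite expr0 (ltr_nat R x 1) -leqNgt.
exists m.-1; rewrite prednK // hm andbT leNgt; apply/negP => /mmin.
by move: m0; clear; lia.
Qed.

(** E is the least exponent with p^E >= phi^30. Then w >= 30, while p^(E - 1) < phi^30 < 1862000, so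
    that the period g p^(E - 1) modulo p^E is at most 4 p times 1862000. *)
Lemma upper_bound (p : nat) (c : int) (k l beta : nat) : prime p ->
  c != 0 -> (fib k)%:Z = (p ^ l)%:Z + c -> c <= (p ^ l)%:Z ->
  s5 R * `|c|%:~R + 1 <= phi ^+ beta -> (k <= (1862 * 4000) * p * (210 + 7 * beta))%N.
Proof.
move=> pp c0 ckl cpl hB.
have p1 := prime_gt1 pp.
have exE : exists E, phi ^+ 30 <= (p ^ E)%:R.
  exists 30; rewrite natrX lerXn2r ?nnegrE ?phi_ge0 ?ler0n //.
  by apply: (@le_trans _ _ 2%:R); rewrite ?ler_nat //; have := phi_bounds R; lra.
have := ex_minnP exE; case=> E hE Emin.
have E0 : (0 < E)%N.
  by rewrite lt0n; apply: contraTneq hE => ->; rewrite expn0 -ltNge; have := phi_30; lra.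
have pE : (p ^ E.-1 <= 1862 * 1000)%N.
  have : (p ^ E.-1)%:R < phi ^+ 30.
    by rewrite ltNge; apply/negP => /Emin; move: E0; clear; lia.
  have [_ h30] := andP phi_30; move=> /lt_trans/(_ h30); rewrite ltr_nat; exact: ltnW.
have [g [g0 g4 [z hz]]] := zphi_period pp.
have [y] := zphi_period_pow E.-1 hz; rewrite (prednK E0); set G := (g * _)%N => hy.
have [|w /andP[w1 w2]] := @log_phi_ex (p ^ E); first by rewrite expn_gt0 ltnW.
have w30 : (30 <= w)%N.
  by rewrite -ltnS -(phiX_lt R); apply: le_lt_trans hE w2.
have G0 : (0 < G)%N by rewrite muln_gt0 g0 expn_gt0 ltnW.
(* p^E divides F_G, and 0 < F_G <= phi^(G - 1). *)
have wG : (w < G)%N.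
  rewrite -(prednK G0) ltnS -(phiX_le R); apply: le_trans w1 _.
  apply: le_trans (fib_le_phi R G.-1); rewrite ler_nat prednK //.
  apply: dvdn_leq; last by rewrite -natrX in hy; exact: zphi_exp_dvd hy.
  by rewrite -(prednK G0) fib_gt0.
have GB : (G <= (1862 * 4000) * p)%N.
  by move: g4 pE; rewrite /G; move: (p ^ _)%N => q g4 pE; nia.
have := linear_form_bound c0 ckl hy E0 (introT andP (conj w30 wG)) _ _ hB cpl.
rewrite -!natrX => /(_ w1 w2) h; apply: leq_trans h _.
have -> : (210 * G + 7 * G * beta = G * (210 + 7 * beta))%N by lia.
by rewrite leq_mul2r GB orbT.
Qed.
End UpperBound.

(** * Norms of short linear combinations *)

Section Solutions.
Variable R : rcfType.
Local Notation phi := (phi R).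
Local Notation psi := (psi R).
Local Notation s5 := (s5 R).
Local Notation ev1 := (ev1 R).
Local Notation ev2 := (ev2 R).

Lemma binet k : phi ^+ k = s5 * (fib k)%:R + psi ^+ k.
Proof.
have [m] := ubnP k; elim: m k => // m IH [|[|k]] km; first by rewrite !expr0 mulr0 add0r.
  by rewrite !expr1 mulr1 /phi /psi; field.
rewrite phiXSS IH ?[phi ^+ k]IH ?fibSS; try by move: km; clear; lia.
by rewrite natrD [psi ^+ k.+2]exprS [psi ^+ k.+1]exprS mulrA -expr2 psi_sqr; ring.
Qed.

Lemma psiX_le m n : (m <= n)%N -> `|psi ^+ n| <= (1237 / 2000) ^+ m.
Proof.
move=> mn; rewrite normrX -(subnK mn) exprD -[X in _ <= X]mul1r.
have h : `|psi| <= 1237 / 2000.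
  by have := psi_bounds R => /andP[h1 h2]; rewrite ltr0_norm; move: h1 h2; clear; lra.
rewrite ler_pM ?exprn_ge0 //; first by rewrite exprn_ile1 ?normr_ge0 //; lra.
by rewrite lerXn2r ?nnegrE ?normr_ge0 //; lra.
Qed.

Lemma psiX_le1 n : `|psi ^+ n| <= 1.
Proof. exact: psiX_le (leq0n n). Qed.

Lemma psiX_le2 n : (2 <= n)%N -> `|psi ^+ n| <= 383 / 1000.
Proof. by move=> /psiX_le; rewrite expr2; lra. Qed.

Lemma ev12_ge1 (t : Zphi) : t != 0 -> 1 <= `|ev1 t| * `|ev2 t|.
Proof.
move=> t0; rewrite -normrM ev12_norm -intr_norm -[1]/(1%:~R) ler_int.
by rewrite -gtz0_ge1 normr_gt0; apply: contraNneq t0 => /qnorm_Zphi_eq0 ->.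
Qed.

Lemma norm_trick (t : Zphi) (k : nat) (x y : R) : t != 0 ->
  `|phi ^+ k * ev1 t| <= x -> `|ev2 t| <= y -> phi ^+ k <= x * y.
Proof.
move=> t0 hx hy.
rewrite -[X in X <= _]mulr1 (le_trans _ (ler_pM _ _ hx hy)) //.
rewrite normrM gtr0_norm ?phiX_gt0 // -mulrA ler_pM2l ?phiX_gt0 //; exact: ev12_ge1.
Qed.

Lemma nat_ler (m n : nat) : (m <= n)%N -> (m%:R : R) <= n%:R.
Proof. by rewrite ler_nat. Qed.

Lemma binet_comb (k h1 h2 : nat) (x0 x1 x2 : R) (y : R) :
  s5 * (x0 * (fib k)%:R - x1 * (fib (k + h1))%:R + x2 * (fib (k + h2))%:R) = y ->
  phi ^+ k * (x0 - x1 * phi ^+ h1 + x2 * phi ^+ h2) =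
    psi ^+ k * (x0 - x1 * psi ^+ h1 + x2 * psi ^+ h2) + y.
Proof.
move=> <-.
have b0 := binet k; have b1 := binet (k + h1); have b2 := binet (k + h2).
rewrite !exprD in b1 b2.
transitivity (x0 * phi ^+ k - x1 * (phi ^+ k * phi ^+ h1) + x2 * (phi ^+ k * phi ^+ h2)).
  by ring.
by rewrite b2 b1 b0; ring.
Qed.

(* With q_i = p^l_i the identity is F_1 (q_3 - q_2) + F_2 (q_1 - q_3) + F_3 (q_2 - q_1) = 0 divided
   by q_1, where A = q_2 / q_1 and Q = q_3 / q_1; it makes an element of Z[phi] of norm
   at least 1 very small in the first embedding. *)
Lemma norm_trick1 (k h1 h2 A Q : nat) : (0 < h1)%N -> (1 < h2)%N -> (0 < A)%N ->
  (2 * A <= Q)%N ->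
  (fib k)%:R * (Q%:R - A%:R) + (fib (k + h2))%:R * (A%:R - 1)
    = (fib (k + h1))%:R * (Q%:R - 1) :> R ->
  phi ^+ k <= 2 * Q%:R.
Proof.
move=> h10 h20 A0 AQ hF.
have AR := nat_ler A0; have QR := nat_ler AQ; rewrite natrM in QR.
pose t : Zphi := (Q%:R - A%:R) - (Q%:R - 1) * zphi ^+ h1 + (A%:R - 1) * zphi ^+ h2.
have t1E : ev1 t = (Q%:R - A%:R) - (Q%:R - 1) * phi ^+ h1 + (A%:R - 1) * phi ^+ h2.
  by rewrite rmorphD rmorphB !rmorphM !rmorphXn !rmorphB !rmorph_nat rmorph1 ev1_phi.
have t2E : ev2 t = (Q%:R - A%:R) - (Q%:R - 1) * psi ^+ h1 + (A%:R - 1) * psi ^+ h2.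
  by rewrite rmorphD rmorphB !rmorphM !rmorphXn !rmorphB !rmorph_nat rmorph1 ev2_phi.
have key : phi ^+ k * ev1 t = psi ^+ k * ev2 t + 0.
  rewrite t1E t2E; apply: binet_comb.
  by rewrite -[RHS](mulr0 s5) -[X in _ = s5 * X](subrr ((fib (k + h1))%:R * (Q%:R - 1))) -{1}hF; ring.
have sq := psi_sqr R; have pb := psi_bounds R.
(* 1 + psi = psi^2 is the largest psi^h with h >= 1, and 1 + 2 psi = psi^3 the smallest with h >= 2.
   Together with 2 A <= Q they make the second embedding of t positive, so t is nonzero. *)
have p1 : psi ^+ h1 <= 1 + psi.
  case: h1 h10 {hF t t1E t2E key} => [//|[|h1]] _; first by rewrite expr1 lerDr.
  rewrite [1 + psi]addrC -sq -(addn2 h1) exprD -[X in _ <= X]mul1r ler_wpM2r ?sqr_ge0 //.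
  by have := psiX_le1 h1; rewrite ler_norml => /andP[].
have p2 : 1 + 2 * psi <= psi ^+ h2.
  case: h2 h20 {hF t t1E t2E key} => [//|[|[|h2]]] // _; first by rewrite sq; move: pb; clear; lra.
  have q3 : psi ^+ 3 = 1 + 2 * psi by rewrite exprS sq mulrDr mulr1 -expr2 sq; ring.
  rewrite -(addn3 h2) exprD q3 -[X in X <= _]mul1r ler_wnM2r //; first by move: pb; clear; lra.
  by have := psiX_le1 h2; rewrite ler_norml => /andP[].
have m1 := psiX_le1 h1; have m2 := psiX_le1 h2; have mk := psiX_le1 k.
rewrite !ler_norml in m1 m2.
have t2le : `|ev2 t| <= 2 * Q%:R.
  rewrite t2E; move: m1 m2 AR QR; clear.
  move: (psi ^+ h1) (psi ^+ h2) => u v /andP[m1 m1'] /andP[m2 m2'] AR QR.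
  have e1 : 0 <= (Q%:R - 1) * (1 - u) by apply: mulr_ge0; lra.
  have e2 : 0 <= (Q%:R - 1) * (1 + u) by apply: mulr_ge0; lra.
  have e3 : 0 <= (A%:R - 1) * (1 - v) by apply: mulr_ge0; lra.
  have e4 : 0 <= (A%:R - 1) * (1 + v) by apply: mulr_ge0; lra.
  by rewrite ler_norml; lra.
have t2gt : 0 < ev2 t.
  rewrite t2E; move: p1 p2 AR QR pb; clear.
  move: (psi ^+ h1) (psi ^+ h2) => u v p1 p2 AR QR /andP[_ pb].
  have e1 : 0 <= (Q%:R - 1) * (1 + psi - u) by apply: mulr_ge0; lra.
  have e3 : 0 <= (A%:R - 1) * (v - (1 + 2 * psi)) by apply: mulr_ge0; lra.
  have e5 : 0 < (Q%:R - 2 * A%:R + 1) * (- psi) by apply: mulr_gt0; lra.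
  by lra.
have t0 : t != 0 by apply: contraTneq t2gt => ->; rewrite rmorph0 ltxx.
rewrite addr0 in key.
have le1 : `|phi ^+ k * ev1 t| <= 2 * Q%:R / phi ^+ k.
  rewrite key normrM mulrC ler_pM ?normr_ge0 // -exprVn.
  have -> : phi^-1 = - psi.
    by apply: (mulIf (lt0r_neq0 (phi_gt0 R))); rewrite mulVf ?lt0r_neq0 ?phi_gt0 // mulNr mulrC phi_psi opprK.
  by rewrite normrX ltr0_norm //; move: pb; clear; lra.
have h := norm_trick t0 le1 t2le.
have P0 := phiX_gt0 R k; move: h; rewrite mulrAC ler_pdivlMr // -!expr2 ler_pXn2r ?nnegrE //.
  exact: ltW.
by rewrite mulr_ge0 ?ler0n.
Qed.

Lemma fib_le_of_phi k (y : R) : (2 <= k)%N -> phi ^+ k <= y ->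
  2236 / 1000 * (fib k)%:R <= y + 383 / 1000.
Proof.
move=> k2; have := binet k; have := psiX_le2 k2; rewrite ler_norml.
move: (phi ^+ k) (psi ^+ k) => u v /andP[v1 v2] -> hy.
have := s5_bounds R => /andP[s1 _].
have h : 0 <= (s5 - 2236 / 1000) * (fib k)%:R.
  by rewrite mulr_ge0 ?ler0n // subr_ge0 ltW.
by move: h v1 v2 hy; clear; lra.
Qed.

(** For powers q_0 < q_1 < q_2 of p take D = q_2 / q_1 and x = q_0: the combination on the left
    loses c as well as q_1 and q_2. So phi^k times the first embedding of t is of size x D, while
    the second embedding is at most 2 D. *)
Lemma norm_trick2 (k h1 h2 D : nat) (x : R) : (2 <= k)%N -> (1 < D)%N -> 1 <= x ->
  ((fib (k + h2))%:R - (fib k)%:R) - D%:R * ((fib (k + h1))%:R - (fib k)%:R) = x * (D%:R - 1) :> R ->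
  phi ^+ k <= 61 / 10 * (x * D%:R ^+ 2).
Proof.
move=> k2 D1 x1 hF; have DR := nat_ler D1.
pose t : Zphi := (D%:R - 1) - D%:R * zphi ^+ h1 + 1 * zphi ^+ h2.
have t1E : ev1 t = (D%:R - 1) - D%:R * phi ^+ h1 + 1 * phi ^+ h2.
  by rewrite rmorphD rmorphB !rmorphM !rmorphXn !rmorphB !rmorph_nat rmorph1 ev1_phi.
have t2E : ev2 t = (D%:R - 1) - D%:R * psi ^+ h1 + 1 * psi ^+ h2.
  by rewrite rmorphD rmorphB !rmorphM !rmorphXn !rmorphB !rmorph_nat rmorph1 ev2_phi.
have key : phi ^+ k * ev1 t = psi ^+ k * ev2 t + s5 * (x * (D%:R - 1)).
  by rewrite t1E t2E; apply: binet_comb; rewrite -hF; ring.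
have s5b := s5_bounds R.
have t0 : t != 0.
  apply/eqP => t0; move/eqP: key; rewrite t0 !rmorph0 !mulr0 add0r eq_sym !mulf_eq0.
  by move: s5b DR x1; clear=> /andP[s5b _] DR x1; rewrite !gt_eqF //; lra.
have m1 := psiX_le1 h1; have m2 := psiX_le1 h2; have mk := psiX_le2 k2.
rewrite !ler_norml in m1 m2.
have t2le : `|ev2 t| <= 2 * D%:R.
  rewrite t2E; move: m1 m2 DR; clear.
  move: (psi ^+ h1) (psi ^+ h2) => u v /andP[m1 m1'] /andP[m2 m2'] DR.
  have e1 : 0 <= D%:R * (1 - u) by apply: mulr_ge0; lra.
  have e2 : 0 <= D%:R * (1 + u) by apply: mulr_ge0; lra.
  by rewrite ler_norml; lra.
have le1 : `|phi ^+ k * ev1 t| <= 305 / 100 * (x * D%:R).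
  rewrite key; apply: le_trans (ler_normD _ _) _; rewrite normrM.
  have /le_trans -> // : `|psi ^+ k| * `|ev2 t| + `|s5 * (x * (D%:R - 1))| <=
    383 / 1000 * (2 * D%:R) + 2237 / 1000 * (x * (D%:R - 1)).
    apply: lerD; first by rewrite ler_pM.
    have h0 : 0 <= x * (D%:R - 1) by apply: mulr_ge0; move: DR x1; clear; lra.
    rewrite normrM (ger0_norm h0) ler_wpM2r // ger0_norm; move: s5b; clear; lra.
  have h1' : 0 <= (x - 1) * D%:R by apply: mulr_ge0; move: DR x1; clear; lra.
  by move: h1' DR x1; clear; lra.
apply: le_trans (norm_trick t0 le1 t2le) _.
by have -> : 305 / 100 * (x * D%:R) * (2 * D%:R) = 61 / 10 * (x * D%:R ^+ 2) by field.
Qed.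

(** The identity of [norm_trick1] once more, with k now the middle index and x the smallest
    Fibonacci number, moved to the right as a known quantity. *)
Lemma norm_trick3 (k h A Q : nat) (x : R) : (2 <= k)%N -> (0 < A)%N -> (2 * A <= Q)%N -> 1 <= x ->
  (fib (k + h))%:R * (A%:R - 1) - (fib k)%:R * (Q%:R - 1) = - (x * (Q%:R - A%:R)) :> R ->
  phi ^+ k <= 43 / 10 * (x * Q%:R ^+ 2).
Proof.
move=> k2 A0 AQ x1 hF; have AR := nat_ler A0; have QR := nat_ler AQ; rewrite natrM in QR.
pose t : Zphi := - (Q%:R - 1) - 0 * zphi ^+ 0 + (A%:R - 1) * zphi ^+ h.
have t1E : ev1 t = - (Q%:R - 1) - 0 * phi ^+ 0 + (A%:R - 1) * phi ^+ h.
  by rewrite /t !mul0r !subr0 rmorphD rmorphN !rmorphM !rmorphXn !rmorphB !rmorph_nat rmorph1 ev1_phi.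
have t2E : ev2 t = - (Q%:R - 1) - 0 * psi ^+ 0 + (A%:R - 1) * psi ^+ h.
  by rewrite /t !mul0r !subr0 rmorphD rmorphN !rmorphM !rmorphXn !rmorphB !rmorph_nat rmorph1 ev2_phi.
have key : phi ^+ k * ev1 t = psi ^+ k * ev2 t + s5 * - (x * (Q%:R - A%:R)).
  by rewrite t1E t2E; apply: binet_comb; rewrite -hF; ring.
have s5b := s5_bounds R.
have t0 : t != 0.
  apply/eqP => t0; move/eqP: key; rewrite t0 !rmorph0 !mulr0 add0r eq_sym mulf_eq0 oppr_eq0 mulf_eq0.
  by move: s5b AR QR x1; clear=> /andP[s5b _] AR QR x1; rewrite !gt_eqF //; lra.
have m1 := psiX_le1 h; have mk := psiX_le2 k2; rewrite ler_norml in m1.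
have t2le : `|ev2 t| <= 3 / 2 * Q%:R.
  rewrite t2E; move: m1 AR QR; clear.
  move: (psi ^+ h) => u /andP[m1 m1'] AR QR.
  have e1 : 0 <= (A%:R - 1) * (1 - u) by apply: mulr_ge0; lra.
  have e2 : 0 <= (A%:R - 1) * (1 + u) by apply: mulr_ge0; lra.
  by rewrite ler_norml; lra.
have le1 : `|phi ^+ k * ev1 t| <= 282 / 100 * (x * Q%:R).
  rewrite key; apply: le_trans (ler_normD _ _) _; rewrite normrM.
  have /le_trans -> // : `|psi ^+ k| * `|ev2 t| + `|s5 * - (x * (Q%:R - A%:R))| <=
    383 / 1000 * (3 / 2 * Q%:R) + 2237 / 1000 * (x * (Q%:R - A%:R)).
    apply: lerD; first by rewrite ler_pM.
    have h0 : 0 <= x * (Q%:R - A%:R) by apply: mulr_ge0; move: AR QR x1; clear; lra.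
    rewrite normrM normrN (ger0_norm h0) ler_wpM2r // ger0_norm; move: s5b; clear; lra.
  have h1' : 0 <= (x - 1) * Q%:R by apply: mulr_ge0; move: AR QR x1; clear; lra.
  have h2' : 0 <= x * A%:R by apply: mulr_ge0; move: AR QR x1; clear; lra.
  by move: h1' h2' AR QR x1; clear; lra.
apply: le_trans (norm_trick t0 le1 t2le) _.
have -> : 282 / 100 * (x * Q%:R) * (3 / 2 * Q%:R) = 423 / 100 * (x * Q%:R ^+ 2) by field.
by rewrite ler_wpM2r ?mulr_ge0 ?exprn_ge0 ?ler0n //; move: x1; clear; lra.
Qed.
End Solutions.

(** * A gap principle *)

Lemma bernoulli (R : realDomainType) (x : R) n : -1 <= x -> 1 + n%:R * x <= (1 + x) ^+ n.
Proof.
move=> x1; elim: n => [|n IH]; first by rewrite mul0r addr0 expr0.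
have h : 0 <= (1 + x) * ((1 + x) ^+ n - (1 + n%:R * x)) by apply: mulr_ge0; lra.
have h2 : 0 <= n%:R * x ^+ 2 by rewrite mulr_ge0 ?sqr_ge0 ?ler0n.
by rewrite exprS -[n.+1]addn1 natrD; move: h h2; rewrite expr2; clear; lra.
Qed.

(** An upper bound for (1 + x)^n free of division: 1 - n x is at most (1 - x)^n, and (1 - x^2)^n is
    at most 1. *)
Lemma bernoulli_inv (R : realDomainType) (x : R) n : `|x| <= 1 -> (1 + x) ^+ n * (1 - n%:R * x) <= 1.
Proof.
rewrite ler_norml => /andP[x1 x2].
have h := @bernoulli R (- x) n; rewrite mulrN lerN2 in h.
have p0 : 0 <= 1 + x by lra.
apply: le_trans (ler_wpM2l (exprn_ge0 n p0) (h x2)) _.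
have h2 : 0 <= (1 - x) * (1 + x) by apply: mulr_ge0; lra.
rewrite -exprMn exprn_ile1 //.
  by move: h2; clear; lra.
by have := sqr_ge0 x; rewrite expr2; clear; lra.
Qed.

Section RealGap.
Variable R : rcfType.
Local Notation phi := (phi R).
Local Notation psi := (psi R).
Local Notation s5 := (s5 R).

Lemma phi_pow_gap (M N : nat) (u v : R) : phi ^+ M * u = phi ^+ N * v ->
  0 < u -> u < v -> v < phi * u -> False.
Proof.
move=> h u0 uv vu; have pM := phiX_gt0 R M; have pN := phiX_gt0 R N.
have : phi ^+ N < phi ^+ M.
  by rewrite -(ltr_pM2r u0) h ltr_pM2l.
rewrite phiX_lt -(phiX_le R) exprS => NM.
move: NM; have -> : phi * phi ^+ N = phi ^+ N * phi by rewrite mulrC.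
move=> NM; have := ler_wpM2r (ltW u0) NM; by rewrite h -mulrA ler_pM2l // => /(lt_le_trans vu); rewrite ltxx.
Qed.

(* The two products are close to 1 but distinct, while their quotient is a power of phi. *)
Lemma gap_core (M N a b : nat) (s f1 f2 f3 : R) : s = 1 \/ s = -1 ->
  phi ^+ M * (1 + s * f2) ^+ (a + b) = phi ^+ N * ((1 + s * f1) ^+ b * (1 + s * f3) ^+ a) ->
  0 <= f1 -> 0 <= f2 <= 1 -> 0 <= f3 -> f1 <= 1 -> f3 <= 1 ->
  b%:R * f1 + a%:R * f3 <= 1 / 10 -> 0 < (a + b)%:R * f2 <= 1 / 20 ->
  6 / 5 * ((a + b)%:R * f2) <= b%:R * f1 + a%:R * f3 -> False.
Proof.
move=> hs h f1p /andP[f2p f21] f3p f11 f31 hx /andP[y0 hy] xy.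
have sn z : 0 <= z -> z <= 1 -> `|s * z| <= 1.
  by move=> z0 z1; rewrite normrM (ger0_norm z0) (_ : `|s| = 1) ?mul1r //; case: hs => ->; rewrite ?normrN normr1.
have sb z n : 0 <= z -> z <= 1 -> 1 + s * (n%:R * z) <= (1 + s * z) ^+ n.
  move=> z0 z1; rewrite mulrCA; apply: bernoulli.
  by have := sn z z0 z1; rewrite ler_norml => /andP[].
have si z n : 0 <= z -> z <= 1 -> (1 + s * z) ^+ n * (1 - s * (n%:R * z)) <= 1.
  by move=> z0 z1; rewrite mulrCA; apply: bernoulli_inv; exact: sn.
have U1 := sb f2 (a + b)%N f2p f21; have U2 := si f2 (a + b)%N f2p f21.
have B1 := sb f1 b f1p f11; have B2 := si f1 b f1p f11.
have C1 := sb f3 a f3p f31; have C2 := si f3 a f3p f31.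
have x1p : 0 <= b%:R * f1 by rewrite mulr_ge0 ?ler0n.
have x3p : 0 <= a%:R * f3 by rewrite mulr_ge0 ?ler0n.
move: h U1 U2 B1 B2 C1 C2 y0 hy hx xy x1p x3p.
move: ((1 + s * f2) ^+ (a + b)) ((1 + s * f1) ^+ b) ((1 + s * f3) ^+ a) => U V1 V3.
move: ((a + b)%:R * f2) (b%:R * f1) (a%:R * f3) => y x1 x3.
move=> h U1 U2 B1 B2 C1 C2 y0 hy hx xy x1p x3p.
have ss : s * s = 1 by case: hs => ->; rewrite ?mulrNN mul1r.
have V1p : 0 < V1 by move: hs B1 hx x1p x3p; clear => -[] ->; lra.
have V3p : 0 < V3 by move: hs C1 hx x1p x3p; clear => -[] ->; lra.
have Up : 0 < U by move: hs U1 y0 hy; clear => -[] ->; lra.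
have x13 : 0 <= x1 * x3 by rewrite mulr_ge0.
have Vlo : 1 + s * (x1 + x3) <= V1 * V3.
  apply: le_trans (_ : (1 + s * x1) * (1 + s * x3) <= _).
    have -> : (1 + s * x1) * (1 + s * x3) = 1 + s * (x1 + x3) + (s * s) * (x1 * x3) by ring.
    by rewrite ss mul1r lerDl.
  by rewrite ler_pM //; move: hs hx x1p x3p; clear => -[] ->; lra.
have Vhi : V1 * V3 * (1 - s * (x1 + x3)) <= 1.
  apply: le_trans (_ : (V1 * (1 - s * x1)) * (V3 * (1 - s * x3)) <= 1).
    have -> : V1 * (1 - s * x1) * (V3 * (1 - s * x3)) =
      V1 * V3 * (1 - s * (x1 + x3)) + V1 * V3 * ((s * s) * (x1 * x3)) by ring.
    by rewrite ss mul1r lerDl !mulr_ge0 ?(ltW V1p) ?(ltW V3p).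
  rewrite -[X in _ <= X]mul1r ler_pM // mulr_ge0 ?(ltW V1p) ?(ltW V3p) //;
    move: hs hx x1p x3p; clear => -[] ->; lra.
move: Vlo Vhi h; have Vp : 0 < V1 * V3 by rewrite mulr_gt0.
move: {B1 B2 C1 C2 V1p V3p} (V1 * V3) Vp => V Vp.
have {xy} : 6 / 5 * y <= x1 + x3 by [].
move: {x1p x3p x13} (x1 + x3) hx => x hx xy Vlo Vhi h.
have pb := phi_bounds R.
have key : 1 < (1 + x) * (1 - y).
  have h1 : 0 <= y * (1 / 10 - x) by rewrite mulr_ge0 ?(ltW y0) // subr_ge0.
  by move: h1 xy y0; clear; lra.
case: hs => hs; rewrite hs ?mulN1r ?mul1r ?opprK in U1 U2 Vlo Vhi.
  apply: (phi_pow_gap h Up).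
    have y1 : 0 < 1 - y by move: hy; clear; lra.
    rewrite -(ltr_pM2r y1); apply: le_lt_trans U2 (lt_le_trans key _).
    by rewrite ler_wpM2r ?(ltW y1).
  have x1' : 0 < 1 - x by move: hx; clear; lra.
  rewrite -(ltr_pM2r x1'); apply: le_lt_trans Vhi _.
  have e1 : 0 <= (phi - 1618 / 1000) * U by rewrite mulr_ge0 ?(ltW Up) //; move: pb; clear; lra.
  have e2 : 0 <= (phi * U - 1618 / 1000) * (1 / 10 - x).
    by rewrite mulr_ge0 //; move: e1 U1 y0 hx; clear; lra.
  by move: e1 e2 U1 y0 hx; clear; lra.
apply: (phi_pow_gap (esym h) Vp).
  have x1' : 0 < 1 + x by move: xy y0; clear; lra.
  rewrite -(ltr_pM2r x1'); apply: le_lt_trans Vhi (lt_le_trans key _).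
  by rewrite mulrC ler_wpM2r ?(ltW x1').
have e1 : 0 <= (phi - 1618 / 1000) * V by rewrite mulr_ge0 ?(ltW Vp) //; move: pb; clear; lra.
have e2 : 0 <= U * y by rewrite mulr_ge0 ?ltW.
by move: e1 e2 U2 Vlo hx; clear; lra.
Qed.

(** For f_1, f_2, f_3 proportional to 1, p^-a, p^-(a + b) it says that b f_1 + a f_3 is at least 5/4
    of (a + b) f_2, with equality for p = 2, a = b = 1. [gap_core] asks for 6/5 only, which leaves
    room for the one percent errors of [real_gap]. *)
Lemma pow_gap_nat (p a b : nat) : (1 < p)%N -> (0 < a)%N -> (0 < b)%N ->
  (5 * ((a + b) * p ^ b) <= 4 * (p ^ a * p ^ b * b + a))%N.
Proof.
move=> p1 a0 b0.
have gen : (2 * a + 1 <= p ^ a)%N -> (5 * ((a + b) * p ^ b) <= 4 * (p ^ a * p ^ b * b + a))%N.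
  move=> h; have h1 : ((2 * a + 1) * (p ^ b * b) <= p ^ a * p ^ b * b)%N by rewrite -mulnA leq_mul.
  have h2 : (p ^ b * (5 * (a + b)) <= p ^ b * (4 * (2 * a + 1) * b))%N.
    by rewrite leq_mul //; move: a0 b0; clear; nia.
  by move: h1 h2; move: (p ^ a * p ^ b * b)%N => w; move: (p ^ b)%N => z; clear; nia.
have pow n q : (0 < n)%N -> (3 <= q)%N -> (2 * n + 1 <= q ^ n)%N.
  move=> + q3; elim: n => // -[|n] IH _; first by rewrite expn1; move: q3; clear; lia.
  have := IH isT; rewrite [(q ^ n.+2)%N]expnS => h.
  have := leq_mul q3 h; clear; lia.
have [p3|] := leqP 3 p; first exact: gen (pow _ _ a0 p3).
move=> p3; have {p1 p3} -> : p = 2%N by move: p1 p3; clear; lia.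
case: a a0 {gen pow} => [//|[|[|a]]] _.
- case: b b0 => [//|[|b]] _; first by [].
  have : (2 <= 2 ^ b.+2)%N by rewrite expnS leq_pmulr ?expn_gt0.
  by rewrite expn1; move: (2 ^ b.+2)%N => w; clear; nia.
- have : (2 <= 2 ^ b)%N by case: b b0 => // b _; rewrite expnS leq_pmulr ?expn_gt0.
  by rewrite (_ : 2 ^ 2 = 4)%N //; move: (2 ^ b)%N b0 => w; clear; nia.
have h : (2 * a.+3 + 1 <= 2 ^ a.+3)%N.
  elim: a => [//|a IH]; rewrite expnS; move: IH; clear; lia.
have h1 : ((2 * a.+3 + 1) * (2 ^ b * b) <= 2 ^ a.+3 * 2 ^ b * b)%N by rewrite -mulnA leq_mul.
have h2 : (2 ^ b * (5 * (a.+3 + b)) <= 2 ^ b * (4 * (2 * a.+3 + 1) * b))%N.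
  by rewrite leq_mul //; move: b0; clear; nia.
by move: h1 h2; move: (2 ^ a.+3 * 2 ^ b * b)%N => w; move: (2 ^ b)%N => z; clear; nia.
Qed.

(** If the conclusion failed, t = |c| / p^l1 would satisfy 13 t (a + b) < 1, which makes all
    deviations from 1 small enough for [gap_core]. Indices of at least 8 keep psi^k / sqrt 5 below
    one percent of |c|. *)
Lemma real_gap (p k1 k2 k3 l1 a b : nat) (c : R) : (1 < p)%N -> (0 < a)%N -> (0 < b)%N ->
  (8 <= k1)%N -> (8 <= k2)%N -> (8 <= k3)%N ->
  (fib k1)%:R = p%:R ^+ l1 + c -> (fib k2)%:R = p%:R ^+ (l1 + a) + c ->
  (fib k3)%:R = p%:R ^+ (l1 + a + b) + c -> 1 <= `|c| -> 100 * `|c| <= p%:R ^+ l1 ->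
  p%:R ^+ l1 <= 13 * (`|c| * (a + b)%:R).
Proof.
move=> p1 a0 b0 k18 k28 k38 F1 F2 F3 c1 cq; rewrite leNgt; apply/negP => hlt.
have s5b := s5_bounds R; have s5p : 0 < s5 by move: s5b; clear; lra.
have [s [hs ss cE]] : exists s : R, [/\ s = 1 \/ s = -1, s * s = 1 & s * c = `|c|].
  case: (leP 0 c) => hc; [exists 1 | exists (-1)]; split.
  - by left.
  - by rewrite mul1r.
  - by rewrite mul1r ger0_norm.
  - by right.
  - by rewrite mulrNN mul1r.
  - by rewrite mulN1r ltr0_norm.
pose d k := s * (c + psi ^+ k / s5).
have dE k : (8 <= k)%N -> 99 / 100 * `|c| <= d k <= 101 / 100 * `|c|.
  move=> k8; rewrite /d mulrDr cE.
  have : `|s * (psi ^+ k / s5)| <= 1 / 100.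
    rewrite normrM (_ : `|s| = 1) ?mul1r; last by case: hs => ->; rewrite ?normrN normr1.
    rewrite normrM normfV (gtr0_norm s5p) ler_pdivrMr //.
    apply: le_trans (psiX_le _ k8) _; rewrite !exprS expr0; move: s5b; clear; lra.
  by rewrite ler_norml; move: c1; clear; lra.
have phiE k q : 0 < q -> (fib k)%:R = q + c -> phi ^+ k = s5 * q * (1 + s * (d k / q)).
  move=> q0 Fk; rewrite binet Fk /d [s * (_ / q)]mulrA mulrA ss mul1r.
  by field; rewrite !gt_eqF.
have pR : 2 <= p%:R :> R by rewrite (ler_nat R 2).
have p0 : 0 < p%:R :> R by move: pR; clear; lra.
have gap : 5 * ((a%:R + b%:R) * p%:R ^+ b) <= 4 * (p%:R ^+ a * p%:R ^+ b * b%:R + a%:R) :> R.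
  by have := pow_gap_nat p1 a0 b0; rewrite -(ler_nat R) !(natrM, natrD, natrX).
have A2 : 2 <= p%:R ^+ a :> R by case: (a) a0 => // n _; rewrite exprS -[X in X <= _]mulr1 ler_pM ?exprn_ege1 //; move: pR; clear; lra.
have B2 : 2 <= p%:R ^+ b :> R by case: (b) b0 => // n _; rewrite exprS -[X in X <= _]mulr1 ler_pM ?exprn_ege1 //; move: pR; clear; lra.
have AB : (p%:R ^+ a) ^+ b = (p%:R ^+ b) ^+ a :> R by rewrite -!exprM mulnC.
have q0 : 0 < p%:R ^+ l1 :> R by rewrite exprn_gt0.
rewrite exprD in F2; rewrite !exprD in F3.
move: (p%:R ^+ l1) (p%:R ^+ a) (p%:R ^+ b) q0 AB A2 B2 gap F1 F2 F3 cq hlt => q A B q0 AB A2 B2 gap F1 F2 F3 cq hlt.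
have A0 : 0 < A by move: A2; clear; lra.
have B0 : 0 < B by move: B2; clear; lra.
have P1 := phiE _ _ q0 F1; have P2 := phiE _ _ (mulr_gt0 q0 A0) F2.
have P3 := phiE _ _ (mulr_gt0 (mulr_gt0 q0 A0) B0) F3.
have D1 := dE _ k18; have D2 := dE _ k28; have D3 := dE _ k38.
move: {dE phiE} (d k1) (d k2) (d k3) P1 P2 P3 D1 D2 D3 => d1 d2 d3 P1 P2 P3 D1 D2 D3.
have aR := @nat_ler R _ _ a0; have bR := @nat_ler R _ _ b0.
pose t := `|c| / q.
have tq : `|c| = t * q by rewrite /t mulfVK ?gt_eqF.
rewrite tq in D1 D2 D3 c1 cq hlt.
have t0 : 0 < t by rewrite -(pmulr_lgt0 _ q0); apply: lt_le_trans c1.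
have t1 : 100 * t <= 1 by rewrite -(ler_pM2r q0) mul1r -mulrA.
have tab : 13 * (t * (a + b)%:R) < 1.
  rewrite -(ltr_pM2r q0) mul1r; move: hlt; congr (_ < _); ring.
have dq d0 : 99 / 100 * (t * q) <= d0 <= 101 / 100 * (t * q) -> 99 / 100 * t <= d0 / q <= 101 / 100 * t.
  by move=> h; rewrite ler_pdivlMr // ler_pdivrMr //; move: h; clear; lra.
have f1E := dq _ D1.
have f2E : 99 / 100 * t <= d2 / (q * A) * A <= 101 / 100 * t.
  have -> : d2 / (q * A) * A = d2 / q by field; rewrite !gt_eqF.
  exact: dq.
have f3E : 99 / 100 * t <= d3 / (q * A * B) * A * B <= 101 / 100 * t.
  have -> : d3 / (q * A * B) * A * B = d3 / q by field; rewrite !gt_eqF.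
  exact: dq.
(* The exponents are chosen such that l1 b + (l1 + a + b) a = (l1 + a) (a + b): all powers of p and
   of sqrt 5 cancel. *)
have eqn : phi ^+ (k1 * b + k3 * a) * (1 + s * (d2 / (q * A))) ^+ (a + b) =
  phi ^+ (k2 * (a + b)) * ((1 + s * (d1 / q)) ^+ b * (1 + s * (d3 / (q * A * B))) ^+ a).
  rewrite exprD !exprM P1 P2 P3 !exprMn.
  have -> : (s5 ^+ (a + b)) = s5 ^+ a * s5 ^+ b by rewrite exprD.
  have -> : q ^+ (a + b) = q ^+ a * q ^+ b by rewrite exprD.
  have -> : A ^+ (a + b) = A ^+ a * B ^+ a by rewrite exprD AB.
  by ring.
move: {P1 P2 P3 F1 F2 F3} (d1 / q) (d2 / (q * A)) (d3 / (q * A * B)) f1E f2E f3E eqn.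
move=> f1 f2 f3 f1E f2E f3E eqn; rewrite natrD in tab.
have f2p : 0 < f2 by rewrite -(pmulr_lgt0 _ A0); move: f2E t0; clear; lra.
have f3p : 0 < f3 by rewrite -(pmulr_lgt0 _ A0) -(pmulr_lgt0 _ B0); move: f3E t0; clear; lra.
have f2A : 0 <= f2 * (A - 2) by rewrite mulr_ge0 ?(ltW f2p) // subr_ge0.
have f3A : 0 <= f3 * (A - 2) by rewrite mulr_ge0 ?(ltW f3p) // subr_ge0.
have f3B : 0 <= f3 * A * (B - 2) by rewrite mulr_ge0 ?mulr_ge0 ?(ltW f3p) ?(ltW A0) // subr_ge0.
apply: (gap_core hs eqn).
- by move: f1E t0; clear; lra.
- by move: f2E f2A f2p t1; clear; lra.
- exact: ltW.
- by move: f1E t1; clear; lra.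
- by move: f3E f3A f3B t1; clear; lra.
- have e1 : 0 <= b%:R * (101 / 100 * t - f1) by rewrite mulr_ge0 ?ler0n //; move: f1E; clear; lra.
  have e3 : 0 <= a%:R * (101 / 100 * t - f3) by rewrite mulr_ge0 ?ler0n //; move: f3E f3A f3B f3p; clear; lra.
  by move: e1 e3 tab; clear; lra.
- rewrite natrD; apply/andP; split; first by rewrite mulr_gt0 //; move: aR; clear; have := ler0n R b; lra.
  have e1 : 0 <= (a%:R + b%:R) * (101 / 100 * t - f2 * 2).
    apply: mulr_ge0; first by rewrite -natrD ler0n.
    by move: f2E f2A; clear; lra.
  by move: e1 tab; clear; lra.
rewrite natrD -(ler_pM2r A0) -(ler_pM2r B0).
have e1 : 0 <= (a%:R + b%:R) * B * (101 / 100 * t - f2 * A).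
  apply: mulr_ge0; first by rewrite mulr_ge0 ?(ltW B0) // -natrD ler0n.
  by move: f2E; clear; lra.
have e2 : 0 <= b%:R * A * B * (f1 - 99 / 100 * t).
  apply: mulr_ge0; first by rewrite !mulr_ge0 ?ler0n ?(ltW B0) ?(ltW A0).
  by move: f1E; clear; lra.
have e3 : 0 <= a%:R * (f3 * A * B - 99 / 100 * t).
  by rewrite mulr_ge0 ?ler0n //; move: f3E; clear; lra.
have e4 : 0 <= t * (4 * (A * B * b%:R + a%:R) - 5 * ((a%:R + b%:R) * B)).
  by rewrite mulr_ge0 ?(ltW t0) // subr_ge0.
have e5 : 0 <= t * ((a%:R + b%:R) * B) by rewrite -natrD; apply: mulr_ge0 (ltW t0) (mulr_ge0 (ler0n _ _) (ltW B0)).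
by move: e1 e2 e3 e4 e5; clear; lra.
Qed.
End RealGap.

(** * Bounds for the exponents *)

Lemma fib_leq m n : (m <= n)%N -> (fib m <= fib n)%N.
Proof.
move=> /subnKC <-; elim: (n - m)%N => [|d IH]; first by rewrite addn0.
rewrite addnS; apply: leq_trans IH _.
by case: (m + d)%N => // j; rewrite fibSS leq_addr.
Qed.

Lemma fib_ltn m n : (2 <= m)%N -> (m < n)%N -> (fib m < fib n)%N.
Proof.
case: m => [|[|m]] // _ mn; apply: leq_trans (fib_leq mn).
by rewrite [fib m.+3]fibSS -addn1 leq_add2l fib_gt0.
Qed.

Lemma fib_lt_2X k : (fib k < 2 ^ k)%N.
Proof.
have [n] := ubnP k; elim: n k => // n IH [|[|k]] kn; rewrite ?expn0 ?expn1 //.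
have h1 := IH k.+1; have h2 := IH k; rewrite fibSS !expnS in h1 h2 *.
by move: (h1 ltac:(lia)) (h2 ltac:(lia)); lia.
Qed.

(* 13 comes from [real_gap], 1862 * 4000 and 7 from [upper_bound]. *)
Definition Zc : nat := locked (13 * (1862 * 4000) * 7)%N.

Section Bounds.
Variable R : rcfType.
Local Notation phi := (phi R).
Local Notation psi := (psi R).
Local Notation s5 := (s5 R).

Lemma Zc_real : (Zc%:R : R) = 13 * (1862 * 4000) * 7.
Proof. by rewrite /Zc -lock !natrM. Qed.

(** [real_gap] for the solutions 2, 3, 4 gives p^l_2 <= 13 |c| (l_4 - l_2), where l_4 <= k_4 and
    [upper_bound] controls k_4; note 210 + 7 beta = 7 (30 + beta). If p^l_2 < 100 |c| the claim is
    trivial, its factor before |c| being at least 13 times 8. *)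
Lemma fifth_bound (p : nat) (c : int) (k l : nat -> nat) (beta : nat) : prime p -> c != 0 ->
  (forall i, (2 <= i <= 4)%N -> (fib (k i))%:Z = (p ^ l i)%:Z + c) ->
  (k 2 < k 3)%N -> (k 3 < k 4)%N -> (l 2 < l 3)%N -> (l 3 < l 4)%N ->
  (`|c| <= p ^ l 2)%N -> s5 * `|c|%:~R + 1 <= phi ^+ beta ->
  (p ^ l 2 <= Zc * p * (30 + beta) * `|c|)%N.
Proof.
move=> pp c0 hF k23 k34 l23 l34 cl hb.
have p1 := prime_gt1 pp; have p0 := prime_gt0 pp.
have pl4 : (p ^ l 2 * 2 <= p ^ l 4)%N.
  apply: (@leq_trans (p ^ (l 2).+1)); last by rewrite leq_pexp2l // (ltn_trans l23 l34).
  by rewrite expnS mulnC leq_mul2r p1 orbT.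
have F4 := hF 4 isT; have F3 := hF 3 isT; have F2 := hF 2 isT.
have cle : c <= (p ^ l 4)%:Z by move: cl pl4; move: (p ^ l 2)%N (p ^ l 4)%N => x y; clear; lia.
have c1 : (1 <= `|c|)%N by rewrite absz_gt0.
have U4 := upper_bound pp c0 F4 cle hb.
have lk4 : (l 4 <= k 4)%N.
  have h1 : (p ^ l 4 <= 2 * fib (k 4))%N by move: cl pl4 F4; move: (p ^ l 2)%N (p ^ l 4)%N (fib (k 4)) => x y z; clear; lia.
  have h2 : (2 ^ l 4 < 2 ^ (k 4).+1)%N.
    apply: leq_ltn_trans (_ : p ^ l 4 < _)%N; first by case: (l 4) => // n; rewrite leq_exp2r.
    by rewrite expnS; apply: leq_ltn_trans h1 _; rewrite ltn_pmul2l // fib_lt_2X.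
  by rewrite ltn_exp2l // in h2.
have [x [zE x8 {}U4]] : exists x,
    [/\ Zc = (13 * x * 7)%N, (8 <= x)%N & (k 4 <= x * p * (210 + 7 * beta))%N].
  by exists (1862 * 4000)%N; split; rewrite // /Zc -lock.
have UZ : (13 * (x * p * (210 + 7 * beta)) = Zc * p * (30 + beta))%N.
  by rewrite zE; clear; nia.
have U8 : (8 <= x * p * (210 + 7 * beta))%N.
  by apply: (@leq_trans (8 * 1 * 1)%N) => //; rewrite !leq_mul.
rewrite -UZ.
have [cq|cq] := leqP (100 * `|c|) (p ^ l 2); last first.
  apply: leq_trans (ltnW cq) _; rewrite leq_mul2r; apply/orP; right.
  by move: U8; move: (x * p * (210 + 7 * beta))%N => u; clear; lia.
have k8 : (8 <= k 2)%N.
  rewrite leqNgt; apply/negP => hk; have : (fib (k 2) <= fib 7)%N by exact: fib_leq.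
  by rewrite (_ : fib 7 = 13)%N //; move: cq F2 c1; move: (p ^ l 2)%N (fib (k 2)) => y z; clear; lia.
have FR i : (2 <= i <= 4)%N -> (fib (k i))%:R = p%:R ^+ l i + c%:~R :> R.
  by move=> /hF h; have := congr1 (intmul (1 : R)) h; rewrite intrD -!pmulrn natrX.
have l3E : l 3 = (l 2 + (l 3 - l 2))%N by rewrite subnKC // ltnW.
have l4E : l 4 = (l 2 + (l 3 - l 2) + (l 4 - l 3))%N by rewrite subnKC ?(ltnW l23) // subnKC // ltnW.
have := @real_gap R p (k 2) (k 3) (k 4) (l 2) (l 3 - l 2) (l 4 - l 3) c%:~R p1.
rewrite !subn_gt0 -l4E -l3E -intr_norm.
move=> /(_ l23 l34 k8 (leq_trans k8 (ltnW k23)) (leq_trans k8 (ltnW (ltn_trans k23 k34)))).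
move=> /(_ (FR 2 isT) (FR 3 isT) (FR 4 isT)).
have -> : (`|c|%:~R : R) = `|c|%N%:R by rewrite pmulrn abszE.
rewrite -natrX -!natrM -[1]/(1%:R) !ler_nat.
move=> /(_ c1 cq) /leq_trans; apply.
rewrite -mulnA leq_mul2l /= mulnC leq_mul2r; apply/orP; right.
by move: U4 lk4 l23 l34; move: (x * p * (210 + 7 * beta))%N (k 4) (l 2) (l 3) (l 4) => u *; lia.
Qed.

Lemma phi_224 : 256 * (Zc%:R) ^+ 5 < phi ^+ 224.
Proof.
have -> : phi ^+ 224 = (phi ^+ 16) ^+ 14 by rewrite -exprM.
rewrite Zc_real.
apply: (@lt_le_trans _ _ (2206 ^+ 14)).
  rewrite !exprS !expr0; lra.
rewrite lerXn2r ?nnegrE ?exprn_ge0 ?phi_ge0 //.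
rewrite phi_fib (_ : fib 15 = 610)%N // (_ : fib 16 = 987)%N //.
by have /andP[h _] := phi_bounds R; move: h; clear; lra.
Qed.

(** In the two bounds below, p^4 is at most the square of 4 Zc (33 + v): for p <= 10^4 since that
    number exceeds p^2, otherwise because it is supposed to be at least p^3. The threshold 328 = 224
    + 104 adds the exponents of [phi_224], for the constant, and of [natr2_le_phi], for the powers
    of 33 + v. *)
Lemma phi_dominates v : (328 <= v)%N ->
  16 * (Zc%:R) ^+ 3 * (33 + v)%:R ^+ 3 * (4 * Zc%:R * (33 + v)%:R) ^+ 2 < phi ^+ v.
Proof.
move=> hv; have [K [vE K1]] : exists K, (v = 224 + K)%N /\ (104 <= K)%N.
  by exists (v - 224)%N; move: hv; clear; lia.
have -> : 16 * (Zc%:R) ^+ 3 * (33 + v)%:R ^+ 3 * (4 * Zc%:R * (33 + v)%:R) ^+ 2 =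
   256 * (Zc%:R) ^+ 5 * (33 + v)%:R ^+ 5 :> R.
  by move: (Zc%:R : R) ((33 + v)%:R : R) => z t; ring.
rewrite [X in phi ^+ X]vE exprD.
have T1 : (33 + v)%:R ^+ 5 <= phi ^+ K :> R.
  apply: le_trans (natr2_le_phi R K1).
  apply: (@le_trans _ _ ((4 * K)%:R ^+ 5)).
    by rewrite lerXn2r ?nnegrE ?ler0n // ler_nat; move: K1 vE; clear; lia.
  have K0 := @nat_ler R _ _ K1; have -> : (4 * K)%:R = 2 * (K + K)%:R :> R by rewrite !natrM !natrD; ring.
  move: K0; have -> : (K%:R : R) = (K + K)%:R / 2 by rewrite natrD; field.
  move: ((K + K)%:R : R) => x hx.
  have x2 : 2 <= x by move: hx; clear; lra.
  have h : 0 <= x ^+ 5 * (x ^+ 3 - 2 ^+ 5).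
    rewrite mulr_ge0 ?exprn_ge0 ?subr_ge0 //; first by move: hx; clear; lra.
    have : (4 : R) ^+ 3 <= x ^+ 3 by rewrite lerXn2r ?nnegrE //; move: hx; clear; lra.
    by rewrite !exprS !expr0; clear; lra.
  by rewrite -subr_ge0; apply: le_trans h _; rewrite le_eqVlt; apply/orP; left; apply/eqP; ring.
have h5 : (0 : R) < (33 + v)%:R ^+ 5 by rewrite exprn_gt0 // ltr0n.
apply: lt_le_trans (_ : phi ^+ 224 * (33 + v)%:R ^+ 5 <= _).
  by rewrite ltr_pM2r //; exact: phi_224.
by rewrite ler_pM2l ?phiX_gt0.
Qed.

Lemma T_bound_small (v p : nat) : (p <= 10 * 1000)%N ->
  phi ^+ v <= 16 * (Zc%:R) ^+ 3 * (33 + v)%:R ^+ 3 * p%:R ^+ 4 -> (v <= 327)%N.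
Proof.
move=> hp h; rewrite leqNgt; apply/negP => hv; have := phi_dominates hv.
rewrite ltNge => /negP; apply; apply: le_trans h _.
rewrite ler_wpM2l ?mulr_ge0 ?exprn_ge0 ?ler0n // (_ : 4 = 2 * 2)%N // exprM.
rewrite lerXn2r ?nnegrE ?mulr_ge0 ?exprn_ge0 ?ler0n //.
have p1 := @nat_ler R _ _ hp; rewrite natrM in p1.
have v1 : (33 : R) <= (33 + v)%:R by rewrite ler_nat leq_addr.
apply: (@le_trans _ _ ((10 * 1000) ^+ 2)); first by rewrite lerXn2r ?nnegrE ?ler0n //; lra.
rewrite Zc_real; move: v1; clear; lra.
Qed.

Lemma T_bound_large (v p : nat) : (10 * 1000 <= p)%N ->
  phi ^+ v <= 16 * (Zc%:R) ^+ 3 * (33 + v)%:R ^+ 3 * p%:R ^+ 4 ->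
  4 * Zc%:R * (33 + v)%:R < p%:R ^+ 3 :> R.
Proof.
move=> hp h; rewrite ltNge; apply/negP => hT.
have p1 := @nat_ler R _ _ hp; rewrite natrM in p1.
have p3 : (10 * 1000) ^+ 3 <= p%:R ^+ 3 :> R by rewrite lerXn2r ?nnegrE ?ler0n //; move: p1; clear; lra.
have hv : (328 <= v)%N.
  rewrite leqNgt; apply/negP => hv; have := le_trans p3 hT; rewrite Zc_real.
  have : ((33 + v)%:R : R) <= 361%:R by rewrite ler_nat; move: hv; clear; lia.
  by clear; lra.
have := phi_dominates hv; rewrite ltNge => /negP; apply; apply: le_trans h _.
rewrite ler_wpM2l ?mulr_ge0 ?exprn_ge0 ?ler0n //.
apply: (@le_trans _ _ ((p%:R ^+ 3) ^+ 2)); last first.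
  by rewrite lerXn2r ?nnegrE ?mulr_ge0 ?exprn_ge0 ?ler0n.
by rewrite -exprM ler_weXn2l //; move: p1; clear; lra.
Qed.
End Bounds.

Section Constraints.
Variable R : rcfType.
Local Notation phi := (phi R).
Local Notation s5 := (s5 R).

Lemma pow2_le (p m n : nat) : (1 < p)%N -> (m < n)%N -> (2 * p ^ m <= p ^ n)%N.
Proof.
move=> p1 mn; apply: (@leq_trans (p ^ m.+1)); last by rewrite leq_pexp2l // ltnW.
by rewrite expnS leq_mul2r p1 orbT.
Qed.

Lemma norm_bounds (p : nat) (c : R) (k0 k1 k2 l a d : nat) : (1 < p)%N ->
  (2 <= k0)%N -> (k0 < k1)%N -> (k1 < k2)%N -> (0 < a)%N -> (0 < d)%N ->
  (fib k0)%:R = p%:R ^+ l + c -> (fib k1)%:R = p%:R ^+ (l + a) + c ->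
  (fib k2)%:R = p%:R ^+ (l + (a + d)) + c ->
  [/\ (fib k0 <= p ^ (a + d))%N, (fib k0 <= 3 * (p ^ l * (p ^ d) ^ 2))%N &
      (fib k1 <= 3 * (fib k0 * (p ^ (a + d)) ^ 2))%N].
Proof.
move=> p1 k02 k01 k12 a0 d0 F0 F1 F2.
have p0 : (0 < p)%N := ltnW p1.
have A1 : (0 < p ^ a)%N by rewrite expn_gt0 p0.
have A2 : (2 <= p ^ a)%N by rewrite -(prednK a0) expnS (leq_trans p1) // leq_pmulr // expn_gt0 p0.
have D2 : (1 < p ^ d)%N by rewrite -(prednK d0) expnS (leq_trans p1) // leq_pmulr // expn_gt0 p0.
have AQ : (2 * p ^ a <= p ^ (a + d))%N by rewrite pow2_le // -[X in (X < _)%N]addn0 ltn_add2l.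
have q1 : 1 <= p%:R ^+ l :> R by rewrite -natrX (ler_nat R 1) expn_gt0 p0.
have k1E : k1 = (k0 + (k1 - k0))%N by rewrite subnKC // ltnW.
have k2E : k2 = (k0 + (k2 - k0))%N by rewrite subnKC // ltnW // (ltn_trans k01).
have k2E' : k2 = (k1 + (k2 - k1))%N by rewrite subnKC // ltnW.
have F0p : (1 <= fib k0)%N by rewrite -(prednK (ltnW k02)) fib_gt0.
have AR : (p ^ a)%:R = p%:R ^+ a :> R by rewrite natrX.
have DR : (p ^ d)%:R = p%:R ^+ d :> R by rewrite natrX.
have QR : (p ^ (a + d))%:R = p%:R ^+ a * p%:R ^+ d :> R by rewrite natrX exprD.
rewrite exprD in F1; rewrite !exprD in F2.
split.
- have := @norm_trick1 R k0 (k1 - k0) (k2 - k0) (p ^ a) (p ^ (a + d)).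
  rewrite -k1E -k2E F0 F1 F2 AR QR => /(_ _ _ A1 AQ) h.
  have /h {h} h1 : (0 < k1 - k0)%N by rewrite subn_gt0.
  have /h1 {h1} h2 : (1 < k2 - k0)%N by move: k01 k12; clear; lia.
  have {}h2 : phi ^+ k0 <= 2 * (p%:R ^+ a * p%:R ^+ d) by apply: h2; ring.
  have := fib_le_of_phi k02 h2; rewrite -QR -(ler_nat R).
  have : 4%:R <= (p ^ (a + d))%:R :> R by rewrite ler_nat (leq_trans _ AQ) // (@leq_mul 2 2).
  by clear; lra.
- have := @norm_trick2 R k0 (k1 - k0) (k2 - k0) (p ^ d) (p%:R ^+ l) k02 D2 q1.
  rewrite -k1E -k2E F0 F1 F2 DR => h.
  have {}h : phi ^+ k0 <= 61 / 10 * (p%:R ^+ l * (p%:R ^+ d) ^+ 2) by apply: h; ring.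
  have := fib_le_of_phi k02 h; rewrite -(ler_nat R) !(natrM, natrX).
  have h1 : 1 <= p%:R ^+ l * (p%:R ^+ d) ^+ 2 :> R.
    rewrite -[X in X <= _]mulr1 ler_pM // exprn_ege1 // -natrX (ler_nat R 1); exact: ltnW.
  by move: h1; clear; lra.
have := @norm_trick3 R k1 (k2 - k1) (p ^ a) (p ^ (a + d)) (fib k0)%:R
  (leq_trans k02 (ltnW k01)) A1 AQ (nat_ler _ F0p).
rewrite -k2E' F0 F1 F2 AR QR => h.
have {}h : phi ^+ k1 <= 43 / 10 * ((p%:R ^+ l + c) * (p%:R ^+ a * p%:R ^+ d) ^+ 2).
  by apply: h; ring.
have := fib_le_of_phi (leq_trans k02 (ltnW k01)) h; rewrite -F0 -QR -(ler_nat R) !(natrM, natrX).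
have h1 : 1 <= (fib k0)%:R * ((p%:R ^+ (a + d)) ^+ 2) :> R.
  rewrite -[X in X <= _]mulr1 ler_pM // ?(nat_ler _ F0p) // exprn_ege1 // -natrX (ler_nat R 1).
  by rewrite expn_gt0 p0.
by move: h1; clear; lra.
Qed.

Lemma fib_double k : (0 < k)%N -> (fib k.+1 <= 2 * fib k)%N.
Proof.
case: k => // k _; rewrite fibSS mul2n -addnn leq_add2l; exact: fib_leq.
Qed.

(** F_(k_1) exceeds F_(k_0) by at least half of F_(k_0), since consecutive Fibonacci numbers have
    ratio at most 2, and F_(k_0) >= C. *)
Lemma pos_le (p C : nat) (k l : nat -> nat) : prime p -> (0 < C)%N -> (2 <= k 0)%N ->
  (forall i j, (i < j)%N -> (j <= 4)%N -> (k i < k j)%N) ->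
  (forall i j, (i < j)%N -> (j <= 4)%N -> (l i < l j)%N) ->
  (forall i, (i <= 4)%N -> fib (k i) = p ^ l i + C)%N -> (C <= 2 * p ^ l 1)%N.
Proof.
move=> pp C0 k2 hk hl hF; have F0 := hF 0%N isT; have F1 := hF 1%N isT.
have k01 := hk _ _ (isT : (0 < 1)%N)%N isT.
have [n [kn n1]] : exists n, k 1 = n.+2 /\ (0 < n)%N.
  by exists (k 1 - 2)%N; move: k01 k2; move: (k 0) (k 1) => *; lia.
have h1 : (fib (k 0) <= fib n.+1)%N by apply: fib_leq; rewrite -ltnS -kn.
have h2 := fib_double n1.
rewrite kn fibSS in F1.
by move: F0 F1 h1 h2; move: (p ^ l 0)%N (p ^ l 1)%N (fib n) (fib n.+1) (fib (k 0)) => *; lia.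
Qed.

(** 2617 / 1000 is just below phi^2, so if v is the integral part of log_phi x for a bound x of |c|,
    then beta = v + 3 is admissible. With the 30 of [fifth_bound] this is the origin of 33 + v. *)
Lemma beta_ok (x y : R) v : s5 * y + 1 <= 2617 / 1000 * x -> x < phi ^+ v.+1 -> s5 * y + 1 <= phi ^+ (v + 3).
Proof.
move=> h hx; apply: le_trans h _; rewrite (_ : (v + 3 = 2 + v.+1)%N); last by lia.
rewrite exprD; have x0 := phiX_gt0 R v.+1.
have p2 : 2617 / 1000 <= phi ^+ 2 by rewrite phi_sqr; have := phi_bounds R; clear; lra.
have e : 0 <= (phi ^+ 2 - 2617 / 1000) * phi ^+ v.+1 by rewrite mulr_ge0 ?(ltW x0) // subr_ge0.
by move: e hx; clear; lra.
Qed.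

Local Notation P p := (p%:R : R).

Lemma order_bound p v : 2 <= P p -> 12 * (Zc%:R * P p * (33 + v)%:R) ^+ 3 <= 16 * (Zc%:R) ^+ 3 * (33 + v)%:R ^+ 3 * P p ^+ 4.
Proof.
move=> P2.
have : 0 <= (Zc%:R * P p * (33 + v)%:R) ^+ 3 by rewrite exprn_ge0 // !mulr_ge0 ?ler0n.
have -> : 16 * (Zc%:R) ^+ 3 * (33 + v)%:R ^+ 3 * P p ^+ 4 = 16 * P p * (Zc%:R * P p * (33 + v)%:R) ^+ 3.
  by move: (Zc%:R : R) ((33 + v)%:R : R) (P p) => x y z; ring.
move: (_ ^+ 3) => x x0; have := mulr_ge0 x0 (_ : 0 <= P p - 2).
by rewrite subr_ge0 => /(_ P2); move: x0; clear; lra.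
Qed.

Lemma Zc_gt0 : (0 < Zc)%N.
Proof. by rewrite -(ltr_nat R) Zc_real; clear; lra. Qed.

(** [T_bound_small] gives 33 + v <= 360, and 12 (360 Zc)^4 is below 2^156. This is where the search
    limit of [run_prime] comes from. *)
Lemma small_final p v : 2 <= P p -> (p <= 10 * 1000)%N ->
  phi ^+ v <= 16 * (Zc%:R) ^+ 3 * (33 + v)%:R ^+ 3 * P p ^+ 4 ->
  12 * (Zc%:R * P p * (33 + v)%:R) ^+ 4 <= P p ^+ 5 * 2 ^+ 156.
Proof.
move=> P2 hp /(T_bound_small hp) hv.
have hT : ((33 + v)%:R : R) <= 360%:R by rewrite ler_nat; move: hv; clear; lia.
apply: (@le_trans _ _ (12 * (Zc%:R * P p * 360%:R) ^+ 4)).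
  rewrite ler_pM2l // lerXn2r ?nnegrE ?mulr_ge0 ?ler0n // ler_wpM2l // mulr_ge0 ?ler0n //.
have -> : 12 * (Zc%:R * P p * 360%:R) ^+ 4 = P p ^+ 4 * (12 * (Zc%:R * 360%:R) ^+ 4).
  by move: (Zc%:R : R) (P p) (360%:R : R) => x y z; ring.
rewrite [P p ^+ 5]exprSr -mulrA ler_wpM2l ?exprn_ge0 ?ler0n // Zc_real.
apply: (@le_trans _ _ (1 * 2 ^+ 156)).
  rewrite mul1r (_ : 156 = 12 * 13)%N // exprM; clear; lra.
by rewrite ler_wpM2r ?exprn_ge0 //; move: P2; clear; lra.
Qed.

(** Put w = Zc p (33 + v). Against p^l_2 <= w C from [fifth_bound] stand three bounds of C: by p^(a
    + d), by 2 p^l_1 and by 3 p^l_0 p^(2 d). They yield p^l_0 <= w, p^d <= 2 w and p^(a + d) <= 3 w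
    p^(2 d). As v is a logarithm of p^(a + d), it is thereby bounded; for p >= 10^4 this gives 4 w <
    p^4 and the exponents can be read off. *)
Lemma constraints_pos (p C : nat) (k l : nat -> nat) : prime p -> (0 < C)%N -> (2 <= k 0)%N ->
  (forall i j, (i < j)%N -> (j <= 4)%N -> (k i < k j)%N) ->
  (forall i j, (i < j)%N -> (j <= 4)%N -> (l i < l j)%N) ->
  (forall i, (i <= 4)%N -> fib (k i) = p ^ l i + C)%N ->
  ((p <= 10 * 1000)%N -> P p ^+ l 2 <= P p ^+ 5 * 2 ^+ 156) /\
  ((10 * 1000 <= p)%N -> [/\ (l 0 <= 3)%N, (l 2 - l 1 <= 3)%N & (l 2 - l 0 <= 2 * (l 2 - l 1) + 3)%N]).
Proof.
move=> pp C0 k2 hk hl hF; have Cle := pos_le pp C0 k2 hk hl hF.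
have p1 := prime_gt1 pp; have p0 := prime_gt0 pp.
have expn_gt0_p n : (0 < p ^ n)%N by rewrite expn_gt0 p0.
have P2 : 2 <= P p by rewrite (ler_nat R 2).
have P0 : 0 < P p by rewrite ltr0n.
have l01 := hl _ _ (isT : (0 < 1)%N)%N isT; have l12 := hl _ _ (isT : (1 < 2)%N)%N isT.
have l23 := hl _ _ (isT : (2 < 3)%N)%N isT; have l34 := hl _ _ (isT : (3 < 4)%N)%N isT.
have [a [a0 l1E]] : exists a, (0 < a)%N /\ l 1 = (l 0 + a)%N.
  by exists (l 1 - l 0)%N; rewrite subn_gt0 l01 subnKC // ltnW.
have [d [d0 l2E]] : exists d, (0 < d)%N /\ l 2 = (l 0 + (a + d))%N.
  by exists (l 2 - l 1)%N; rewrite subn_gt0 l12 addnA -l1E subnKC // ltnW.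
have FR i : (i <= 4)%N -> (fib (k i))%:R = P p ^+ l i + C%:R :> R.
  by move=> i4; rewrite hF // natrD natrX.
have F0 := FR 0%N isT; have F1 := FR 1%N isT; have F2 := FR 2%N isT.
rewrite l1E in F1; rewrite l2E in F2.
have [n1 n2 _] := norm_bounds p1 k2 (hk _ _ (isT : (0 < 1)%N)%N isT) (hk _ _ (isT : (1 < 2)%N)%N isT) a0 d0 F0 F1 F2.
have CF : (C <= fib (k 0))%N by rewrite hF // leq_addl.
have [v /andP[v1 v2]] := log_phi_ex R (expn_gt0_p (a + d)).
have c0 : (C%:Z != 0) by move: C0; clear; lia.
have := @fifth_bound R p C%:Z k l (v + 3) pp c0.
have hF' i : (2 <= i <= 4)%N -> (fib (k i))%:Z = (p ^ l i)%:Z + C%:Z.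
  by move=> /andP[_ i4]; rewrite hF // PoszD.
move=> /(_ hF' (hk _ _ (isT : (2 < 3)%N) isT) (hk _ _ (isT : (3 < 4)%N) isT) l23 l34).
have cl : (C <= p ^ l 2)%N by apply: leq_trans Cle (pow2_le p1 l12).
move=> /(_ cl); rewrite -pmulrn => fb.
have CQ : (C <= p ^ (a + d))%N by apply: leq_trans CF n1.
have {fb} : (p ^ l 2 <= Zc * p * (33 + v) * C)%N.
  have -> : (33 + v = 30 + (v + 3))%N by clear; lia.
  apply: fb; apply: beta_ok v2.
  have Q4 : (4 <= p ^ (a + d))%N.
    apply: (@leq_trans (p ^ 2)); first by rewrite (@leq_mul 2 2).
    by rewrite leq_pexp2l //; move: a0 d0; clear; lia.
  have /= := nat_ler R CQ; have /= := nat_ler R Q4; have := s5_bounds R.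
  move: ((p ^ (a + d))%:R : R) (C%:R : R) => x y /andP[_ sb] x4 yx.
  have e1 : 0 <= (2237 / 1000 - s5) * x by rewrite mulr_ge0 //; move: sb x4; clear; lra.
  have e2 : 0 <= s5 * (x - y) by rewrite mulr_ge0 ?subr_ge0 //; exact: sqrtr_ge0.
  by move: e1 e2 x4; clear; lra.
rewrite l2E; move=> hq.
have hqR : P p ^+ l 0 * (P p ^+ a * P p ^+ d) <= Zc%:R * P p * (33 + v)%:R * C%:R.
  by have := nat_ler R hq; rewrite !natrM natrX !exprD.
have Z0 : (0 : R) < Zc%:R by rewrite ltr0n Zc_gt0.
have T0 : (0 : R) < (33 + v)%:R by rewrite ltr0n.
have h1 : C%:R <= 2 * (P p ^+ l 0 * P p ^+ a).
  by have := nat_ler R Cle; rewrite natrM natrX l1E exprD.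
have h2 : C%:R <= P p ^+ a * P p ^+ d by have := nat_ler R CQ; rewrite natrX exprD.
have h3 : C%:R <= 3 * (P p ^+ l 0 * (P p ^+ d) ^+ 2).
  by have := nat_ler R (leq_trans CF n2); rewrite !(natrM, natrX).
have v1' : phi ^+ v <= P p ^+ a * P p ^+ d by move: v1; rewrite natrX exprD.
set w := Zc%:R * P p * (33 + v)%:R in hqR.
have w0 : 0 < w by rewrite !mulr_gt0.
have q0 : P p ^+ l 0 <= w.
  rewrite -(ler_pM2r (_ : 0 < P p ^+ a * P p ^+ d)); last by rewrite mulr_gt0 ?exprn_gt0.
  by apply: le_trans hqR _; rewrite ler_pM2l.
have D0 : P p ^+ d <= 2 * w.
  rewrite -(ler_pM2l (_ : 0 < P p ^+ l 0 * P p ^+ a)); last by rewrite mulr_gt0 ?exprn_gt0.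
  rewrite -mulrA; apply: le_trans hqR _.
  by rewrite -(ler_pM2l w0) in h1; apply: le_trans h1 _; rewrite le_eqVlt; apply/orP; left; apply/eqP; ring.
have Q1 : P p ^+ a * P p ^+ d <= 3 * w * (P p ^+ d) ^+ 2.
  rewrite -(ler_pM2l (_ : 0 < P p ^+ l 0)); last by rewrite exprn_gt0.
  apply: le_trans hqR _; rewrite -(ler_pM2l w0) in h3; apply: le_trans h3 _.
  by rewrite le_eqVlt; apply/orP; left; apply/eqP; ring.
have Q2 : P p ^+ a * P p ^+ d <= 12 * w ^+ 3.
  apply: le_trans Q1 _.
  have : (P p ^+ d) ^+ 2 <= (2 * w) ^+ 2 by rewrite lerXn2r ?nnegrE ?exprn_ge0 ?mulr_ge0 ?(ltW w0) ?(ltW P0).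
  rewrite -(ler_pM2l (_ : 0 < 3 * w)) ?mulr_gt0 // => /le_trans; apply.
  by rewrite le_eqVlt; apply/orP; left; apply/eqP; ring.
have Tb : phi ^+ v <= 16 * (Zc%:R) ^+ 3 * (33 + v)%:R ^+ 3 * P p ^+ 4.
  apply: le_trans v1' _; apply: le_trans Q2 _; exact: order_bound.
split=> hp.
  rewrite !exprD; have q2 : P p ^+ l 0 * (P p ^+ a * P p ^+ d) <= 12 * w ^+ 4.
    have -> : 12 * w ^+ 4 = w * (12 * w ^+ 3) by ring.
    by rewrite ler_pM ?mulr_ge0 ?exprn_ge0 ?(ltW P0).
  apply: le_trans q2 _; apply: (small_final P2 hp Tb).
have lg := T_bound_large hp Tb.
have w4 : 4 * w < P p ^+ 4.
  have -> : 4 * w = 4 * Zc%:R * (33 + v)%:R * P p by rewrite /w; ring.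
  by rewrite [P p ^+ 4]exprSr ltr_pM2r.
have p1R : 1 < P p by move: P2; clear; lra.
have dle : (d < 4)%N.
  by rewrite -(ltr_eXn2l p1R); apply: le_lt_trans D0 _; move: w4 w0; clear; lra.
have l0le : (l 0 < 4)%N.
  by rewrite -(ltr_eXn2l p1R); apply: le_lt_trans q0 _; move: w4 w0; clear; lra.
have ble : (a + d < 4 + d * 2)%N.
  rewrite -(ltr_eXn2l p1R) !exprD exprM; apply: le_lt_trans Q1 _.
  by rewrite ltr_pM2r ?exprn_gt0 //; move: w4 w0; clear; lra.
have -> : (l 0 + (a + d) - l 1 = d)%N by rewrite l1E addnA addKn.
by rewrite addKn; split; move: dle l0le ble; clear; lia.
Qed.

(** Now C < p^l_0, so p^l_2 <= w C gives p^(a + d) <= w. The third norm bound gives p^l_1 <= 6 p^(3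
    (a + d)), hence p^l_0 <= 3 w^3, and v, here a logarithm of p^l_0, is again bounded. *)
Lemma constraints_neg (p C : nat) (k l : nat -> nat) : prime p -> (0 < C)%N -> (2 <= k 0)%N ->
  (forall i j, (i < j)%N -> (j <= 4)%N -> (k i < k j)%N) ->
  (forall i j, (i < j)%N -> (j <= 4)%N -> (l i < l j)%N) ->
  (forall i, (i <= 4)%N -> fib (k i) + C = p ^ l i)%N ->
  ((p <= 10 * 1000)%N -> P p ^+ l 2 <= P p ^+ 5 * 2 ^+ 156) /\
  ((10 * 1000 <= p)%N -> (l 2 - l 0 <= 3)%N /\ (l 1 <= 3 * (l 2 - l 0))%N).
Proof.
move=> pp C0 k2 hk hl hF.
have p1 := prime_gt1 pp; have p0 := prime_gt0 pp.
have expn_gt0_p n : (0 < p ^ n)%N by rewrite expn_gt0 p0.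
have P2 : 2 <= P p by rewrite (ler_nat R 2).
have P0 : 0 < P p by rewrite ltr0n.
have l01 := hl _ _ (isT : (0 < 1)%N)%N isT; have l12 := hl _ _ (isT : (1 < 2)%N)%N isT.
have l23 := hl _ _ (isT : (2 < 3)%N)%N isT; have l34 := hl _ _ (isT : (3 < 4)%N)%N isT.
have [a [a0 l1E]] : exists a, (0 < a)%N /\ l 1 = (l 0 + a)%N.
  by exists (l 1 - l 0)%N; rewrite subn_gt0 l01 subnKC // ltnW.
have [d [d0 l2E]] : exists d, (0 < d)%N /\ l 2 = (l 0 + (a + d))%N.
  by exists (l 2 - l 1)%N; rewrite subn_gt0 l12 addnA -l1E subnKC // ltnW.
have FR i : (i <= 4)%N -> (fib (k i))%:R = P p ^+ l i + - C%:R :> R.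
  by move=> i4; rewrite -natrX -hF // natrD addrK.
have F0 := FR 0%N isT; have F1 := FR 1%N isT; have F2 := FR 2%N isT.
rewrite l1E in F1; rewrite l2E in F2.
have [n1 _ n3] := norm_bounds p1 k2 (hk _ _ (isT : (0 < 1)%N)%N isT) (hk _ _ (isT : (1 < 2)%N)%N isT) a0 d0 F0 F1 F2.
have F0p : (1 <= fib (k 0))%N by rewrite -(prednK (ltnW k2)) fib_gt0.
have Clt : (C < p ^ l 0)%N by rewrite -hF // -[X in (X < _)%N]add0n ltn_add2r.
have [v /andP[v1 v2]] := log_phi_ex R (expn_gt0_p (l 0)).
have c0 : (- C%:Z != 0) by move: C0; clear; lia.
have := @fifth_bound R p (- C%:Z) k l (v + 3) pp c0.
have hF' i : (2 <= i <= 4)%N -> (fib (k i))%:Z = (p ^ l i)%:Z + - C%:Z.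
  by move=> /andP[_ i4]; rewrite -hF // PoszD addrK.
move=> /(_ hF' (hk _ _ (isT : (2 < 3)%N) isT) (hk _ _ (isT : (3 < 4)%N) isT) l23 l34); rewrite abszN normrN.
have cl : (C <= p ^ l 2)%N.
  by apply: leq_trans (ltnW Clt) _; rewrite leq_pexp2l // ltnW // (ltn_trans l01).
move=> /(_ cl); rewrite -pmulrn => fb.
have {fb} : (p ^ l 2 <= Zc * p * (33 + v) * C)%N.
  have -> : (33 + v = 30 + (v + 3))%N by clear; lia.
  apply: fb; apply: beta_ok v2.
  have := nat_ler R Clt; rewrite -natr1; have := s5_bounds R; have := ler0n R C.
  move: ((p ^ l 0)%:R : R) (C%:R : R) => x y y0 /andP[sb1 sb] xy.
  have e1 : 0 <= (2237 / 1000 - s5) * x by rewrite mulr_ge0 //; move: sb y0 xy; clear; lra.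
  have e2 : 0 <= s5 * (x - y - 1) by rewrite mulr_ge0 //; [exact: sqrtr_ge0|move: xy; clear; lra].
  by move: e1 e2 sb1 xy y0; clear; lra.
rewrite l2E => hq.
have hqR : P p ^+ l 0 * (P p ^+ a * P p ^+ d) <= Zc%:R * P p * (33 + v)%:R * C%:R.
  by have := nat_ler R hq; rewrite !natrM natrX !exprD.
have Z0 : (0 : R) < Zc%:R by rewrite ltr0n Zc_gt0.
have T0 : (0 : R) < (33 + v)%:R by rewrite ltr0n.
have h1 : C%:R <= P p ^+ l 0 by have := nat_ler R (ltnW Clt); rewrite natrX.
have v1' : phi ^+ v <= P p ^+ l 0 by move: v1; rewrite natrX.
set w := Zc%:R * P p * (33 + v)%:R in hqR.
have w0 : 0 < w by rewrite !mulr_gt0.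
have Q0 : P p ^+ a * P p ^+ d <= w.
  rewrite -(ler_pM2l (_ : 0 < P p ^+ l 0)); last by rewrite exprn_gt0.
  by apply: le_trans hqR _; rewrite [X in _ <= X]mulrC ler_pM2l.
have q1le : (p ^ l 1 <= 6 * (p ^ (a + d)) ^ 3)%N.
  have g1 := hF 1%N isT; have g2 := pow2_le p1 l01.
  have g3 : (fib (k 1) <= 3 * (p ^ (a + d)) ^ 3)%N.
    by apply: leq_trans n3 _; rewrite [((p ^ (a + d)) ^ 3)%N]expnS !leq_mul.
  move: g1 g2 g3 Clt; move: (p ^ l 0)%N (p ^ l 1)%N (fib (k 1)) ((p ^ (a + d)) ^ 3)%N => x y z t u1 u2 u3 u4.
  by clear -u1 u2 u3 u4; lia.
have q0le : P p ^+ l 0 <= 3 * w ^+ 3.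
  have g2 := nat_ler R (leq_trans (pow2_le p1 l01) q1le); rewrite !(natrM, natrX) exprD in g2.
  have : (P p ^+ a * P p ^+ d) ^+ 3 <= w ^+ 3 by rewrite lerXn2r ?nnegrE ?mulr_ge0 ?exprn_ge0 ?(ltW w0) ?(ltW P0).
  by move: g2; clear; lra.
have w3 : 0 < w ^+ 3 by rewrite exprn_gt0.
have Tb : phi ^+ v <= 16 * (Zc%:R) ^+ 3 * (33 + v)%:R ^+ 3 * P p ^+ 4.
  apply: le_trans v1' _; apply: le_trans q0le _.
  by apply: le_trans (order_bound v P2); rewrite -/w; move: w3; clear; lra.
split=> hp.
  rewrite !exprD; have q2 : P p ^+ l 0 * (P p ^+ a * P p ^+ d) <= 12 * w ^+ 4.
    have : P p ^+ l 0 * (P p ^+ a * P p ^+ d) <= (3 * w ^+ 3) * w.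
      by rewrite ler_pM ?mulr_ge0 ?exprn_ge0 ?(ltW P0).
    by move: (mulr_gt0 w3 w0); rewrite [w ^+ 4]exprSr; clear; lra.
  apply: le_trans q2 _; apply: (small_final P2 hp Tb).
have lg := T_bound_large hp Tb.
have w4 : 4 * w < P p ^+ 4.
  have -> : 4 * w = 4 * Zc%:R * (33 + v)%:R * P p by rewrite /w; ring.
  by rewrite [P p ^+ 4]exprSr ltr_pM2r.
have p1R : 1 < P p by move: P2; clear; lra.
have ble : (a + d < 4)%N.
  by rewrite -(ltr_eXn2l p1R) exprD; apply: le_lt_trans Q0 _; move: w4 w0; clear; lra.
rewrite addKn; split; first by rewrite -ltnS.
rewrite -ltnS -(ltn_exp2l _ _ p1); apply: leq_ltn_trans q1le _.
rewrite -expnM [((a + d) * 3)%N]mulnC expnS ltn_pmul2r ?expn_gt0 ?p0 //.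
by apply: leq_trans hp; apply: (@leq_trans (7 * 1)%N) => //; rewrite leq_mul.
Qed.
End Constraints.

(** * Large primes *)

(* In units of 10^-6: twice the relative error made when p^l_0 / p^l_1 and c / p^l_2 are neglected,
   for p >= 10^4, l = l_2 and d = l_2 - l_1; when l >= d + 5 one has l_1 - l_0 >= 2. *)
Definition tab_err (l d : nat) : nat :=
  ((if (l < d + 5)%N then 300 * l else l) + (if d == 1%N then 402 * (l - 1) else l))%N.

Section LargePrime.
Variable R : rcfType.
Local Notation phi := (phi R).
Local Notation psi := (psi R).
Local Notation s5 := (s5 R).

Lemma phi_cube : phi ^+ 3 = 1 + 2 * phi.
Proof. by rewrite exprS phi_sqr mulrDr mulr1 -expr2 phi_sqr; ring. Qed.

(** For d = 1, 2, 3 the number sqrt 5^d lies between phi and phi^2, phi^3 and phi^4, phi^5 and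
    phi^6. The closest pair, 5 sqrt 5 and phi^5, differs by less than one percent, whence the
    tolerance for r. *)
Lemma s5_pow_gap (x y d : nat) (r : R) : (0 < d)%N -> (d <= 3)%N ->
  996 / 1000 <= r <= 1004 / 1000 -> phi ^+ x = phi ^+ y * (s5 ^+ d * r) -> False.
Proof.
move=> d0 d3 hr h.
have sb := s5_bounds R; have s2 := s5_sqr R; have pb := phi_bounds R.
have [p2 p3] := (phi_sqr R, phi_cube).
have p4 : phi ^+ 4 = 2 + 3 * phi by rewrite exprS p3 mulrDr mulrCA -expr2 p2; ring.
have p5 : phi ^+ 5 = 3 + 5 * phi by rewrite exprS p4 mulrDr mulrCA -expr2 p2; ring.
have p6 : phi ^+ 6 = 5 + 8 * phi by rewrite exprS p5 mulrDr mulrCA -expr2 p2; ring.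
have s3 : s5 ^+ 3 = 5 * s5 by rewrite exprSr s2.
have low : 2 < s5 ^+ d * r.
  case: d d0 d3 {h} => [//|[|[|[|//]]]] _ _; rewrite ?expr1 ?s2 ?s3.
  - have e : 0 <= (s5 - 2236 / 1000) * r by rewrite mulr_ge0 //; move: sb hr; clear; lra.
    by move: e hr; clear; lra.
  - by move: hr; clear; lra.
  have e : 0 <= (s5 - 2236 / 1000) * r by rewrite mulr_ge0 //; move: sb hr; clear; lra.
  by move: e hr; clear; lra.
have [xy|yx] := leqP x y.
  move: h; rewrite -(subnKC xy) exprD -{1}[phi ^+ x]mulr1 -mulrA => /(mulfI (lt0r_neq0 (phiX_gt0 R x))).
  have p1 : 1 <= phi ^+ (y - x) by rewrite exprn_ege1 // ltW // phi_gt1.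
  move: (phi ^+ (y - x)) p1 low; move: (s5 ^+ d * r) => u v v1 u2 uv.
  have : 0 <= (v - 1) * u by rewrite mulr_ge0 //; move: v1 u2; clear; lra.
  by move: uv u2; clear; lra.
move: h; rewrite -(subnKC (ltnW yx)) exprD => /(mulfI (lt0r_neq0 (phiX_gt0 R y))).
move: (x - y)%N => n h {low}.
have small m : phi ^+ m < s5 ^+ d * r -> (m < n)%N by rewrite -h phiX_lt.
have big m : s5 ^+ d * r < phi ^+ m -> (n < m)%N by rewrite -h phiX_lt.
case: d d0 d3 h small big => [//|[|[|[|//]]]] _ _; rewrite ?expr1 ?s2 ?s3 => h small big.
- have e1 : 0 <= (s5 - 2236 / 1000) * r by rewrite mulr_ge0 //; move: sb hr; clear; lra.
  have e2 : 0 <= (2237 / 1000 - s5) * r by rewrite mulr_ge0 //; move: sb hr; clear; lra.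
  have h1 : (1 < n)%N by apply: small; rewrite expr1; move: e1 pb hr; clear; lra.
  have h2 : (n < 2)%N by apply: big; rewrite p2; move: e2 pb hr; clear; lra.
  by move: h1 h2; clear; lia.
- have h1 : (3 < n)%N by apply: small; rewrite p3; move: pb hr; clear; lra.
  have h2 : (n < 4)%N by apply: big; rewrite p4; move: pb hr; clear; lra.
  by move: h1 h2; clear; lia.
have e1 : 0 <= (s5 - 2236 / 1000) * r by rewrite mulr_ge0 //; move: sb hr; clear; lra.
have e2 : 0 <= (2237 / 1000 - s5) * r by rewrite mulr_ge0 //; move: sb hr; clear; lra.
have h1 : (5 < n)%N by apply: small; rewrite p5; move: e1 pb hr; clear; lra.
have h2 : (n < 6)%N by apply: big; rewrite p6; move: e2 pb hr; clear; lra.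
by move: h1 h2; clear; lia.
Qed.

(** C is negligible against both powers, so phi^k is sqrt 5 p^l (1 - e) with e of order 1/p.
    Comparing the power l_1 + d of the first with the power l_1 of the second removes p and leaves
    sqrt 5^d r; exponents of at most 12 keep r within the tolerance of [s5_pow_gap]. *)
Lemma large_neg (p C k1 k2 l1 d : nat) : (10 * 1000 <= p)%N -> (2 <= k1)%N -> (2 <= k2)%N ->
  (0 < C)%N -> (p * C <= p ^ l1)%N -> (0 < d)%N -> (d <= 3)%N -> (l1 + d <= 12)%N ->
  (fib k1 + C = p ^ l1)%N -> (fib k2 + C = p ^ (l1 + d))%N -> False.
Proof.
move=> hp k12 k22 C0 pC d0 d3 l12 F1 F2.
have pR := nat_ler R hp; rewrite natrM in pR.
have sb := s5_bounds R; have sp : 0 < s5 by move: sb; clear; lra.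
have CR := nat_ler R C0.
have p0 : 0 < p%:R :> R by move: pR; clear; lra.
have q10 : 0 < p%:R ^+ l1 :> R by rewrite exprn_gt0.
have q20 : 0 < p%:R ^+ (l1 + d) :> R by rewrite exprn_gt0.
have C1 : p%:R * C%:R <= p%:R ^+ l1 :> R by have := nat_ler R pC; rewrite natrM natrX.
have C2 : p%:R * C%:R <= p%:R ^+ (l1 + d) :> R.
  by apply: le_trans C1 _; rewrite ler_weXn2l ?leq_addr //; move: pR; clear; lra.
have main k q : (2 <= k)%N -> 0 < q -> p%:R * C%:R <= q -> (fib k)%:R = q - C%:R ->
    exists2 e : R, 0 <= e <= 12 / (100 * 1000) & phi ^+ k = s5 * q * (1 - e).
  move=> hk q0 Cq Fk; exists ((s5 * C%:R - psi ^+ k) / (s5 * q)); last first.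
    by rewrite binet Fk; field; rewrite !gt_eqF.
  have := @psiX_le2 R _ hk; rewrite ler_norml => /andP[ps1 ps2].
  have e1 : 0 <= (s5 - 2236 / 1000) * (C%:R - 1) by rewrite mulr_ge0 //; move: sb CR; clear; lra.
  have e2 : 0 <= (p%:R - 10 * 1000) * C%:R :> R by rewrite mulr_ge0 //; move: pR CR; clear; lra.
  have e3 : 0 <= (s5 - 2236 / 1000) * C%:R by rewrite mulr_ge0 //; move: sb CR; clear; lra.
  have e4 : 0 <= s5 * (q - p%:R * C%:R) by rewrite mulr_ge0 ?(ltW sp) // subr_ge0.
  have e5 : 0 <= s5 * ((p%:R - 10 * 1000) * C%:R) by rewrite mulr_ge0 ?(ltW sp).
  rewrite divr_ge0 ?mulr_ge0 ?(ltW sp) ?(ltW q0) //=; last by move: e1 ps2 sb CR; clear; lra.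
  rewrite ler_pdivrMr ?mulr_gt0 //.
  by move: e3 e4 e5 ps1 sb CR; clear; lra.
have [|e1 he1 P1] := main k1 _ k12 q10 C1; first by rewrite -natrX -F1 natrD addrK.
have [|e2 he2 P2] := main k2 _ k22 q20 C2; first by rewrite -natrX -F2 natrD addrK.
have eqn : phi ^+ (k1 * (l1 + d)) * (1 - e2) ^+ l1 = phi ^+ (k2 * l1) * (s5 ^+ d * (1 - e1) ^+ (l1 + d)).
  rewrite !exprM P1 P2 !exprMn -!exprM [(l1 * _)%N]mulnC exprD.
  by rewrite mulrACA -!mulrA; ring.
have b1 := @bernoulli R (- e1) (l1 + d); have b2 := @bernoulli R (- e2) l1.
have {b1}b1 : 1 + (l1 + d)%:R * - e1 <= (1 - e1) ^+ (l1 + d) by apply: b1; move: he1; clear; lra.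
have {b2}b2 : 1 + l1%:R * - e2 <= (1 - e2) ^+ l1 by apply: b2; move: he2; clear; lra.
have u1 : (1 - e1) ^+ (l1 + d) <= 1 by rewrite exprn_ile1 //; move: he1; clear; lra.
have u2 : (1 - e2) ^+ l1 <= 1 by rewrite exprn_ile1 //; move: he2; clear; lra.
have l1R : (l1 + d)%:R <= 12%:R :> R by rewrite ler_nat.
have l2R : l1%:R <= 12%:R :> R by rewrite ler_nat (leq_trans _ l12) // leq_addr.
have f1 : 0 <= (12%:R - (l1 + d)%:R) * e1 by rewrite mulr_ge0 ?subr_ge0 //; move: he1; clear; lra.
have f2 : 0 <= (12%:R - l1%:R) * e2 by rewrite mulr_ge0 ?subr_ge0 //; move: he2; clear; lra.
have v0 : 0 < (1 - e2) ^+ l1 by move: b2 f2 he2; clear; lra.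
apply: (@s5_pow_gap (k1 * (l1 + d)) (k2 * l1) d ((1 - e1) ^+ (l1 + d) / (1 - e2) ^+ l1) d0 d3).
  rewrite ler_pdivlMr // ler_pdivrMr //.
  by move: b1 b2 u1 u2 f1 f2 he1 he2; clear; lra.
by rewrite mulrA mulrA -[X in _ = X / _]mulrA -eqn mulfK ?gt_eqF.
Qed.
End LargePrime.


(* Sealed, so that unification never unfolds a large binary numeral into unary. *)
Fact nR_sig (R : pzSemiRingType) : {f : N -> R | forall x, f x = (N.to_nat x)%:R}.
Proof. by exists (fun x => (N.to_nat x)%:R). Qed.
Definition nR (R : pzSemiRingType) (x : N) : R := sval (nR_sig R) x.
Lemma nRE (R : pzSemiRingType) (x : N) : nR R x = (N.to_nat x)%:R.
Proof. exact: (svalP (nR_sig R)). Qed.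

(** * Fixed-point computation with (1 - phi^-g)^l *)

Section Table.
(** 10^7, the scale of all fixed-point numbers below; [num_lo] is the floor of 10^7 phi. Large
    numerals are composed of small ones because proofs about them pass through [N.to_nat]. *)
Definition den : N := N.mul (N.mul 100 100) 1000.
Definition mega : N := N.mul 1000 1000.
Definition num_lo : N := N.add (N.mul (N.add (N.mul 161 100) 80) 1000) 339.
Definition num_hi : N := N.succ num_lo.

Definition lucas_step (w : N * N) : N * N := (N.add w.1 w.2, N.add w.1 (N.add w.2 w.2)).
Definition fib_step (w : N * N) : N * N := (w.2, N.add w.1 w.2).
Definition phi_lo (w : N * N) : N := N.add (N.mul w.1 den) (N.mul w.2 num_lo).
Definition phi_hi (w : N * N) : N := N.add (N.mul w.1 den) (N.mul w.2 num_hi).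

Definition cut_lo (x y : N) : N := N.div (N.mul x y) den.
Definition cut_hi (x y : N) : N := N.succ (N.div (N.mul x y) den).

(* [w] holds the coordinates of [phi^(2m)], and [x / den] brackets [(1 - phi^-g)^(2l)]. *)
Fixpoint tab_scan (n : nat) (xlo xhi d5 e : N) (w : N * N) : bool :=
  if n is n'.+1 then
    if N.ltb (N.mul mega (N.mul xhi (phi_hi w))) (N.mul e d5)
    then tab_scan n' xlo xhi d5 e (lucas_step w)
    else N.ltb d5 (N.mul xlo (phi_lo w))
  else false.

(** The first two tests certify, after multiplication by phi^g, that glo and glo + 1 bracket 10^7 (1
    - phi^-g); the third excludes that the subtraction in e was truncated. The scan then shows that
    (1 - phi^-g)^(2l) phi^(2m) never falls between (e / 10^6) 5^d and 5^d. *)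
Definition tab_case (glo : N) (l d g : nat) : bool :=
  let w := iter g fib_step (1, 0)%num in
  let ghi := N.succ glo in
  let e := N.sub mega (N.of_nat (tab_err l d)) in
  let d5 := N.mul (N.mul den den) (iter d (N.mul 5) 1%num) in
  [&& N.leb (N.add (N.mul den den) (N.mul (phi_lo w) glo)) (N.mul (phi_lo w) den),
      N.leb (N.mul (phi_hi w) den) (N.add (N.mul den den) (N.mul (phi_hi w) ghi)),
      N.leb (N.add e (N.of_nat (tab_err l d))) mega &
      tab_scan 15 (iter (2 * l) (cut_lo glo) den) (iter (2 * l) (cut_hi ghi) den) d5 e (1, 0)%num].

(** The floors of 10^7 (1 - phi^-g) for g = 3, ..., 16; they need not be trusted, since [tab_case]
    checks them. *)
Definition tab_hints : seq N := [:: 7639320; 8541019; 9098300; 9442719; 9655581; 9787137; 9868443; 9918693; 9949750; 9968943; 9980806; 9988137; 9992668; 9995468]%num.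

Definition tab_check : bool :=
  all (fun d => all (fun l => all (fun gh => tab_case gh.1 l d gh.2)
    (zip tab_hints (iota 3 14))) (iota d.+1 (d + 6))) [:: 1; 2; 3]%N.

Lemma tab_checkP : tab_check. Proof. by vm_compute. Qed.
End Table.

Section TableSound.
Variable R : rcfType.
Local Notation phi := (phi R).
Local Notation nR := (nR R).

Lemma nRD x y : nR (N.add x y) = nR x + nR y.
Proof. by rewrite !nRE N2Nat.inj_add plusE natrD. Qed.
Lemma nRM x y : nR (N.mul x y) = nR x * nR y.
Proof. by rewrite !nRE N2Nat.inj_mul multE natrM. Qed.
Lemma nRS x : nR (N.succ x) = nR x + 1.
Proof. by rewrite -N.add_1_r nRD [nR 1]nRE. Qed.
Lemma nR_ge0 x : 0 <= nR x. Proof. by rewrite nRE ler0n. Qed.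
Lemma nR_lt x y : N.lt x y -> nR x < nR y.
Proof. by move=> h; rewrite !nRE ltr_nat; apply/ssrnat.ltP; lia. Qed.
Lemma nR_le x y : N.le x y -> nR x <= nR y.
Proof. by move=> h; rewrite !nRE ler_nat; apply/ssrnat.leP; lia. Qed.
Lemma nR_ltb x y : N.ltb x y -> nR x < nR y.
Proof. by move=> /N.ltb_lt /nR_lt. Qed.
Lemma nR_leb x y : N.leb x y -> nR x <= nR y.
Proof. by move=> /N.leb_le /nR_le. Qed.
Lemma nR_of_nat n : nR (N.of_nat n) = n%:R.
Proof. by rewrite nRE Nat2N.id. Qed.

Lemma nR_mega : nR mega = 10 ^+ 6.
Proof.
rewrite nRM; have -> : nR 1000 = 1000 by rewrite nRE.
by ring.
Qed.

Lemma den_gt0 : 0 < nR den.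
Proof. by rewrite nRE ltr0n. Qed.

Lemma phi_num : nR num_lo <= phi * nR den <= nR num_hi.
Proof.
rewrite /num_hi nRS /num_lo /den !(nRM, nRD).
have -> : nR 161 = 161 by rewrite nRE. have -> : nR 100 = 100 by rewrite nRE. have -> : nR 80 = 80 by rewrite nRE.
have -> : nR 1000 = 1000 by rewrite nRE. have -> : nR 339 = 339 by rewrite nRE.
have h := phi_sqr R; have pb := phi_bounds R; rewrite expr2 in h.
set r := (161 * 100 + 80) * 1000 + 339; set q : R := 100 * 100 * 1000.
have q0 : 0 < q by rewrite /q !mulr_gt0.
(* phi q and q - phi q are the roots of X^2 - q X - q^2, so the sign of phi q - x can be read off
   from rational numbers. *)
have e x : (phi * q - x) * (phi * q + x - q) = q ^+ 2 - x ^+ 2 + x * q.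
  have -> : (phi * q - x) * (phi * q + x - q) = (phi * phi) * q ^+ 2 - phi * q ^+ 2 - x ^+ 2 + x * q by ring.
  by rewrite h; ring.
have q1 : q < phi * q by rewrite -[X in X < _]mul1r ltr_pM2r // phi_gt1.
apply/andP; split.
  rewrite -subr_ge0 -(pmulr_lge0 _ (_ : 0 < phi * q + r - q)); last by move: q1; rewrite /r /q; clear; lra.
  by rewrite e /r /q expr2; clear; lra.
rewrite -subr_ge0 -(pmulr_lge0 _ (_ : 0 < phi * q + (r + 1) - q)); last by move: q1; rewrite /r /q; clear; lra.
have -> : (r + 1 - phi * q) * (phi * q + (r + 1) - q) = - ((phi * q - (r + 1)) * (phi * q + (r + 1) - q)) by ring.
by rewrite e /r /q expr2; clear; lra.
Qed.

Opaque den num_lo num_hi.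

Definition phi_coords n (w : N * N) := phi ^+ n = nR w.1 + nR w.2 * phi.

Lemma fib_stepP n w : phi_coords n w -> phi_coords n.+1 (fib_step w).
Proof.
rewrite /phi_coords /fib_step /= nRD exprS => ->.
have h := phi_sqr R; rewrite expr2 in h.
have -> : phi * (nR w.1 + nR w.2 * phi) = nR w.1 * phi + nR w.2 * (phi * phi) by ring.
by rewrite h; ring.
Qed.

Lemma lucas_stepP n w : phi_coords n w -> phi_coords n.+2 (lucas_step w).
Proof.
move=> /fib_stepP /fib_stepP; rewrite /phi_coords /= !nRD => ->; ring.
Qed.

Lemma phi_loP n w : phi_coords n w -> nR (phi_lo w) <= nR den * phi ^+ n.
Proof.
move=> ->; rewrite /phi_lo nRD (nRM w.1) (nRM w.2); have /andP[h _] := phi_num.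
have := ler_wpM2l (nR_ge0 w.2) h; have -> : nR w.2 * (phi * nR den) = nR den * (nR w.2 * phi) by ring.
by clear; lra.
Qed.

Lemma phi_hiP n w : phi_coords n w -> nR den * phi ^+ n <= nR (phi_hi w).
Proof.
move=> ->; rewrite /phi_hi nRD (nRM w.1) (nRM w.2); have /andP[_ h] := phi_num.
have := ler_wpM2l (nR_ge0 w.2) h; have -> : nR w.2 * (phi * nR den) = nR den * (nR w.2 * phi) by ring.
by clear; lra.
Qed.

Lemma cut_loP x y (X Y : R) : nR x <= nR den * X -> nR y <= nR den * Y -> nR (cut_lo x y) <= nR den * (X * Y).
Proof.
move=> hx hy; have d0 := den_gt0; rewrite -(ler_pM2l d0) -nRM.
have /nR_le/le_trans -> // : N.le (N.mul den (cut_lo x y)) (N.mul x y) by exact: N.Div0.mul_div_le.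
by rewrite (nRM x y) (_ : nR den * (nR den * (X * Y)) = (nR den * X) * (nR den * Y)) ?ler_pM ?nR_ge0 //; ring.
Qed.

Lemma cut_hiP x y (X Y : R) : 0 <= X -> 0 <= Y -> nR den * X <= nR x -> nR den * Y <= nR y ->
  nR den * (X * Y) <= nR (cut_hi x y).
Proof.
move=> X0 Y0 hx hy; have d0 := den_gt0; rewrite -(ler_pM2l d0) -nRM.
have /nR_lt/ltW : N.lt (N.mul x y) (N.mul den (cut_hi x y)) by exact: N.mul_succ_div_gt.
apply: le_trans; rewrite (nRM x y) (_ : nR den * (nR den * (X * Y)) = (nR den * X) * (nR den * Y)); last by ring.
by rewrite ler_pM ?mulr_ge0 ?nR_ge0.
Qed.

(** As long as the first test succeeds, X phi^(2j) is still below the forbidden window; when it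
    fails, the second test puts X phi^(2j), and by monotonicity all later terms, above the
    window. *)
Lemma tab_scanP n xlo xhi d5 e w j (X D : R) : tab_scan n xlo xhi d5 e w ->
  phi_coords (2 * j) w -> nR xlo <= nR den * X <= nR xhi -> nR d5 = nR den * nR den * D ->
  forall m, (j <= m)%N -> nR e * D <= 10 ^+ 6 * (X * phi ^+ (2 * m)) -> X * phi ^+ (2 * m) <= D -> False.
Proof.
elim: n w j => //= n IH w j; have d0 := den_gt0; have dd0 := mulr_gt0 d0 d0.
case: ifP => [/nR_ltb h1 hs hw hX hd m|_ /nR_ltb h1 hw hX hd m] jm u1 u2.
  have [mj|mj] := eqVneq m j; last first.
    apply: (IH _ j.+1 hs _ hX hd m _ u1 u2); first by rewrite mulnS; exact: lucas_stepP.
    by rewrite ltn_neqAle eq_sym mj.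
  case/andP: hX => _ hX; have hp := phi_hiP hw.
  have : nR den * X * (nR den * phi ^+ (2 * j)) <= nR xhi * nR (phi_hi w).
    apply: (@le_trans _ _ (nR xhi * (nR den * phi ^+ (2 * j)))).
      by rewrite ler_wpM2r // mulr_ge0 ?(ltW d0) ?(ltW (phiX_gt0 _ _)).
    by rewrite ler_wpM2l ?nR_ge0.
  move=> h2; move: h1; rewrite (nRM mega) (nRM xhi) (nRM e) hd ltNge => /negP; apply.
  rewrite nR_mega (_ : _ * (nR den * nR den * D) = nR den * nR den * (nR e * D)); last by ring.
  rewrite mj in u1; have := ler_wpM2l (ltW dd0) u1 => /le_trans; apply.
  by move: h2; move: (nR den) (phi ^+ _) (nR xhi * _) => u v z; clear; lra.
case/andP: hX => hX _; have hp := phi_loP hw.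
have X0 : 0 <= X.
  by rewrite -(pmulr_rge0 _ d0); apply: le_trans hX; exact: nR_ge0.
have : nR d5 < nR den * X * (nR den * phi ^+ (2 * j)).
  apply: lt_le_trans h1 _; rewrite nRM ler_pM ?nR_ge0 //.
rewrite hd ltNge => /negP; apply.
have -> : nR den * X * (nR den * phi ^+ (2 * j)) = nR den * nR den * (X * phi ^+ (2 * j)) by ring.
rewrite ler_pM2l //; apply: le_trans u2; rewrite ler_wpM2l //.
by rewrite phiX_le leq_mul2l jm orbT.
Qed.

Lemma tab_caseP glo l d g m : tab_case glo l d g ->
  (10 ^+ 6 - (tab_err l d)%:R) * 5 ^+ d <= 10 ^+ 6 * ((1 - phi ^- g) ^+ (2 * l) * phi ^+ (2 * m)) ->
  (1 - phi ^- g) ^+ (2 * l) * phi ^+ (2 * m) <= 5 ^+ d -> False.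
Proof.
have d0 := den_gt0; have dd0 := mulr_gt0 d0 d0.
have P0 := phiX_gt0 R g.
have g0 : 0 <= 1 - phi ^- g.
  by rewrite subr_ge0 invf_le1 // exprn_ege1 // ltW // phi_gt1.
have coord0 : phi_coords 0 (1, 0)%num by rewrite /phi_coords expr0 /= !nRE mul0r addr0.
have cw : phi_coords g (iter g fib_step (1, 0)%num).
  by elim: (g) => // n IH; rewrite iterS; exact: fib_stepP.
rewrite /tab_case => /and4P[/nR_leb h1 /nR_leb h2 /nR_leb h3 hs].
rewrite nRD (nRM den den) (nRM (phi_lo _) glo) (nRM (phi_lo _) den) in h1.
rewrite nRD (nRM den den) (nRM (phi_hi _) (N.succ glo)) (nRM (phi_hi _) den) in h2.
rewrite nRD nR_of_nat in h3.
have lo := phi_loP cw; have hi := phi_hiP cw.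
have pv : phi ^- g * phi ^+ g = 1 by rewrite mulVf ?gt_eqF.
have glo1 : nR glo <= nR den * (1 - phi ^- g).
  have n0 : 0 <= nR den - nR glo.
    rewrite leNgt; apply/negP => hlt; have := ler_wpM2l (nR_ge0 (phi_lo (iter g fib_step (1, 0)%num))) (ltW hlt).
    by move: h1 dd0; clear; lra.
  rewrite -(ler_pM2r P0); have q := ler_wpM2r n0 lo.
  have -> : nR den * (1 - phi ^- g) * phi ^+ g = nR den * (phi ^+ g - phi ^- g * phi ^+ g) by ring.
  rewrite pv -(ler_pM2l d0); move: h1 q; move: (phi ^+ g) (nR den) (nR glo) (nR (phi_lo _)) => u v z t.
  by clear; lra.
have ghi1 : nR den * (1 - phi ^- g) <= nR (N.succ glo).
  have [n0|n0] := lerP 0 (nR den - nR (N.succ glo)); last first.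
    apply: (@le_trans _ _ (nR den * 1)); last by move: n0; clear; lra.
    by rewrite ler_pM2l // lerBlDr lerDl invr_ge0 ltW.
  rewrite -(ler_pM2r P0); have q := ler_wpM2r n0 hi.
  have -> : nR den * (1 - phi ^- g) * phi ^+ g = nR den * (phi ^+ g - phi ^- g * phi ^+ g) by ring.
  rewrite pv -(ler_pM2l d0); move: h2 q; move: (phi ^+ g) (nR den) (nR (N.succ glo)) (nR (phi_hi _)) => u v z t.
  by clear; lra.
have it n : nR (iter n (cut_lo glo) den) <= nR den * (1 - phi ^- g) ^+ n <= nR (iter n (cut_hi (N.succ glo)) den).
  elim: n => [|n /andP[IH1 IH2]]; first by rewrite expr0 mulr1 lexx.
  by rewrite !iterS exprS cut_loP // cut_hiP ?exprn_ge0.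
have d5E : nR (N.mul (N.mul den den) (iter d (N.mul 5) 1%num)) = nR den * nR den * 5 ^+ d.
  rewrite nRM (nRM den den); congr (_ * _ * _); elim: (d) => [|n IH]; first by rewrite nRE expr0.
  by rewrite iterS nRM IH exprS [nR 5]nRE.
move=> u1 u2; apply: (tab_scanP hs (coord0 : phi_coords (2 * 0) _) (it _) d5E (leq0n m) _ u2).
apply: le_trans u1; rewrite ler_wpM2r ?exprn_ge0 //.
by move: h3; rewrite nR_mega; clear; lra.
Qed.
End TableSound.

Lemma tab_check_ex d l g : (0 < d)%N -> (d <= 3)%N -> (d < l)%N -> (l <= 2 * d + 6)%N ->
  (3 <= g)%N -> (g <= 16)%N -> exists glo, tab_case glo l d g.
Proof.
move=> d0 d3 dl l6 g3 g16; have /allP/(_ d) := tab_checkP.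
have -> : d \in [:: 1; 2; 3]%N by rewrite !inE; lia.
move=> /(_ isT)/allP/(_ l); rewrite mem_iota (_ : (d < l < d.+1 + (d + 6))%N); last by lia.
move=> /(_ isT)/allP/(_ (nth 0%num tab_hints (g - 3), g)) h; exists (nth 0%num tab_hints (g - 3)).
apply: h; apply/(nthP (0%num, 0%N)); exists (g - 3)%N; first by rewrite size_zip /=; lia.
rewrite nth_zip ?size_iota // nth_iota; last by lia.
by congr (_, _); lia.
Qed.

Section LargePos.
Variable R : rcfType.
Local Notation phi := (phi R).
Local Notation psi := (psi R).
Local Notation s5 := (s5 R).

Lemma phi17 : 3500 <= phi ^+ 17.
Proof.
rewrite phi_fib (_ : fib 16 = 987)%N // (_ : fib 17 = 1597)%N //.
by have := phi_bounds R; lra.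
Qed.

Lemma G_bounds g : (0 < g)%N -> 0 < 1 - phi ^- g <= 1.
Proof.
move=> g0; rewrite subr_gt0 invf_lt1 ?phiX_gt0 // -[X in X < _](expr0 phi) phiX_lt g0 /=.
by rewrite lerBlDr lerDl invr_ge0 (ltW (phiX_gt0 R g)).
Qed.

(* For g <= 2 the number 1 - phi^-g is a power of phi, for g >= 17 it is close enough to 1;
   the remaining g are compared numerically. *)
Lemma G_table (l d g x y : nat) (r : R) : (0 < d)%N -> (d <= 3)%N -> (d < l)%N -> (l <= 2 * d + 6)%N ->
  (0 < g)%N -> r <= 1 -> 10 ^+ 6 * (1 - r) * 2 <= (tab_err l d)%:R ->
  phi ^+ x * (1 - phi ^- g) ^+ l = phi ^+ y * (s5 ^+ d * r) -> False.
Proof.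
move=> d0 d3 dl l6 g0 r1 hr h.
have e1 : (tab_err l d <= 40 * 100)%N.
  by rewrite /tab_err; case: ifP => u; case: eqP => v; lia.
have er : ((tab_err l d)%:R : R) <= 40 * 100 by rewrite -natrM ler_nat.
have r0 : 997 / 1000 <= r by move: hr er; clear; lra.
have /andP[G0 G1] := G_bounds g0.
have pb := phi_bounds R; have p2 := phi_sqr R.
have phi0 := phi_gt0 R.
have [gle|ggt] := leqP g 2.
  have [j hj] : exists j, phi ^+ j * (1 - phi ^- g) = 1.
    case: g g0 gle {h G0 G1} => [//|[|[|//]]] _ _; [exists 2|exists 1].
      have iv : phi * phi^-1 = 1 by rewrite mulfV ?gt_eqF.
      have -> : phi ^+ 2 * (1 - phi ^- 1) = phi ^+ 2 - phi * (phi * phi^-1) by ring.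
      by rewrite iv p2; ring.
    have iv : phi ^+ 2 * phi ^- 2 = 1 by rewrite mulfV // gt_eqF ?exprn_gt0.
    apply: (mulfI (lt0r_neq0 phi0)).
    have -> : phi * (phi ^+ 1 * (1 - phi ^- 2)) = phi ^+ 2 - phi ^+ 2 * phi ^- 2.
      by move: (phi ^- 2) => z; ring.
    by rewrite iv p2; ring.
  have hjl : phi ^+ (j * l) * (1 - phi ^- g) ^+ l = 1 by rewrite exprM -exprMn hj expr1n.
  apply: (@s5_pow_gap R x (y + j * l) d r d0 d3); first by move: r0 r1; clear; lra.
  by rewrite exprD mulrAC -h -mulrA [_ ^+ l * _]mulrC hjl mulr1.
have [gle|g17] := leqP g 16; last first.
  have Gl : 9965 / (100 * 100) <= (1 - phi ^- g) ^+ l.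
    have b1 : 1 + l%:R * - phi ^- g <= (1 - phi ^- g) ^+ l by apply: bernoulli; move: G0; clear; lra.
    have l12 : (l%:R : R) <= 12%:R by rewrite ler_nat; move: l6 d3; clear; lia.
    have i17 : phi ^- g <= 1 / 3500.
      rewrite div1r lef_pV2 ?posrE ?phiX_gt0 //; first by apply: le_trans phi17 _; rewrite phiX_le.
    have e2 : 0 <= (12%:R - l%:R) * phi ^- g by rewrite mulr_ge0 ?subr_ge0 // invr_ge0 (ltW (phiX_gt0 R g)).
    by move: b1 e2 i17; clear; lra.
  have Gl1 : (1 - phi ^- g) ^+ l <= 1 by rewrite exprn_ile1 // ltW.
  have Gp : 0 < (1 - phi ^- g) ^+ l by rewrite exprn_gt0.
  apply: (@s5_pow_gap R x y d (r / (1 - phi ^- g) ^+ l) d0 d3).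
    rewrite ler_pdivlMr // ler_pdivrMr //; move: Gl Gl1 r0 r1; clear; lra.
  by rewrite mulrA mulrA -[X in _ = X / _]mulrA -h mulfK ?gt_eqF.
have [glo hg] := tab_check_ex d0 d3 dl l6 ggt gle.
have [xy|yx] := leqP x y.
  move: h; rewrite -(subnKC xy) exprD -mulrA => /(mulfI (lt0r_neq0 (phiX_gt0 R x))) h.
  have : (1 - phi ^- g) ^+ l <= 1 by rewrite exprn_ile1 // ltW.
  rewrite h leNgt => /negP; apply.
  have s0 := s5_bounds R.
  have f1 : 1 <= phi ^+ (y - x) by rewrite exprn_ege1 // ltW // phi_gt1.
  have f2 : 2 <= s5 ^+ d.
    rewrite -(prednK d0) exprS -[X in X <= _]mulr1 ler_pM //; first by move: s0; clear; lra.
    by rewrite exprn_ege1 //; move: s0; clear; lra.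
  have f3 : 0 <= (s5 ^+ d - 2) * r by rewrite mulr_ge0 ?subr_ge0 //; move: r0; clear; lra.
  have f4 : 1 < s5 ^+ d * r by move: f3 r0; clear; lra.
  by apply: (lt_le_trans f4); rewrite ler_peMl // (ltW (lt_trans ltr01 f4)).
move: h; rewrite -(subnKC (ltnW yx)) exprD -mulrA => /(mulfI (lt0r_neq0 (phiX_gt0 R y))).
move: (x - y)%N => m h.
(* Squaring turns sqrt 5^d into the integer 5^d and doubles the relative error, as reflected in
   [tab_err]. *)
have h2 : (1 - phi ^- g) ^+ (2 * l) * phi ^+ (2 * m) = 5 ^+ d * r ^+ 2.
  rewrite -s5_sqr -!exprM ![(2 * _)%N]mulnC !exprM -!exprMn mulrC h.
  by rewrite !exprMn -!exprM mulnC.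
have d5 : (0 : R) < 5 ^+ d by rewrite exprn_gt0.
apply: (@tab_caseP R glo l d g m hg); rewrite h2; last first.
  by rewrite ger_pMr // exprn_ile1 //; move: r0; clear; lra.
rewrite mulrCA [X in X <= _]mulrC ler_pM2l //.
by move: hr (sqr_ge0 (1 - r)); rewrite !expr2; clear; lra.
Qed.

(** C may be comparable with p^l_1, so it is removed from F_(k_1) by subtracting F_(k_0): phi^k_1 (1
    - phi^-g) is sqrt 5 p^l_1 (1 - e1) with e1 of order p^-a. Against p^l_2 it is small, and phi^k_2
    is sqrt 5 p^l_2 (1 + e3) with e3 at most of order p^-d. The powers l_2 and l_1 of these
    equations eliminate p. *)
Lemma large_pos (p C k0 k1 k2 l0 l1 l2 : nat) : (10 * 1000 <= p)%N ->
  (2 <= k0)%N -> (k0 < k1)%N -> (k1 < k2)%N -> (l0 < l1)%N -> (l1 < l2)%N ->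
  (0 < C)%N -> (C <= 2 * p ^ l1)%N ->
  (l0 <= 3)%N -> (l2 - l1 <= 3)%N -> (l2 - l0 <= 2 * (l2 - l1) + 3)%N ->
  (fib k0 = p ^ l0 + C)%N -> (fib k1 = p ^ l1 + C)%N -> (fib k2 = p ^ l2 + C)%N -> False.
Proof.
move=> hp k02 k01 k12 l01 l12 C0 Cle l03 d3 b3 F0 F1 F2.
have [a [a0 l1E]] : exists a, (0 < a)%N /\ l1 = (l0 + a)%N.
  by exists (l1 - l0)%N; rewrite subn_gt0 l01 subnKC // ltnW.
have [d [d0 l2E]] : exists d, (0 < d)%N /\ l2 = (l1 + d)%N.
  by exists (l2 - l1)%N; rewrite subn_gt0 l12 subnKC // ltnW.
have dE : (l2 - l1 = d)%N by rewrite l2E addKn.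
rewrite dE in d3 b3.
have [g [g0 k1E]] : exists g, (0 < g)%N /\ k1 = (k0 + g)%N.
  by exists (k1 - k0)%N; rewrite subn_gt0 k01 subnKC // ltnW.
have pR := nat_ler R hp; rewrite natrM in pR.
have sb := s5_bounds R; have sp : 0 < s5 by move: sb; clear; lra.
have CR := nat_ler R C0; have C1 := nat_ler R Cle; rewrite natrM natrX in C1.
have p0 : 0 < p%:R :> R by move: pR; clear; lra.
have p1 : 1 <= p%:R :> R by move: pR; clear; lra.
have FR k l : (fib k = p ^ l + C)%N -> (fib k)%:R = p%:R ^+ l + C%:R :> R by move=> ->; rewrite natrD natrX.
move: F0 F1 F2 => /FR F0 /FR F1 /FR F2.
have q0 : 1 <= p%:R ^+ l0 :> R by rewrite exprn_ege1.
have q1 : 0 < p%:R ^+ l1 :> R by rewrite exprn_gt0.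
have q2 : 0 < p%:R ^+ l2 :> R by rewrite exprn_gt0.
have pa : p%:R <= p%:R ^+ a :> R by rewrite -[X in X <= _]expr1 ler_weXn2l.
have pd : p%:R <= p%:R ^+ d :> R by rewrite -[X in X <= _]expr1 ler_weXn2l.
have q1E : p%:R ^+ l1 = p%:R ^+ l0 * p%:R ^+ a :> R by rewrite l1E exprD.
have q2E : p%:R ^+ l2 = p%:R ^+ l1 * p%:R ^+ d :> R by rewrite l2E exprD.
have q1p : p%:R <= p%:R ^+ l1 :> R.
  by rewrite q1E -[X in X <= _]mul1r ler_pM // ltW.
have := @psiX_le2 R _ k02; rewrite ler_norml => /andP[u1 u2].
have := @psiX_le2 R _ (leq_trans k02 (ltnW k01)); rewrite ler_norml => /andP[u3 u4].
have := @psiX_le2 R _ (leq_trans k02 (ltnW (ltn_trans k01 k12))); rewrite ler_norml => /andP[u5 u6].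
have e135 : 135 / 100 <= 201 / 100 :> R by clear; lra.
have sn := lt0r_neq0 sp; have qn0 := lt0r_neq0 (lt_le_trans ltr01 q0).
have qn1 := lt0r_neq0 q1; have qn2 := lt0r_neq0 q2.
pose e1 := (s5 * p%:R ^+ l0 + psi ^+ k0 - psi ^+ k1) / (s5 * p%:R ^+ l1).
pose e3 := (s5 * C%:R + psi ^+ k2) / (s5 * p%:R ^+ l2).
have P1 : phi ^+ k1 * (1 - phi ^- g) = s5 * p%:R ^+ l1 * (1 - e1).
  have -> : phi ^+ k1 * (1 - phi ^- g) = phi ^+ k1 - phi ^+ k0.
    by rewrite mulrBr mulr1 k1E exprD mulfK // gt_eqF ?phiX_gt0.
  rewrite (binet _ k1) (binet _ k0) F1 F0 /e1; move: sn qn1; clear => sn qn1.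
  by field; rewrite sn qn1.
have P2 : phi ^+ k2 = s5 * p%:R ^+ l2 * (1 + e3).
  rewrite (binet _ k2) F2 /e3; move: sn qn2; clear => sn qn2.
  by field; rewrite sn qn2.
have e1lo : 0 <= e1.
  rewrite /e1 divr_ge0 ?mulr_ge0 ?(ltW sp) ?(ltW q1) //.
  have f : 0 <= s5 * (p%:R ^+ l0 - 1) by rewrite mulr_ge0 ?(ltW sp) ?subr_ge0.
  by move: f u1 u4 sb; clear; lra.
have e1hi : e1 * p%:R ^+ a <= 135 / 100.
  rewrite /e1 q1E; move: (p%:R ^+ a) (lt_le_trans p0 pa) => A A0.
  rewrite (_ : _ * A = (s5 * p%:R ^+ l0 + psi ^+ k0 - psi ^+ k1) / (s5 * p%:R ^+ l0)); last first.
    by move: sn qn0 (lt0r_neq0 A0); clear => sn qn0 An; field; rewrite sn qn0 An.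
  rewrite ler_pdivrMr ?mulr_gt0 // ?(lt_le_trans ltr01) //.
  have f : 0 <= s5 * (p%:R ^+ l0 - 1) by rewrite mulr_ge0 ?(ltW sp) ?subr_ge0.
  by move: f u2 u3 sb; clear; lra.
have e3lo : 0 <= e3.
  rewrite /e3 divr_ge0 ?mulr_ge0 ?(ltW sp) ?(ltW q2) //.
  have f : 0 <= s5 * (C%:R - 1) by rewrite mulr_ge0 ?(ltW sp) ?subr_ge0.
  by move: f u5 sb; clear; lra.
have e3hi : e3 * p%:R ^+ d <= 201 / 100.
  rewrite /e3 q2E; move: (p%:R ^+ d) (lt_le_trans p0 pd) => D D0.
  rewrite (_ : _ * D = (s5 * C%:R + psi ^+ k2) / (s5 * p%:R ^+ l1)); last first.
    by move: sn qn1 (lt0r_neq0 D0); clear => sn qn1 Dn; field; rewrite sn qn1 Dn.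
  rewrite ler_pdivrMr ?mulr_gt0 //.
  have f : 0 <= s5 * (2 * p%:R ^+ l1 - C%:R) by rewrite mulr_ge0 ?(ltW sp) ?subr_ge0.
  have f2 : 0 <= (s5 - 2) * (p%:R ^+ l1 - p%:R) by rewrite mulr_ge0 ?subr_ge0 //; move: sb; clear; lra.
  have f3 : 0 <= (s5 - 2) * (p%:R - 10 * 1000) by rewrite mulr_ge0 ?subr_ge0 //; move: sb; clear; lra.
  by move: f f2 f3 u6 sb q1p pR; clear; lra.
clearbody e1 e3.
have small (x : R) n : 0 <= x -> (0 < n)%N -> x * p%:R ^+ n <= 201 / 100 -> x * (10 * 1000) <= 201 / 100.
  move=> x0 n0; apply: le_trans; rewrite ler_wpM2l //; apply: (le_trans pR).
  by rewrite -[X in X <= _]expr1 ler_weXn2l.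
have e1s : e1 <= 1 by have := small e1 a e1lo a0 (le_trans e1hi e135); clear; lra.
pose r := (1 - e1) ^+ l2 / (1 + e3) ^+ l1.
have v0 : 0 < (1 + e3) ^+ l1 by rewrite exprn_gt0 //; move: e3lo; clear; lra.
have r1 : r <= 1.
  rewrite ler_pdivrMr // mul1r; apply: (@le_trans _ _ 1).
    by rewrite exprn_ile1 //; move: e1lo e1s; clear; lra.
  by rewrite exprn_ege1 //; move: e3lo; clear; lra.
have eqn : phi ^+ (k1 * l2) * (1 - phi ^- g) ^+ l2 = phi ^+ (k2 * l1) * (s5 ^+ d * r).
  rewrite !exprM -exprMn P1 P2 /r !exprMn -!exprM [(l1 * l2)%N]mulnC.
  have -> : s5 ^+ l2 = s5 ^+ l1 * s5 ^+ d by rewrite l2E exprD.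
  by move: (lt0r_neq0 v0); clear => v0n; field.
apply: (G_table d0 d3 _ _ g0 r1 _ eqn).
- by rewrite l2E -[X in (X < _)%N]add0n ltn_add2r (leq_ltn_trans _ l01).
- by move: b3 l2E l1E l03; clear; lia.
have b1 : 1 + l2%:R * - e1 <= (1 - e1) ^+ l2 by apply: bernoulli; move: e1s; clear; lra.
have e3s : e3 <= 1 by have := small e3 d e3lo d0 e3hi; clear; lra.
have b2 : (1 + e3) ^+ l1 * (1 - l1%:R * e3) <= 1.
  by apply: bernoulli_inv; rewrite ger0_norm.
have rlo : 1 - r <= l2%:R * e1 + l1%:R * e3.
  have w0 : 0 <= (1 + e3) ^+ l1 - 1 by rewrite subr_ge0 exprn_ege1 //; move: e3lo; clear; lra.
  have w1 : 0 <= l2%:R * e1 by rewrite mulr_ge0 ?ler0n.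
  have w2 := mulr_ge0 w0 w1.
  have rE : r * (1 + e3) ^+ l1 = (1 - e1) ^+ l2 by rewrite /r mulfVK ?gt_eqF.
  by rewrite -(ler_pM2r v0) mulrBl rE; move: b1 b2 w1 w2; move: ((1 + e3) ^+ l1) => z; clear; lra.
apply: (@le_trans _ _ (10 ^+ 6 * (l2%:R * e1 + l1%:R * e3) * 2)).
  by rewrite ler_pM2r // ler_pM2l // exprn_gt0.
rewrite /tab_err natrD.
have -> : 10 ^+ 6 * (l2%:R * e1 + l1%:R * e3) * 2 = 10 ^+ 6 * (l2%:R * e1) * 2 + 10 ^+ 6 * (l1%:R * e3) * 2.
  by ring.
have e1n := small e1 a e1lo a0 (le_trans e1hi e135).
have e3n := small e3 d e3lo d0 e3hi.
have tiny (x : R) n : 0 <= x -> (1 < n)%N -> x * p%:R ^+ n <= 201 / 100 -> x * (10 ^+ 6 * 2) <= 1.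
  move=> x0 n0 hx.
  have hx2 : x * (10 * 1000) ^+ 2 <= 201 / 100.
    apply: le_trans hx; rewrite ler_wpM2l //; apply: (@le_trans _ _ (p%:R ^+ 2)).
      by rewrite lerXn2r ?nnegrE //; move: pR; clear; lra.
    by rewrite ler_weXn2l.
  by move: hx2 x0; rewrite !exprS !expr0; clear; lra.
apply: lerD.
  have step y : e1 * (10 ^+ 6 * 2) <= y -> 10 ^+ 6 * (l2%:R * e1) * 2 <= l2%:R * y.
    by move=> hy; have := ler_wpM2l (ler0n R l2) hy; clear; lra.
  case: ifP => hl.
    rewrite mulnC natrM; apply: step; rewrite (_ : 10 ^+ 6 = 100 * (10 * 1000)); last by ring.
    have : e1 * (10 * 1000) <= 135 / 100.
      by apply: le_trans e1hi; rewrite ler_wpM2l // (le_trans pR).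
    by clear; lra.
  rewrite -[X in _ <= X]mulr1; apply: step; apply: (tiny _ a) => //; last exact: le_trans e1hi e135.
  by move: hl l2E l1E l03; clear; lia.
have step y : e3 * (10 ^+ 6 * 2) <= y -> 10 ^+ 6 * (l1%:R * e3) * 2 <= l1%:R * y.
  by move=> hy; have := ler_wpM2l (ler0n R l1) hy; clear; lra.
case: eqP => hd.
  have -> : (l2 - 1 = l1)%N by rewrite l2E hd addnK.
  rewrite mulnC natrM; apply: step; rewrite (_ : 10 ^+ 6 = 100 * (10 * 1000)); last by ring.
  by move: e3n; clear; lra.
apply: (@le_trans _ _ (l1%:R * 1)); last by rewrite mulr1 ler_nat ltnW.
apply: step; apply: (tiny _ d) => //.
by move: hd d0; clear; lia.
Qed.
End LargePos.

(** * Small primes *)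

Fixpoint fib_up (n : nat) (x : N) (w : N * N) : N * N :=
  if n is n'.+1 then if N.leb w.2 x then fib_up n' x (fib_step w) else w else w.

(** Descends from a pair of consecutive Fibonacci numbers. Running out of fuel answers [true], which
    can only make the whole check stricter. *)
Fixpoint is_fib (n : nat) (x : N) (w : N * N) : bool :=
  if n is n'.+1 then
    if N.leb w.1 x then N.eqb w.1 x else is_fib n' x (N.sub w.2 w.1, w.1)
  else true.

(** Sufficient since all powers searched are at most 10^20 2^156 < phi^400. *)
Definition fuel : nat := 400.

(* Conditionals instead of [&&] and [||], which call-by-value evaluation does not short-circuit. *)
Fixpoint any (f : N -> bool) (s : seq N) : bool :=
  if s is x :: r then if f x then true else any f r else false.

(* The largest of three solutions determines c: if c > 0 then F_k is the least Fibonacci number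
   above p^l, if c < 0 the greatest one below p^l. *)
Fixpoint pos_hit (c : N) (w : N * N) (qs : seq N) : bool :=
  if qs is q :: r then
    if N.leb c (N.add q q) then
      if is_fib fuel (N.add q c) w then
        if any (fun q' => is_fib fuel (N.add q' c) w) r then true else pos_hit c w r
      else pos_hit c w r
    else false
  else false.

Fixpoint neg_hit (c : N) (w : N * N) (qs : seq N) : bool :=
  if qs is q :: r then
    if N.ltb c q then
      if is_fib fuel (N.sub q c) w then
        if any (fun q' => if N.ltb c q' then is_fib fuel (N.sub q' c) w else false) r then true
        else neg_hit c w r
      else neg_hit c w r
    else false
  else false.

(** c and -c' are the only candidates when x is the largest power of a triple; if x is itself a
    Fibonacci number, c' is taken from the preceding one. The flag [exc], set for p = 2, lets the
    genuine triples with c = 1 and c = -3 pass. *)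
Definition no_hit (exc : bool) (x : N) (qs : seq N) (w : N * N) : bool :=
  let c := N.sub w.2 x in
  let c' := N.sub x (if N.ltb w.1 x then w.1 else N.sub w.2 w.1) in
  (if pos_hit c w qs then exc && N.eqb c 1 else true) &&
  (if neg_hit c' w qs then exc && N.eqb c' 3 else true).

Fixpoint run (n : nat) (exc : bool) (p bound x : N) (qs : seq N) (w : N * N) : bool :=
  if n is n'.+1 then
    if N.ltb bound x then true else
    let w' := fib_up 60 x w in
    if [&& N.leb w'.1 x, N.ltb x w'.2 & no_hit exc x qs w'] then
      run n' exc p bound (N.mul p x) (x :: qs) w'
    else false
  else false.

Definition run_prime (p : N) : bool :=
  let p2 := N.mul p p in
  run fuel (N.eqb p 2) p (N.mul (N.mul p2 (N.mul p2 p)) (iter 156 (N.mul 2) 1%num)) 1%num [::] (1, 2)%num.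

Definition small_primes : seq N :=
  [:: 2; 3; 5; 7; 11; 13; 17; 19; 23; 29; 31; 37; 41; 43; 47; 53; 59; 61; 67; 71; 73; 79; 83; 89; 97]%num.

(** Trial division that saves time; soundness asks only that no prime be skipped. *)
Definition composite (n : N) : bool :=
  any (fun q => if N.ltb q n then N.eqb (N.modulo n q) 0 else false) small_primes.

Fixpoint run_from (n : nat) (p : N) : bool :=
  if n is n'.+1 then
    if (if composite p then true else run_prime p) then run_from n' (N.succ p) else false
  else true.

Lemma run_fromP : run_from (100 * 100 - 1)%N 2.
Proof. by vm_cast_no_check (erefl true). Qed.

(** * Soundness of the search *)

Lemma ofD m n : N.add (N.of_nat m) (N.of_nat n) = N.of_nat (m + n).
Proof. by rewrite -Nat2N.inj_add plusE. Qed.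
Lemma ofM m n : N.mul (N.of_nat m) (N.of_nat n) = N.of_nat (m * n).
Proof. by rewrite -Nat2N.inj_mul multE. Qed.
Lemma ofB m n : N.sub (N.of_nat m) (N.of_nat n) = N.of_nat (m - n).
Proof. by rewrite -Nat2N.inj_sub minusE. Qed.
Lemma of_le m n : N.leb (N.of_nat m) (N.of_nat n) = (m <= n)%N.
Proof. by apply/idP/idP => [/N.leb_le|h]; [lia|apply/N.leb_le; lia]. Qed.
Lemma of_lt m n : N.ltb (N.of_nat m) (N.of_nat n) = (m < n)%N.
Proof. by apply/idP/idP => [/N.ltb_lt|h]; [lia|apply/N.ltb_lt; lia]. Qed.
Lemma of_eq m n : N.eqb (N.of_nat m) (N.of_nat n) = (m == n).
Proof. by apply/idP/eqP => [/N.eqb_eq /Nat2N.inj //|->]; exact: N.eqb_refl. Qed.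

Lemma fib_ltE m n : (fib m < fib n)%N -> (m < n)%N.
Proof. by move=> h; rewrite ltnNge; apply: contraL h => /fib_leq; rewrite -leqNgt. Qed.

Definition fibs_at j (w : N * N) := w = (N.of_nat (fib j), N.of_nat (fib j.+1)).

Lemma fib_upP n x j w : fibs_at j w -> exists j', fibs_at j' (fib_up n x w).
Proof.
elim: n j w => [|n IH] j w hw; first by exists j.
rewrite /=; case: ifP => _; last by exists j.
apply: (IH j.+1); rewrite hw /fibs_at /fib_step /= ofD; congr (_, N.of_nat _).
exact: addnC.
Qed.

Lemma is_fibP n k j w : fibs_at j w -> (k <= j)%N -> is_fib n (N.of_nat (fib k)) w.
Proof.
elim: n j w => //= n IH j w hw kj; rewrite hw /= of_le of_eq.
case: leqP => h; first by rewrite eqn_leq h fib_leq.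
have kj' := fib_ltE h; case: j hw kj h kj' => // j hw _ h kj'.
by apply: (IH j); rewrite // /fibs_at ofB; congr (N.of_nat _, _); exact: addKn.
Qed.

#[local] Arguments is_fib : simpl never.
#[local] Arguments fib_up : simpl never.

Lemma anyE f s : any f s = has f s.
Proof. by elim: s => //= x s ->; case: (f x). Qed.

Fixpoint powers (p l : nat) : seq N := if l is l'.+1 then N.of_nat (p ^ l') :: powers p l' else [::].

Lemma mem_powers p l i : (i < l)%N -> N.of_nat (p ^ i) \in powers p l.
Proof.
elim: l => // l IH; rewrite ltnS leq_eqVlt inE => /orP[/eqP ->|/IH ->]; first by rewrite eqxx.
by rewrite orbT.
Qed.

Lemma pos_hitP p C j k0 k1 l0 l1 l w : (1 < p)%N -> fibs_at j w -> (k0 <= j)%N -> (k1 <= j)%N ->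
  (l0 < l1)%N -> (l1 < l)%N -> (C <= 2 * p ^ l1)%N ->
  (fib k0 = p ^ l0 + C)%N -> (fib k1 = p ^ l1 + C)%N -> pos_hit (N.of_nat C) w (powers p l).
Proof.
move=> p1 hw k0j k1j l01 + hC F0 F1; elim: l => // l IH; rewrite ltnS leq_eqVlt => h.
rewrite /= ofD of_le.
have -> : (C <= p ^ l + p ^ l)%N.
  rewrite addnn -mul2n (leq_trans hC) // leq_mul2l leq_exp2l //=.
  by case/orP: h => [/eqP ->|/ltnW].
case: ifP => f1; last first.
  case/orP: h => [/eqP h|/IH //]; move: f1; rewrite ofD -h -F1.
  by rewrite (is_fibP _ hw).
case: ifP => f2 //; case/orP: h => [/eqP h|/IH //]; move: f2; rewrite anyE => /negP/negP/hasPn.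
move=> /(_ (N.of_nat (p ^ l0))); rewrite -h mem_powers // => /(_ isT) /=.
by rewrite ofD -F0 (is_fibP _ hw).
Qed.

Lemma neg_hitP p C j k0 k1 l0 l1 l w : (1 < p)%N -> fibs_at j w -> (k0 <= j)%N -> (k1 <= j)%N ->
  (l0 < l1)%N -> (l1 < l)%N -> (C < p ^ l0)%N ->
  (fib k0 + C = p ^ l0)%N -> (fib k1 + C = p ^ l1)%N -> neg_hit (N.of_nat C) w (powers p l).
Proof.
move=> p1 hw k0j k1j l01 + hC F0 F1; elim: l => // l IH; rewrite ltnS leq_eqVlt => h.
have hl : (l0 <= l)%N by case/orP: h => [/eqP <-|/(ltn_trans l01)]; exact: ltnW.
rewrite /= of_lt; have -> : (C < p ^ l)%N by rewrite (leq_trans hC) // leq_exp2l.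
case: ifP => f1; last first.
  case/orP: h => [/eqP h|/IH //]; move: f1; rewrite ofB -h -F1 addnK.
  by rewrite (is_fibP _ hw).
case: ifP => f2 //; case/orP: h => [/eqP h|/IH //]; move: f2; rewrite anyE => /negP/negP/hasPn.
move=> /(_ (N.of_nat (p ^ l0))); rewrite -h mem_powers // => /(_ isT) /=.
by rewrite of_lt hC ofB -F0 addnK (is_fibP _ hw).
Qed.

Lemma runP n exc p B l w j : run n exc (N.of_nat p) (N.of_nat B) (N.of_nat (p ^ l)) (powers p l) w ->
  fibs_at j w -> forall m, (l <= m)%N -> (p ^ m <= B)%N -> (1 < p)%N ->
  exists i v, [/\ fibs_at i v, (fib i <= p ^ m < fib i.+1)%N &
                 no_hit exc (N.of_nat (p ^ m)) (powers p m) v].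
Proof.
elim: n l w j => [//|n IH] l w j; rewrite /= of_lt => hr hw m lm mB p1.
move: hr; rewrite ltnNge (leq_trans _ mB) /=; last by rewrite leq_exp2l.
have [i hi] := fib_upP 60 (N.of_nat (p ^ l)) hw.
case: ifP => // /and3P[h1 h2 h3]; rewrite ofM -expnS => hr.
have [lm'|ml|e] := ltngtP l m.
- exact: (IH l.+1 _ _ hr hi).
- by move: ml; rewrite ltnNge lm.
by exists i, (fib_up 60 (N.of_nat (p ^ l)) w); rewrite -e; split=> //; rewrite -of_le -of_lt -{1}[N.of_nat (fib i)]/((N.of_nat (fib i), N.of_nat (fib i.+1)).1) -[N.of_nat (fib i.+1)]/((N.of_nat (fib i), N.of_nat (fib i.+1)).2) -hi h1.
Qed.

Lemma compositeP (p : nat) : prime p -> composite (N.of_nat p) = false.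
Proof.
move=> pp; apply/negP; rewrite /composite anyE => /hasP[q qs].
case: ifP => // /N.ltb_lt qp /N.eqb_eq /N.Div0.div_exact e.
have q1 : (1 < N.to_nat q)%N.
  have /allP/(_ q qs)/N.ltb_lt : all (N.ltb 1) small_primes by [].
  by lia.
have qd : (N.to_nat q %| p)%N.
  have := congr1 N.to_nat e; rewrite Nat2N.id N2Nat.inj_mul multE => {1}->; exact: dvdn_mulr.
move/(prime_nt_dvdP pp (negbT (gtn_eqF q1))): qd => qE.
by move: qp; rewrite -qE N2Nat.id; lia.
Qed.

Lemma run_from_mem n m p : run_from n (N.of_nat m) -> (m <= p < m + n)%N ->
  composite (N.of_nat p) = false -> run_prime (N.of_nat p).
Proof.
elim: n m => [|n IH] m /=; first by rewrite addn0 => _ /andP[h1 h2]; move: (leq_ltn_trans h1 h2); rewrite ltnn.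
case: ifP => // h hr /andP[]; rewrite leq_eqVlt => /orP[/eqP <- _ hc|mp pm hc]; first by rewrite hc in h.
by apply: (IH m.+1) hc; [rewrite Nat2N.inj_succ|rewrite mp addSnnS].
Qed.

Lemma run_prime_bound p m : prime p -> (p <= 10 * 1000)%N -> (p ^ m <= p ^ 5 * 2 ^ 156)%N ->
  exists i v, [/\ fibs_at i v, (fib i <= p ^ m < fib i.+1)%N &
                 no_hit (p == 2)%N (N.of_nat (p ^ m)) (powers p m) v].
Proof.
move=> pp hp hm; have p1 := prime_gt1 pp.
have : run_prime (N.of_nat p).
  apply: (@run_from_mem (100 * 100 - 1) 2 p run_fromP _ (compositeP pp)).
  by rewrite p1 /=; move: hp; clear; lia.
rewrite /run_prime -[2%num]/(N.of_nat 2) of_eq.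
have -> : iter 156 (N.mul (N.of_nat 2)) 1%num = N.of_nat (2 ^ 156).
  elim: (156)%N => [|n IH]; first by rewrite expn0.
  by rewrite iterS IH ofM expnS.
rewrite !ofM (_ : (p * p * (p * p * p) = p ^ 5)%N); last by rewrite !expnS expn0 muln1 !mulnA.
by move=> h; apply: (runP (l := 0) (j := 2) h).
Qed.

Lemma small_pos p C k0 k1 k2 l0 l1 l2 : prime p -> (p <= 10 * 1000)%N -> (p ^ l2 <= p ^ 5 * 2 ^ 156)%N ->
  (k0 < k1)%N -> (k1 < k2)%N -> (l0 < l1)%N -> (l1 < l2)%N ->
  (0 < C)%N -> (C <= 2 * p ^ l1)%N ->
  (fib k0 = p ^ l0 + C)%N -> (fib k1 = p ^ l1 + C)%N -> (fib k2 = p ^ l2 + C)%N -> p = 2%N /\ C = 1%N.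
Proof.
move=> pp hp hB k01 k12 l01 l12 C0 hC F0 F1 F2.
have [i [v [hv /andP[ile ilt] hn]]] := run_prime_bound pp hp hB.
have k2E : k2 = i.+1.
  have h1 : (i < k2)%N by apply: fib_ltE; move: F2 ile C0; clear; lia.
  (* F_(k_2 - 1) = F_(k_2) - F_(k_2 - 2) is at most p^l_2, because F_(k_2 - 2) >= F_(k_0) >= C. *)
  have h2 : (k2.-2.+1 < i.+1)%N.
    apply: fib_ltE; apply: leq_ltn_trans ilt; case: k2 k12 F2 {h1} => [|[|n]] //= kn; rewrite ?fibSS.
      by move=> F2; move: kn k01; clear; lia.
    have : (fib k0 <= fib n)%N by apply: fib_leq; move: k01 kn; clear; lia.
    by move: F0; clear; lia.
  by move: h1 h2 k12 k01; clear; lia.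
have e : N.sub v.2 (N.of_nat (p ^ l2)) = N.of_nat C.
  by rewrite hv -k2E -[X in N.sub X _]/(N.of_nat (fib k2)) ofB F2 addKn.
move: hn; rewrite /no_hit e => /andP[+ _].
rewrite (pos_hitP (prime_gt1 pp) hv (k0 := k0) (k1 := k1) (l0 := l0) (l1 := l1)) //.
- rewrite -[1%num]/(N.of_nat 1) of_eq => /andP[/eqP -> /eqP ->]; by [].
- by move: k01 k12 k2E; clear; lia.
by move: k01 k12 k2E; clear; lia.
Qed.

Lemma small_neg p C k0 k1 k2 l0 l1 l2 : prime p -> (p <= 10 * 1000)%N -> (p ^ l2 <= p ^ 5 * 2 ^ 156)%N ->
  (2 <= k0)%N -> (k0 < k1)%N -> (k1 < k2)%N -> (l0 < l1)%N -> (l1 < l2)%N ->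
  (0 < C)%N -> (C < p ^ l0)%N ->
  (fib k0 + C = p ^ l0)%N -> (fib k1 + C = p ^ l1)%N -> (fib k2 + C = p ^ l2)%N -> p = 2%N /\ C = 3%N.
Proof.
move=> pp hp hB k02 k01 k12 l01 l12 C0 hC F0 F1 F2.
have [i [v [hv /andP[ile ilt] hn]]] := run_prime_bound pp hp hB.
have k22 : (2 <= k2)%N by move: k02 k01 k12; clear; lia.
(* F_(k_2 + 1) is at least F_(k_2) + F_(k_1), and F_(k_1) = p^l_1 - C exceeds C because C < p^l_0 <=
   p^l_1 / 2. *)
have up : (p ^ l2 <= fib k2.+1)%N.
  case: k2 k12 F2 {hv hn k22} => // n kn F2; rewrite fibSS.
  have := fib_leq (kn : (k1 <= n)%N); have := pow2_le (prime_gt1 pp) l01; move: F1 F2 hC.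
  by move: (p ^ l0)%N (p ^ l1)%N (p ^ l2)%N (fib k1) (fib n.+1) (fib n) => *; lia.
have k2i : fib k2 = (if (fib i < p ^ l2)%N then fib i else fib i.+1 - fib i)%N.
  case: ltngtP ile => // h _.
    have h1 : (k2 < i.+1)%N by apply: fib_ltE; move: F2 ilt C0; clear; lia.
    have h2 : (i < k2.+1)%N by apply: fib_ltE; apply: leq_trans up.
    by congr fib; move: h1 h2; clear; lia.
  have h1 : (k2 < i)%N by apply: fib_ltE; move: F2 h C0; clear; lia.
  have h2 : (i <= k2.+1)%N.
    rewrite leqNgt; apply/negP => h2; have := fib_ltn (leqW k22) h2; rewrite ltnNge h up //.
  have -> : i = k2.+1 by move: h1 h2; clear; lia.
  by rewrite fibSS addKn.
have e : N.sub (N.of_nat (p ^ l2)) (if N.ltb v.1 (N.of_nat (p ^ l2)) then v.1 else N.sub v.2 v.1) = N.of_nat C.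
  rewrite hv -[(_, _).1]/(N.of_nat (fib i)) -[(_, _).2]/(N.of_nat (fib i.+1)) of_lt ofB.
  have -> : (if (fib i < p ^ l2)%N then N.of_nat (fib i) else N.of_nat (fib i.+1 - fib i)) = N.of_nat (fib k2).
    by rewrite k2i; case: ifP.
  by rewrite ofB -F2 addKn.
move: hn; rewrite /no_hit e => /andP[_].
have k2le : (k2 <= i)%N.
  have h1 : (k2 < i.+1)%N by apply: fib_ltE; move: F2 ilt C0; clear; lia.
  by rewrite -ltnS.
rewrite (neg_hitP (prime_gt1 pp) hv (k0 := k0) (k1 := k1) (l0 := l0) (l1 := l1)) //.
- rewrite -[3%num]/(N.of_nat 3) of_eq => /andP[/eqP -> /eqP ->]; by [].
- by move: k01 k12 k2le; clear; lia.
by move: k01 k12 k2le; clear; lia.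
Qed.

(** * Powers of p and exceptional triples *)

Lemma fib_addS m n : fib (m.+1 + n) = (fib m.+1 * fib n.+1 + fib m * fib n)%N.
Proof.
have [k] := ubnP n; elim: k n => // k IH [|[|n]] nk.
- by rewrite addn0 muln1 muln0 addn0.
- by rewrite addn1 !muln1.
have e1 := IH n.+1 (ltac:(lia) : (n.+1 < k)%N); have e0 := IH n (ltac:(lia) : (n < k)%N).
have f3 : fib n.+3 = (fib n.+2 + fib n.+1)%N by [].
have f2 : fib n.+2 = (fib n.+1 + fib n)%N by [].
have -> : fib (m.+1 + n.+2) = (fib (m.+1 + n.+1) + fib (m.+1 + n))%N by rewrite !addnS.
rewrite e1 e0 f3; move: f2; clear; move: (fib n) (fib n.+1) (fib n.+2) (fib m) (fib m.+1); nia.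
Qed.

Lemma coprime_fib n : coprime (fib n) (fib n.+1).
Proof.
elim: n => // n IH; rewrite fibSS /coprime gcdnDl.
by rewrite gcdnC; move: IH; rewrite /coprime.
Qed.

(** The expansion of phi^((m + 1) (n + 1)) = (u + x phi)^(n + 1) modulo x^2, read off on the
    coordinates 1 and phi. *)
Lemma fib_mul_expansion m n : let u := fib m in let x := fib m.+1 in
  exists v w, fib (m + m.+1 * n) = (u ^ n.+1 + x ^ 2 * v)%N /\
              fib (m.+1 + m.+1 * n) = (n.+1 * u ^ n * x + x ^ 2 * w)%N.
Proof.
move=> u x; elim: n => [|n [v [w [IH1 IH2]]]].
  by exists 0%N, 0%N; rewrite muln0 !addn0 expn1 expn0 !muln0 !addn0 !mul1n.
have e : (m.+1 * n.+1 = (m + m.+1 * n).+1)%N by rewrite mulnS addSn.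
have s : fib (m + m.+1 * n).+1 = fib (m.+1 + m.+1 * n) by rewrite addSn.
exists (v * u + (n.+1 * u ^ n + x * w))%N, (n.+1 * u ^ n + x * w + w * u + x * v)%N; split.
  rewrite e addnC fib_addS s IH1 IH2 -/u -/x !expnS; move: (u ^ n)%N => z; lia.
rewrite e addnC fib_addS s IH1 IH2 fibSS -/u -/x !expnS; move: (u ^ n)%N => z; lia.
Qed.

Lemma fib_dvd_mul m n : (fib m.+1 %| fib (m.+1 * n.+1))%N.
Proof.
have [v [w [_ e]]] := fib_mul_expansion m n.
rewrite mulnS e; apply: dvdn_add; first exact: dvdn_mull.
by apply: dvdn_mulr; exact: dvdn_exp.
Qed.

Lemma dvd_fib m n : (2 <= m)%N -> (fib m.+1 %| fib n)%N -> (m.+1 %| n)%N.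
Proof.
move=> m2; rewrite {1}(divn_eq n m.+1); set q := (n %/ m.+1)%N; set r := (n %% m.+1)%N => h.
have rm : (r < m.+1)%N by rewrite ltn_mod.
suff r0 : r = 0%N by rewrite /dvdn -/r r0.
have F_r : (fib m.+1 %| fib r)%N.
  case eq : q h => [|q']; first by rewrite mul0n add0n.
  have d := fib_dvd_mul m q'; rewrite [(q'.+1 * _)%N]mulnC.
  have e : (m.+1 * q'.+1 = (m + m.+1 * q').+1)%N by rewrite mulnS addSn.
  rewrite e in d *; rewrite fib_addS dvdn_addr; last by rewrite dvdn_mulr.
  rewrite Gauss_dvdr // coprime_sym; apply: coprime_dvdr d _; exact: coprime_fib.
have [//|r0] := posnP r; have : (fib r < fib m.+1)%N.
  case: r rm r0 {h F_r} => [//|[|r]] rm _; last exact: fib_ltn.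
  by apply: (@leq_trans (fib 3)) => //; exact: fib_leq.
by rewrite ltnNge dvdn_leq // -(prednK r0) fib_gt0.
Qed.

Lemma fib_two_shift m n : (2 ^ n * fib m.+2 <= fib (m.+2 + 2 * n))%N.
Proof.
elim: n => [|n IH]; first by rewrite muln0 addn0 mul1n.
have -> : (m.+2 + 2 * n.+1 = (m.+2 + 2 * n).+2)%N by lia.
rewrite [X in (_ <= X)%N]fibSS expnS -mulnA; have := fib_leq (leqnSn (m.+2 + 2 * n)%N).
by move: IH; move: (2 ^ n * _)%N (fib (m.+2 + 2 * n)) (fib (m.+2 + 2 * n).+1) => x y z; lia.
Qed.

(* If p^2 divides F_m, then F_(p m) / F_m is p times a unit modulo p^2; were it a power of p,
   it would be p, which is too small. *)
Lemma fib_pow_three (p k1 k2 l1 l2 : nat) : prime p -> (2 <= l1)%N -> (k1 < k2)%N ->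
  fib k1 = (p ^ l1)%N -> fib k2 = (p ^ l2)%N -> False.
Proof.
move=> pp l12 k12 F1 F2; have p1 := prime_gt1 pp; have p0 := prime_gt0 pp.
have F14 : (4 <= fib k1)%N by rewrite F1 (leq_trans (_ : _ <= p ^ 2)%N) ?leq_pexp2l // (@leq_mul 2 2).
have [m [k1E m2]] : exists m, k1 = m.+1 /\ (2 <= m)%N.
  by case: k1 F14 {F1 k12} => [|[|[|m]]] //; exists m.+2.
rewrite {}k1E in k12 F1 F14.
have l12' : (l1 < l2)%N by rewrite -(ltn_exp2l _ _ p1) -F1 -F2 (fib_ltn (leqW m2)).
have : (m.+1 %| k2)%N by apply: dvd_fib; rewrite // F1 F2 dvdn_exp2l // ltnW.
case/dvdnP => n k2E; rewrite mulnC in k2E.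
have n1 : (1 < n)%N.
  by move: k12; rewrite k2E -[X in (X < _)%N]muln1 ltn_pmul2l.
have pF : (p %| fib m.+1)%N by rewrite F1 dvdn_exp // ltnW.
have cop : coprime p (fib m).
  by apply: coprime_dvdl pF _; rewrite coprime_sym; exact: coprime_fib.
have pn : (p %| n)%N.
  have [v [w [_ e]]] := fib_mul_expansion m n.-1.
  rewrite -mulnS prednK ?(ltnW n1) // -k2E F2 in e.
  have : (p * fib m.+1 %| p ^ l2)%N by rewrite F1 -expnS dvdn_exp2l.
  rewrite e (_ : _ + _ = fib m.+1 * (n * fib m ^ n.-1 + fib m.+1 * w))%N; last first.
    by rewrite mulnDr mulnC expnS expn1 -!mulnA.
  rewrite [(p * _)%N]mulnC dvdn_pmul2l ?fib_gt0 // dvdn_addl; last by rewrite dvdn_mulr.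
  by rewrite Gauss_dvdl // coprimeXr.
have d : (fib (m.+1 * p) %| p ^ l2)%N.
  case/dvdnP: pn => n' n'E; rewrite -F2 k2E n'E mulnA mulnAC.
  have n'0 : (0 < n')%N by case: n' n'E n1 => // ->.
  rewrite -(prednK n'0) -(prednK (_ : 0 < m.+1 * p)%N) ?muln_gt0 //; exact: fib_dvd_mul.
have [v [w [_ e]]] := fib_mul_expansion m p.-1.
rewrite -mulnS prednK // in e.
have Fe : (fib m.+1 = p ^ 2 * p ^ (l1 - 2))%N by rewrite F1 -expnD subnKC.
have e2 : (fib (m.+1 * p) = fib m.+1 * p * (fib m ^ p.-1 + p * (p ^ (l1 - 2) * w)))%N.
  have sq : (fib m.+1 ^ 2 * w = fib m.+1 * (p ^ 2 * p ^ (l1 - 2)) * w)%N by rewrite -Fe expnS expn1.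
  rewrite e sq !expnS expn0 !muln1; move: (fib m ^ p.-1)%N (fib m.+1) (p ^ (l1 - 2))%N => x y z.
  by rewrite mulnDr; congr (_ + _)%N; [rewrite mulnC mulnA | rewrite -!mulnA].
set z := (fib m ^ p.-1 + _)%N in e2.
have zd : (z %| p ^ l2)%N by apply: dvdn_trans d; rewrite e2 dvdn_mull.
have zc : coprime p z.
  by rewrite /z addnC mulnC /coprime gcdnMDl; exact: coprimeXr.
have z1 : z = 1%N.
  by apply/eqP; move: (coprimeXl l2 zc); rewrite /coprime (gcdn_idPr zd).
rewrite z1 muln1 in e2.
case: m m2 {F1 F14 pF cop Fe z zd zc z1 w e v d k2E k12} e2 => // m m2 e2.
have h1 := fib_two_shift m p.-1.
have h2 : (fib (m.+2 + 2 * p.-1) < fib (m.+2 * p))%N.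
  by apply: fib_ltn; case: (p) p1 => // -[|q] //= _; move: m2; clear; nia.
have h3 : (p <= 2 ^ p.-1)%N by rewrite -{1}(prednK p0) ltn_expl.
by have := leq_ltn_trans h1 h2; rewrite e2 [(_ * p)%N]mulnC ltn_pmul2r ?fib_gt0 // ltnNge h3.
Qed.

Lemma traj_mod (T : eqType) (x : T) (g : T -> T) (h : nat -> T) n :
  looping g x n -> h 0 = x -> (forall k, h k.+1 = g (h k)) -> forall k, h k \in traject g x n.
Proof.
move=> /loopingP lp h0 hS k; have -> : h k = iter k g x; last exact: lp.
by elim: k => // k IH; rewrite hS IH iterS.
Qed.

Definition fib_mod_step (M : nat) (w : nat * nat) : nat * nat := (w.2, (w.1 + w.2) %% M)%N.
Definition pow_mod_step (M x : nat) : nat := (2 * x %% M)%N.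

(** [looping] certifies that n and m steps exhaust the two orbits modulo M, so finitely many pairs
    of residues decide for all k and l. Starting the powers at 2^l0 leaves out the solutions that do
    exist. *)
Lemma fib_pow_residue (M a b l0 n m : nat) :
  looping (fib_mod_step M) (0 %% M, 1 %% M)%N n -> looping (pow_mod_step M) (2 ^ l0 %% M)%N m ->
  all (fun w => all (fun x => ((w.1 + a) %% M != (x + b) %% M)%N) (traject (pow_mod_step M) (2 ^ l0 %% M)%N m))
    (traject (fib_mod_step M) (0 %% M, 1 %% M)%N n) ->
  forall k l, (l0 <= l)%N -> (fib k + a = 2 ^ l + b)%N -> False.
Proof.
move=> lf lp /allP hall k l ll e.
have hf : (fib k %% M, fib k.+1 %% M)%N \in traject (fib_mod_step M) (0 %% M, 1 %% M)%N n.
  apply: (traj_mod (h := fun k => (fib k %% M, fib k.+1 %% M)%N) lf) => // j.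
  by rewrite /fib_mod_step /= modnDm addnC.
have hp : (2 ^ l %% M)%N \in traject (pow_mod_step M) (2 ^ l0 %% M)%N m.
  rewrite -(subnKC ll).
  apply: (traj_mod (h := fun j => (2 ^ (l0 + j) %% M)%N) lp) => [|j]; first by rewrite addn0.
  by rewrite /pow_mod_step modnMmr addnS expnS.
have /allP/(_ _ hp) /= := hall _ hf.
by rewrite !modnDml e eqxx.
Qed.

(* For p = 2 the triples of solutions (3, 0), (4, 1), (5, 2) with c = 1 and (2, 2), (5, 3), (7, 4)
   with c = -3 exist; congruences exclude a fourth one. *)
Lemma fib_pow_plus1 k l : (3 <= l)%N -> fib k = (2 ^ l + 1)%N -> False.
Proof.
move=> l3 e; apply: (@fib_pow_residue 144 0 1 3 24 10 _ _ _ k l l3); try by vm_compute.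
by rewrite addn0.
Qed.

Lemma fib_pow_minus3 k l : (5 <= l)%N -> (fib k + 3 = 2 ^ l)%N -> False.
Proof.
move=> l3 e; apply: (@fib_pow_residue 2016 3 0 5 48 10 _ _ _ k l l3); try by vm_compute.
by rewrite addn0.
Qed.

Lemma no_five_solutions (p : nat) (c : int) (k l : nat -> nat) : prime p -> (2 <= k 0)%N ->
  (forall i j, (i < j)%N -> (j <= 4)%N -> (k i < k j)%N) ->
  (forall i j, (i < j)%N -> (j <= 4)%N -> (l i < l j)%N) ->
  (forall i, (i <= 4)%N -> (fib (k i))%:Z = (p ^ l i)%:Z + c) -> False.
Proof.
move=> pp k02 hk hl hF; have p1 := prime_gt1 pp.
have k01 := hk _ _ (isT : (0 < 1)%N) isT; have k12 := hk _ _ (isT : (1 < 2)%N) isT.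
have k23 := hk _ _ (isT : (2 < 3)%N) isT.
have l01 := hl _ _ (isT : (0 < 1)%N) isT; have l12 := hl _ _ (isT : (1 < 2)%N) isT.
have l23 := hl _ _ (isT : (2 < 3)%N) isT.
have toN m : (p%:R : realalg) ^+ m <= p%:R ^+ 5 * 2 ^+ 156 -> (p ^ m <= p ^ 5 * 2 ^ 156)%N.
  by rewrite -(ler_nat realalg) natrM !natrX.
case: c hF => [[|C]|C] hF.
(* Here c = 0. The smaller power must be divisible by p^2, which solution 2 guarantees since l_0 <
   l_1 < l_2. *)
- apply: (@fib_pow_three p (k 2%N) (k 3%N) (l 2%N) (l 3%N) pp _ k23).
  + by move: l01 l12; clear; lia.
  + by have := hF 2%N isT; rewrite addr0 => -[].
  by have := hF 3%N isT; rewrite addr0 => -[].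
- have {}hF i : (i <= 4)%N -> (fib (k i) = p ^ l i + C.+1)%N by move=> /hF [].
  have [c1 c2] := constraints_pos realalg pp (ltn0Sn C) k02 hk hl hF.
  have Cle := pos_le pp (ltn0Sn C) k02 hk hl hF.
  case: (leqP p (10 * 1000)) => hp.
    have [p2 C1] := small_pos pp hp (toN _ (c1 hp)) k01 k12 l01 l12 (ltn0Sn C) Cle
      (hF 0%N isT) (hF 1%N isT) (hF 2%N isT).
    apply: (@fib_pow_plus1 (k 3%N) (l 3%N)); first by move: l01 l12 l23; clear; lia.
    by rewrite hF // p2 C1.
  have [a1 a2 a3] := c2 (ltnW hp).
  exact: (large_pos realalg (ltnW hp) k02 k01 k12 l01 l12 (ltn0Sn C) Cle a1 a2 a3
    (hF 0%N isT) (hF 1%N isT) (hF 2%N isT)).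
have {}hF i : (i <= 4)%N -> (fib (k i) + C.+1 = p ^ l i)%N.
  by move=> /hF; rewrite NegzE => h; move: h; move: (p ^ l i)%N (fib (k i)) => x y; lia.
have [c1 c2] := constraints_neg realalg pp (ltn0Sn C) k02 hk hl hF.
have Clt : (C.+1 < p ^ l 0)%N.
  by rewrite -hF // -[X in (X < _)%N]add0n ltn_add2r -(prednK (ltnW k02)) fib_gt0.
case: (leqP p (10 * 1000)) => hp.
  have [p2 C1] := small_neg pp hp (toN _ (c1 hp)) k02 k01 k12 l01 l12 (ltn0Sn C) Clt
    (hF 0%N isT) (hF 1%N isT) (hF 2%N isT).
  apply: (@fib_pow_minus3 (k 3%N) (l 3%N)); last by have := hF 3%N isT; rewrite p2 C1.
  (* 2^l_0 > 3 forces l_0 >= 2, hence l_3 >= 5. *)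
  have l02 : (2 <= l 0)%N by rewrite leqNgt; apply/negP => h; move: Clt; rewrite p2 C1; case: (l 0%N) h => [|[|]].
  by move: l01 l12 l23 l02; clear; lia.
have [a1 a2] := c2 (ltnW hp).
have e : (l 1 + (l 2 - l 1) = l 2)%N by rewrite subnKC // ltnW.
(* Solutions 1 and 2 are used because |c| < p^l_0 makes c negligible only from p^l_1 on. *)
apply: (@large_neg realalg p C.+1 (k 1%N) (k 2%N) (l 1%N) (l 2 - l 1)%N (ltnW hp)); rewrite ?e ?hF ?subn_gt0 //.
- exact: leq_trans k02 (ltnW k01).
- exact: leq_trans k02 (ltnW (ltn_trans k01 k12)).
- apply: (@leq_trans (p ^ (l 0%N).+1)); last by rewrite leq_pexp2l // prime_gt0.
  by rewrite expnS leq_mul2l ltnW ?orbT.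
- by move: a1 l01; clear; lia.
by move: a1 a2 l01; clear; lia.
Qed.


(* m_{F,p}(c) <= 4: every finite collection of distinct solutions (k,l)
   has at most 4 elements (equivalently the solution set is finite of
   cardinality at most 4). *)
Theorem theorem1p1 (p : nat) (c : int) (s : seq (nat * nat)) :
  prime p -> uniq s -> all (is_rep p c) s -> (size s <= 4)%N.
Proof.
move=> pp us /allP hs; rewrite leqNgt; apply/negP => sz.
have p1 := prime_gt1 pp.
pose t := sort (relpre fst leq) s.
have tE : map fst t = sort leq (map fst s) by rewrite sort_map.
have mem_t kl : kl \in t -> is_rep p c kl by rewrite mem_sort; exact: hs.
(* k determines l, so the solutions can be listed by strictly increasing k, and l increases along
   with it. *)
have inj : {in s &, injective fst}.
  move=> [k l] [k' l'] /hs /andP[_ /eqP e] /hs /andP[_ /eqP e'] /= kk; subst k'.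
  congr (_, _); apply/eqP; rewrite -(eqn_exp2l _ _ p1) -eqz_nat; apply/eqP.
  by move: e; rewrite e' => /addrI /oppr_inj.
have st : sorted ltn (map fst t).
  by rewrite ltn_sorted_uniq_leq tE sort_uniq map_inj_in_uniq // us sort_sorted //; exact: leq_total.
have szt : size t = size s by rewrite size_sort.
pose k i := (nth (0, 0)%N t i).1; pose l i := (nth (0, 0)%N t i).2.
have rep i : (i <= 4)%N -> (2 <= k i)%N /\ (fib (k i))%:Z = (p ^ l i)%:Z + c.
  move=> i4; have /mem_t /andP[h1 /eqP h2] : nth (0, 0)%N t i \in t.
    by rewrite mem_nth // szt (leq_ltn_trans i4).
  by split=> //; rewrite h2 addrC subrK.
have hk i j : (i < j)%N -> (j <= 4)%N -> (k i < k j)%N.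
  move=> ij j4; have jt : (j < size t)%N by rewrite szt (leq_ltn_trans j4).
  have it := ltn_trans ij jt.
  have kE n : (n < size t)%N -> k n = nth 0%N (map fst t) n by move=> h; rewrite (nth_map (0, 0)%N).
  rewrite !kE //; have := @sorted_ltn_nth _ ltn (fun y x z => @ltn_trans y x z) 0%N _ st i j.
  by rewrite !inE !size_map; apply.
have hl i j : (i < j)%N -> (j <= 4)%N -> (l i < l j)%N.
  move=> ij j4; rewrite -(ltn_exp2l _ _ p1).
  have [k2 Fi] := rep i (ltnW (leq_trans ij j4)); have [_ Fj] := rep j j4.
  by have := fib_ltn k2 (hk i j ij j4); move: Fi Fj; clear; lia.
apply: (no_five_solutions pp _ hk hl); first by have [] := rep 0%N isT.
by move=> i i4; have [_ ->] := rep i i4.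
Qed.
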